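(* Suppose that $\varphi(s)=\sum_{n=1}^\infty c_nn^{-s}$ is the symbol of a composition operator $C_\varphi$ on $\mathcal{H}^2$ and that $\varphi(\mathbb{C}_0)$ is a bounded subset of $\mathbb{C}_{1/2}$. Then $C_\varphi$ is a compact operator on $\mathcal{H}^2$ if and only if $$\limsup_{\ell(Q)\to0}\frac{m_\infty\left((\Phi^* )^{-1}(Q)\right)}{\ell(Q)}=0,$$ where the limsup is taken over Carleson squares $Q$ in $\overline{\mathbb{C}_{1/2}}$ whose side length $\ell(Q)$ tends to $0$.
   Context: $\mathbb{C}_\theta=\{s\in\mathbb{C}:\operatorname{Re}s>\theta\}$. $\mathcal{H}^2$ is the Hilbert space of Dirichlet series $f(s)=\sum_{n\ge1} b_n n^{-s}$ with $\|f\|_{\mathcal{H}^2}^2=\sum_n |b_n|^2<\infty$, analytic in $\mathbb{C}_{1/2}$, and $C_\varphi f=f\circ\varphi$. The Dirichlet series $\varphi$ is analytic in $\mathbb{C}_0$ (converging uniformly in $\mathbb{C}_\varepsilon$ for each $\varepsilon>0$), and under the hypothesis $C_\varphi$ is bounded on $\mathcal{H}^2$ by the Gordon-Hedenmalm theorem. Let $p_1<p_2<\dots$ be the primes; for $n=\prod_jp_j^{\alpha_j}$ write $\alpha(n)=(\alpha_1,\alpha_2,\dots)$. The Bohr lift of $\varphi$ is $\Phi(z)=\sum_nc_nz^{\alpha(n)}$, obtained by replacing $p_j^{-s}$ by $z^{(j)}$, where $z=(z^{(1)},z^{(2)},\dots)$. Since $\varphi$ is bounded, $\varphi\in\mathcal{H}^2$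 and $\Phi$ has a boundary function $\Phi^*\in L^2(\mathbb{T}^\infty)$ with values in $\overline{\mathbb{C}_{1/2}}$, namely the function with Fourier series $\sum_nc_nz^{\alpha(n)}$. $m_\infty$ is normalized Haar measure on $\mathbb{T}^\infty$. A Carleson square in $\overline{\mathbb{C}_{1/2}}$ is a closed square with one side on the line $\operatorname{Re}s=1/2$; $\ell(Q)$ is its side length. *)

(* Defs.v *)
From HB Require Import structures.
From mathcomp Require Import all_boot all_order all_algebra.
From mathcomp Require Import complex.
From mathcomp Require Import all_classical all_reals all_analysis.
From mathcomp Require Import ring lra.

Set Implicit Arguments.
Unset Strict Implicit.
Unset Printing Implicit Defensive.
Import Order.TTheory GRing.Theory Num.Theory numFieldNormedType.Exports.

Local Open Scope classical_set_scope.
Local Open Scope ring_scope.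
Local Open Scope complex_scope.

(* R[i] receives the topology that every numFieldType has; its norm is
   R[i]-valued. *)
HB.instance Definition _ (R : realType) :=
  NormedModule.copy R[i] (R[i] : numFieldType)^o.

Definition halfplane (R : realType) (theta : R) : set R[i] :=
  [set s | theta < complex.Re s].

(* The principal value of n^{-s} = exp(- s log n), meant for n >= 1. *)
Definition nat_cpowN (R : realType) (n : nat) (s : R[i]) : R[i] :=
  (expR (- (complex.Re s * ln n%:R)))%:C *
  (cos (complex.Im s * ln n%:R) -i* sin (complex.Im s * ln n%:R)).

(* A sequence b : nat -> R[i] stands for the Dirichlet series
   sum_{n >= 1} b_n n^{-s} with a shift of index: b k is the coefficient of
   (k + 1)^{-s}. *)
Definition dirichlet (R : realType) (b : nat -> R[i]) (N : nat) (s : R[i]) :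
  R[i] := \sum_(k < N) b k * nat_cpowN k.+1 s.

Definition sqsummable (R : realType) : {pred nat -> R[i]} :=
  fun b => `[< cvgn (series (fun k => Normc.normc (b k) ^+ 2)) >].

Section sqsummable_theory.
Variable R : realType.
Implicit Types b c : nat -> R[i].

Local Notation nc := (@Normc.normc R).
Local Notation sq b := (series (fun k => nc (b k) ^+ 2)).

Lemma sqrD_le (x p q r : R) : 0 <= x -> x <= p * q + r ->
  x ^+ 2 <= 2 * p ^+ 2 * q ^+ 2 + 2 * r ^+ 2.
Proof.
move=> x0 xle; have : x ^+ 2 <= (p * q + r) ^+ 2.
  by apply: lerXn2r => //; exact: le_trans xle.
have := sqr_ge0 (p * q - r).
nra.
Qed.

Lemma young_le (t x p q : R) : 0 < t -> 0 <= x -> x <= p + q ->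
  x ^+ 2 <= (1 + t) * p ^+ 2 + (1 + t^-1) * q ^+ 2.
Proof.
move=> t0 x0 xle; have : x ^+ 2 <= (p + q) ^+ 2.
  by apply: lerXn2r => //; exact: le_trans xle.
move=> /le_trans; apply; rewrite -subr_ge0.
rewrite (_ : _ - _ = t^-1 * (t * p - q) ^+ 2); last by field; rewrite gt_eqF.
by rewrite mulr_ge0 ?sqr_ge0// invr_ge0 ltW.
Qed.

Lemma normc_ge0 (z : R[i]) : 0 <= nc z.
Proof. by case: z => x y; rewrite /Normc.normc sqrtr_ge0. Qed.

Lemma sqsummableE b : (b \in @sqsummable R) = `[< cvgn (sq b) >].
Proof. by []. Qed.

Lemma sq_nd b : nondecreasing_seq (sq b).
Proof. by apply: nondecreasing_series => k _ _; exact: sqr_ge0. Qed.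

Lemma sq_le b : cvgn (sq b) -> forall n, sq b n <= limn (sq b).
Proof. by move=> cb; apply: nondecreasing_cvgn_le => //; exact: sq_nd. Qed.

Lemma sq_lim_ge0 b : cvgn (sq b) -> 0 <= limn (sq b).
Proof. by move=> /sq_le /(_ 0%N); rewrite /series/= big_geq. Qed.

Lemma sq_bounded b (M : R) : (forall n, sq b n <= M) ->
  cvgn (sq b) /\ limn (sq b) <= M.
Proof.
move=> bM; have cb : cvgn (sq b).
  apply: nondecreasing_is_cvgn; first exact: sq_nd.
  by exists M => _ [n _ <-]; exact: bM.
by split => //; apply: limr_le => //; apply: nearW => n; exact: bM.
Qed.

Lemma sqsummable_submod_closed : submod_closed (@sqsummable R).
Proof.
split=> [|a u v].
  apply/asboolP; suff /sq_bounded[] : forall n, sq (0 : nat -> R[i]) n <= 0 by [].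
  move=> n; rewrite /series [leLHS]big1// => k _.
  by rewrite (_ : nc _ = 0) ?expr0n//; exact: Normc.normc0.
move=> /asboolP cu /asboolP cv; apply/asboolP.
suff /sq_bounded[] : forall n, sq (a *: u + v) n <=
  2 * nc a ^+ 2 * limn (sq u) + 2 * limn (sq v) by [].
move=> n; apply: (@le_trans _ _ (2 * nc a ^+ 2 * sq u n + 2 * sq v n)); last first.
  rewrite lerD// ler_wpM2l ?sq_le//.
  by rewrite mulr_ge0// sqr_ge0.
rewrite /series/= !mulr_sumr -big_split/=; apply: ler_sum => k _.
apply: sqrD_le; first exact: normc_ge0.
by rewrite -Normc.normcM; exact: le_normcD.
Qed.

HB.instance Definition _ :=
  GRing.isSubmodClosed.Build R[i] (nat -> R[i]) (@sqsummable R)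
    sqsummable_submod_closed.

End sqsummable_theory.

Record H2 (R : realType) :=
  MkH2 { H2_coef :> nat -> R[i]; H2_coefP : H2_coef \in @sqsummable R }.

Section H2_normed.
Variable R : realType.

HB.instance Definition _ := [isSub for @H2_coef R].
HB.instance Definition _ := [Choice of H2 R by <:].
HB.instance Definition _ := [SubChoice_isSubLmodule of H2 R by <:].

Local Notation nc := (@Normc.normc R).
Local Notation sq b := (series (fun k => nc (b k) ^+ 2)).

Definition H2_rnorm (f : H2 R) : R := Num.sqrt (limn (sq f)).

Lemma H2_cvg (f : H2 R) : cvgn (sq f).
Proof. by have := H2_coefP f; rewrite sqsummableE => /asboolP. Qed.

Lemma H2_rnorm_sqr (f : H2 R) : H2_rnorm f ^+ 2 = limn (sq f).
Proof. by rewrite sqr_sqrtr// sq_lim_ge0//; exact: H2_cvg. Qed.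

Lemma H2_rnorm_ge0 (f : H2 R) : 0 <= H2_rnorm f.
Proof. exact: sqrtr_ge0. Qed.

Lemma H2_sq_le (f : H2 R) n : sq f n <= H2_rnorm f ^+ 2.
Proof. by rewrite H2_rnorm_sqr; apply: sq_le; exact: H2_cvg. Qed.

Lemma H2_rnorm_le (f : H2 R) (M : R) : 0 <= M ->
  (forall n, sq f n <= M ^+ 2) -> H2_rnorm f <= M.
Proof.
move=> M0 /sq_bounded[_ fM].
by rewrite -[leRHS](ger0_norm M0) -sqrtr_sqr ler_wsqrtr.
Qed.

Lemma H2_rnorm0_eq0 (f : H2 R) : H2_rnorm f = 0 -> f = 0.
Proof.
move=> f0; apply/val_inj/funext => k.
apply/Normc.eq0_normc/eqP; rewrite -sqrf_eq0 eq_le sqr_ge0 andbT.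
have := H2_sq_le f k.+1; rewrite f0 expr0n/=; apply: le_trans.
by rewrite /series/= big_nat_recr//= lerDr sumr_ge0// => i _; exact: sqr_ge0.
Qed.

Lemma H2_rnormZ_le (a : R[i]) (f : H2 R) : H2_rnorm (a *: f) <= nc a * H2_rnorm f.
Proof.
apply: H2_rnorm_le => [|n]; first by rewrite mulr_ge0 ?normc_ge0 ?H2_rnorm_ge0.
rewrite exprMn; apply: le_trans (ler_wpM2l (sqr_ge0 _) (H2_sq_le f n)).
rewrite /series/= mulr_sumr; apply: ler_sum => k _.
by rewrite -exprMn -Normc.normcM.
Qed.

Lemma H2_rnormZ (a : R[i]) (f : H2 R) : H2_rnorm (a *: f) = nc a * H2_rnorm f.
Proof.
apply/eqP; rewrite eq_le H2_rnormZ_le/=.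
have [->|a0] := eqVneq a 0.
  by rewrite [X in X * _](_ : _ = 0) ?mul0r ?H2_rnorm_ge0//; exact: Normc.normc0.
have := H2_rnormZ_le a^-1 (a *: f); rewrite scalerA mulVf// scale1r.
have na0 : 0 < nc a.
  rewrite lt_neqAle normc_ge0 andbT eq_sym.
  by apply: contra a0 => /eqP/Normc.eq0_normc ->.
by rewrite Normc.normcV ler_pdivlMl.
Qed.

Lemma H2_ler_rnormD (f g : H2 R) : H2_rnorm (f + g) <= H2_rnorm f + H2_rnorm g.
Proof.
have [/H2_rnorm0_eq0 ->|f0] := eqVneq (H2_rnorm f) 0.
  by rewrite add0r lerDr H2_rnorm_ge0.
have [/H2_rnorm0_eq0 ->|g0] := eqVneq (H2_rnorm g) 0.
  by rewrite addr0 lerDl H2_rnorm_ge0.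
have {}f0 : 0 < H2_rnorm f by rewrite lt_neqAle eq_sym f0 H2_rnorm_ge0.
have {}g0 : 0 < H2_rnorm g by rewrite lt_neqAle eq_sym g0 H2_rnorm_ge0.
apply: H2_rnorm_le => [|n]; first by rewrite addr_ge0// ltW.
set t := H2_rnorm g / H2_rnorm f.
have t0 : 0 < t by rewrite divr_gt0.
have -> : (H2_rnorm f + H2_rnorm g) ^+ 2 =
    (1 + t) * H2_rnorm f ^+ 2 + (1 + t^-1) * H2_rnorm g ^+ 2.
  by rewrite /t; field; rewrite !gt_eqF.
have t1 : 0 <= 1 + t by rewrite addr_ge0// ltW.
have tV1 : 0 <= 1 + t^-1 by rewrite addr_ge0// invr_ge0 ltW.
apply: le_trans (lerD (ler_wpM2l t1 (H2_sq_le f n)) (ler_wpM2l tV1 (H2_sq_le g n))).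
rewrite /series/= !mulr_sumr -big_split/=; apply: ler_sum => k _.
apply: young_le => //; first exact: normc_ge0.
exact: le_normcD.
Qed.

Definition H2_norm (f : H2 R) : R[i] := (H2_rnorm f)%:C.

Lemma H2_ler_normD (f g : H2 R) : H2_norm (f + g) <= H2_norm f + H2_norm g.
Proof. by rewrite /H2_norm -rmorphD lecR H2_ler_rnormD. Qed.

Lemma H2_normZ (a : R[i]) (f : H2 R) : H2_norm (a *: f) = `|a| * H2_norm f.
Proof. by rewrite /H2_norm H2_rnormZ rmorphM. Qed.

Lemma H2_norm0_eq0 (f : H2 R) : H2_norm f = 0 -> f = 0.
Proof. by move=> [] /H2_rnorm0_eq0. Qed.

HB.instance Definition _ := Lmodule_isNormed.Build R[i] (H2 R)
  H2_ler_normD H2_normZ H2_norm0_eq0.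

End H2_normed.

Definition H2_eval (R : realType) (f : H2 R) (s : R[i]) : R[i] :=
  limn (fun N => dirichlet f N s).

Definition is_composition_operator (R : realType) (phi : R[i] -> R[i])
    (C_phi : {linear H2 R -> H2 R}) :=
  forall (f : H2 R) (s : R[i]), halfplane (1 / 2) s ->
    H2_eval (C_phi f) s = H2_eval f (phi s).

Definition compact_operator (K : numFieldType) (V W : normedModType K)
    (T : {linear V -> W}) :=
  forall A : set V, bounded_set A -> precompact (T @` A).

Definition circle (R : realType) := {z : R[i] | `|z| == 1}.

Lemma circle1_subproof (R : realType) : `|1 : R[i]| == 1.
Proof. by rewrite normr1. Qed.

HB.instance Definition _ (R : realType) := Choice.on (circle R).
HB.instance Definition _ (R : realType) :=
  isPointed.Build (circle R) (exist _ 1 (circle1_subproof R)).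

Lemma circle_mul_subproof (R : realType) (w z : circle R) :
  `|val w * val z| == 1.
Proof. by rewrite normrM (eqP (valP w)) (eqP (valP z)) mulr1. Qed.

Definition circle_mul (R : realType) (w z : circle R) : circle R :=
  exist _ (val w * val z) (circle_mul_subproof w z).

Definition torus_cylinder (R : realType) : set (set (nat -> circle R)) :=
  [set A | exists (j : nat) (U : set R[i]),
    open U /\ A = [set z | U (val (z j))]].

(* The product sigma-algebra; the circle being second countable, it is the
   Borel sigma-algebra of the product topology. *)
Notation torus R := (g_sigma_algebraType (@torus_cylinder R)).

Definition torus_mul (R : realType) (w z : torus R) : torus R :=
  fun j => circle_mul (w j) (z j).

Definition is_haar (R : realType) (m : probability (torus R) R) :=
  forall (w : torus R) (A : set (torus R)), measurable A ->
    m (torus_mul w @^-1` A) = m A.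

Lemma next_prime_subproof (n : nat) : exists p : nat, (n < p)%N && prime p.
Proof. by have [p np pp] := prime_above n; exists p; rewrite np. Qed.

Definition next_prime (n : nat) : nat := ex_minn (next_prime_subproof n).

(* Primes are numbered from 0: nth_prime 0 = 2. *)
Definition nth_prime (j : nat) : nat := iter j.+1 next_prime 0%N.

(* An exponent nu : seq int stands for the finitely supported sequence
   (nu_0, nu_1, ..., 0, 0, ...). *)
Definition character (R : realType) (nu : seq int) (z : torus R) : R[i] :=
  \prod_(j < size nu) (val (z j) : R[i]) ^ (nu`_j)%R.

(* The n with alpha(n) = nu, when all the entries of nu are nonnegative. *)
Definition prime_power_product (nu : seq int) : nat :=
  (\prod_(j < size nu) nth_prime j ^ `|(nu`_j)%R|)%N.

Definition fourier_coef (R : realType) (m : probability (torus R) R)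
    (F : torus R -> R[i]) (nu : seq int) : R[i] :=
  (\int[m]_z complex.Re (F z * (character nu z)^*)) +i*
  (\int[m]_z complex.Im (F z * (character nu z)^*)).

(* F is in L^2(T^oo) and has Fourier series sum_n c_n z^{alpha(n)}, the
   coefficients c being shifted as in dirichlet. *)
Definition is_boundary_function (R : realType) (m : probability (torus R) R)
    (c : nat -> R[i]) (F : torus R -> R[i]) :=
  [/\ (fun z => complex.Re (F z)) \in Lfun m 2%:E,
      (fun z => complex.Im (F z)) \in Lfun m 2%:E &
      forall nu : seq int, fourier_coef m F nu =
        if all (fun k => 0 <= k) nu then c (prime_power_product nu).-1 else 0].

(* Q = (t, l) stands for the closed square [1/2, 1/2 + l] x [t, t + l]. *)
Definition carleson_square (R : realType) (Q : R * R) : set R[i] :=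
  [set s | 1 / 2 <= complex.Re s <= 1 / 2 + Q.2 /\
           Q.1 <= complex.Im s <= Q.1 + Q.2].

(* The filter l(Q) -> 0 on Carleson squares: l(Q) is small and positive, the
   position of Q is unconstrained. *)
Definition carleson_to0 (R : realType) : set_system (R * R) :=
  filter_from [set d : R | 0 < d] (fun d => [set Q | 0 < Q.2 < d]).

(* Main.v *)
(* A Dirichlet polynomial and its Bohr lift have the same coefficients, hence
   the lift has L^2 norm equal to the H^2 norm, and it inherits almost
   everywhere the bounds that the polynomial satisfies on the imaginary axis.
   Approximating phi(. + x) by Dirichlet polynomials simultaneously on the
   half-plane and, after lifting, in L^2(m), gives
   |C_phi f|^2 = int |f(Phi^* )|^2 dm for every Dirichlet polynomial f, so that
   C_phi is the embedding of H^2 into L^2(mu), mu being the law of Phi^*.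

   Compactness implies the Carleson condition: the functions
   sqrt(l) sum_(n <= e^(1/l)) n^(-1/2 + it) n^(-s) are bounded in H^2, tend to 0
   at every point of C_(1/2) when l -> 0, uniformly in t, and have modulus at
   least c / sqrt(l) on the square of side l above 1/2 + it.

   Conversely, let f have only coefficients of index n >= M. Where
   Re s >= 1/2 + delta, |f| is small for M large. The part of mu where
   Re s < 1/2 + delta is replaced by point masses on a fine grid, and the
   embedding is estimated by duality: its Gram kernel sum_n n^(-1-z) has real
   part Re (1/z) + O(1), which is a Poisson kernel, and the form defined by that
   kernel has norm O(epsilon) as soon as squares of side l <= delta have mass at
   most epsilon l. Hence C_phi is small on series with no coefficient below M,
   which makes it compact. *)
Require Import Defs.
From HB Require Import structures.
From mathcomp Require Import all_boot all_order all_algebra.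
From mathcomp Require Import complex.
From mathcomp Require Import all_classical all_reals all_analysis.
From mathcomp Require Import measurable_realfun.
From mathcomp Require Import ring lra.

Set Implicit Arguments.
Unset Strict Implicit.
Unset Printing Implicit Defensive.
Import Order.TTheory GRing.Theory Num.Theory numFieldNormedType.Exports.

Local Open Scope classical_set_scope.
Local Open Scope ring_scope.
Local Open Scope complex_scope.

(** * Modulus and exponential *)

(** The boundary function is known only through its Fourier coefficients, so every pointwise fact
    about it is extracted from Dirichlet polynomials close to it in [L^2]. This works because
    [n^(-s)] and the characters are both completely multiplicative: an algebraic identity whose
    coefficients do not depend on the evaluation holds at once on the half-plane and on the torus.
    Powers of polynomials give the almost everywhere bounds, and a polynomial approximation of
    [e^(-w)] gives substitution into [n^(-w)].

    The Gram kernel is singular at the boundary line and only its real part is controlled. Hence the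
    point masses sit at positive distance from the line, where the partial sums of the kernel are
    uniformly close to their limit, and the duality is run with real functions, the imaginary part
    of [f] being recovered from [- i f]. The grid then depends on the polynomial, so it is essential
    that the embedding constant does not depend on the mesh.

    Compactness is handled with ultrafilters, along which bounded coefficients converge without
    extracting subsequences. *)

Notation nc := (@Normc.normc _).
Arguments Normc.normc : simpl never.

Section ComplexModulus.
Variable R : realType.
Implicit Types (x y : R) (z w : R[i]).

Lemma nc_sqr z : nc z ^+ 2 = complex.Re z ^+ 2 + complex.Im z ^+ 2.
Proof.
by case: z => x y; rewrite /Normc.normc sqr_sqrtr// addr_ge0// sqr_ge0.
Qed.

Lemma nc0 : nc (0 : R[i]) = 0.
Proof. exact: Normc.normc0. Qed.

Lemma nc1 : nc (1 : R[i]) = 1.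
Proof. exact: Normc.normc1. Qed.

Lemma ncM z w : nc (z * w) = nc z * nc w.
Proof. exact: Normc.normcM. Qed.

Lemma ncN z : nc (- z) = nc z.
Proof. exact: normcN. Qed.

Lemma ncD z w : nc (z + w) <= nc z + nc w.
Proof. exact: le_normcD. Qed.

Lemma ncB z w : nc (z - w) <= nc z + nc w.
Proof. by rewrite -(ncN w) ncD. Qed.

Lemma ncBC z w : nc (z - w) = nc (w - z).
Proof. by rewrite -ncN opprB. Qed.

Lemma ncR x : nc x%:C = `|x|.
Proof. by rewrite /Normc.normc/= expr0n addr0 sqrtr_sqr. Qed.

Lemma nc_nat (n : nat) : nc (n%:R : R[i]) = n%:R.
Proof. by rewrite -(rmorph_nat (real_complex R)) ncR normr_nat. Qed.

Lemma ncX z n : nc (z ^+ n) = nc z ^+ n.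
Proof. by elim: n => [|n IH]; rewrite ?expr0 ?nc1// !exprS ncM IH. Qed.

Lemma ncV z : nc z^-1 = (nc z)^-1.
Proof. exact: Normc.normcV. Qed.

Lemma nc_eq0 z : (nc z == 0) = (z == 0).
Proof. by apply/eqP/eqP => [/Normc.eq0_normc//|->]; exact: nc0. Qed.

Lemma nc_conj z : nc z^* = nc z.
Proof. by case: z => x y; rewrite /Normc.normc /= sqrrN. Qed.

Lemma nc_Re z : `|complex.Re z| <= nc z.
Proof.
rewrite -[leRHS](ger0_norm (normc_ge0 z)) -!sqrtr_sqr ler_wsqrtr//.
by rewrite nc_sqr lerDl sqr_ge0.
Qed.

Lemma nc_Im z : `|complex.Im z| <= nc z.
Proof.
rewrite -[leRHS](ger0_norm (normc_ge0 z)) -!sqrtr_sqr ler_wsqrtr//.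
by rewrite nc_sqr lerDr sqr_ge0.
Qed.

Lemma nc_le_ReIm z : nc z <= `|complex.Re z| + `|complex.Im z|.
Proof.
rewrite -(@ler_pXn2r _ 2)// ?nnegrE ?addr_ge0 ?normc_ge0//.
rewrite nc_sqr -(real_normK (num_real (complex.Re z))).
rewrite -(real_normK (num_real (complex.Im z))).
have := normr_ge0 (complex.Re z); have := normr_ge0 (complex.Im z); nra.
Qed.

Lemma nc_sum (I : Type) (r : seq I) (P : pred I) (F : I -> R[i]) :
  nc (\sum_(i <- r | P i) F i) <= \sum_(i <- r | P i) nc (F i).
Proof.
elim/big_ind2 : _ => [|x1 x2 y1 y2 H1 H2|//]; first by rewrite nc0.
by apply: le_trans (ncD _ _) _; rewrite lerD.
Qed.

Lemma ReD z w : complex.Re (z + w) = complex.Re z + complex.Re w.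
Proof. by case: z; case: w. Qed.

Lemma ImD z w : complex.Im (z + w) = complex.Im z + complex.Im w.
Proof. by case: z; case: w. Qed.

Lemma ReN z : complex.Re (- z) = - complex.Re z.
Proof. by case: z. Qed.

Lemma ImN z : complex.Im (- z) = - complex.Im z.
Proof. by case: z. Qed.

Lemma ReM z w : complex.Re (z * w) =
  complex.Re z * complex.Re w - complex.Im z * complex.Im w.
Proof. by case: z; case: w. Qed.

Lemma ImM z w : complex.Im (z * w) =
  complex.Re z * complex.Im w + complex.Im z * complex.Re w.
Proof. by case: z; case: w. Qed.

Lemma Re_conj z : complex.Re z^* = complex.Re z.
Proof. by case: z. Qed.

Lemma Im_conj z : complex.Im z^* = - complex.Im z.
Proof. by case: z. Qed.

Lemma ReZ x z : complex.Re (x%:C * z) = x * complex.Re z.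
Proof. by rewrite ReM /= mul0r subr0. Qed.

Lemma ImZ x z : complex.Im (x%:C * z) = x * complex.Im z.
Proof. by rewrite ImM /= mul0r addr0. Qed.

Lemma Re_sum (I : Type) (r : seq I) (P : pred I) (F : I -> R[i]) :
  complex.Re (\sum_(i <- r | P i) F i) = \sum_(i <- r | P i) complex.Re (F i).
Proof. by elim/big_ind2 : _ => // x1 x2 y1 y2 <- <-; rewrite ReD. Qed.

Lemma Im_sum (I : Type) (r : seq I) (P : pred I) (F : I -> R[i]) :
  complex.Im (\sum_(i <- r | P i) F i) = \sum_(i <- r | P i) complex.Im (F i).
Proof. by elim/big_ind2 : _ => // x1 x2 y1 y2 <- <-; rewrite ImD. Qed.

Lemma complexP z w : complex.Re z = complex.Re w -> complex.Im z = complex.Im w ->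
  z = w.
Proof. by case: z; case: w => /= ? ? ? ? -> ->. Qed.

Lemma conjE z : Num.conj z = conjc z.
Proof. by []. Qed.

Lemma nc_mul_conj z : z * z^* = (nc z ^+ 2)%:C.
Proof. by rewrite nc_sqr; apply: complexP; rewrite ?ReM ?ImM !(Re_conj, Im_conj) /=; ring. Qed.

Lemma lt_ncP z (e : R) : (`|z| < e%:C) = (nc z < e).
Proof. by rewrite normc_def ltcR; case: z. Qed.

Lemma normc_nc z : `|z| = (nc z)%:C.
Proof. by rewrite normc_def; case: z. Qed.

Lemma complex_gt0P (e : R[i]) : 0 < e -> e = (complex.Re e)%:C /\ 0 < complex.Re e.
Proof. by rewrite ltcE /= => /andP[/eqP e0 ->]; split=> //; apply: complexP. Qed.

End ComplexModulus.

Section ComplexExponential.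
Variable R : realType.
Implicit Types (x y : R) (z w : R[i]).

Definition cexp z : R[i] :=
  (expR (complex.Re z))%:C * (cos (complex.Im z) +i* sin (complex.Im z)).

Lemma Re_cexp z : complex.Re (cexp z) = expR (complex.Re z) * cos (complex.Im z).
Proof. by rewrite ReZ. Qed.

Lemma Im_cexp z : complex.Im (cexp z) = expR (complex.Re z) * sin (complex.Im z).
Proof. by rewrite ImZ. Qed.

Lemma cexpD z w : cexp (z + w) = cexp z * cexp w.
Proof.
by apply: complexP; rewrite !(ReM, ImM, Re_cexp, Im_cexp, ReD, ImD) expRD ?cosD ?sinD;
  ring.
Qed.

Lemma cexp0 : cexp 0 = 1.
Proof. by apply: complexP; rewrite ?Re_cexp ?Im_cexp/= expR0 mul1r ?cos0 ?sin0. Qed.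

Lemma nc_cexp z : nc (cexp z) = expR (complex.Re z).
Proof.
rewrite /cexp ncM ncR ger0_norm ?expR_ge0// /Normc.normc /=.
by rewrite cos2Dsin2 sqrtr1 mulr1.
Qed.

Lemma cexpMn z n : cexp (z *+ n) = cexp z ^+ n.
Proof. by elim: n => [|n IH]; rewrite ?mulr0n ?cexp0// mulrS exprS cexpD IH. Qed.

Lemma cexp_conj z : cexp z^* = (cexp z)^*.
Proof.
by apply: complexP; rewrite ?Re_conj ?Im_conj !(Re_cexp, Im_cexp) Re_conj Im_conj ?cosN ?sinN ?mulrN.
Qed.

Lemma nat_cpowNE n (s : R[i]) : nat_cpowN n s = cexp (- ((ln n%:R)%:C * s)).
Proof.
rewrite /nat_cpowN /cexp ReN ImN ReZ ImZ cosN sinN.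
by rewrite [ln _ * complex.Re _]mulrC [ln _ * complex.Im _]mulrC.
Qed.

Lemma nat_cpowND n (s t : R[i]) : nat_cpowN n (s + t) = nat_cpowN n s * nat_cpowN n t.
Proof. by rewrite !nat_cpowNE mulrDr opprD cexpD. Qed.

Lemma nat_cpowNM (n k : nat) (s : R[i]) : (0 < n)%N -> (0 < k)%N ->
  nat_cpowN (n * k) s = nat_cpowN n s * nat_cpowN k s.
Proof.
move=> n0 k0; rewrite !nat_cpowNE natrM lnM ?posrE ?ltr0n//.
by rewrite rmorphD /= mulrDl opprD cexpD.
Qed.

Lemma nat_cpowN1 (s : R[i]) : nat_cpowN 1 s = 1.
Proof. by rewrite nat_cpowNE ln1 mul0r oppr0 cexp0. Qed.

Lemma nc_nat_cpowN n (s : R[i]) : nc (nat_cpowN n s) = expR (- (ln n%:R * complex.Re s)).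
Proof. by rewrite nat_cpowNE nc_cexp ReN ReZ. Qed.

Lemma nc_nat_cpowN_le1 n (s : R[i]) : 0 <= complex.Re s -> nc (nat_cpowN n s) <= 1.
Proof.
move=> s0; rewrite nc_nat_cpowN expR_le1 oppr_le0 mulr_ge0//.
by case: n => [|n]; [rewrite ln0|rewrite ln_ge0// ler1n].
Qed.

Lemma normr_sin_le y : `|sin y| <= `|y|.
Proof.
have main (t : R) : 0 <= t -> sin t <= t.
  move=> t0; have [c _ /=] := @MVT_segment R (@sin R) (@cos R) 0 t t0
     (fun x _ => is_derive_sin x) (continuous_subspaceT (@continuous_sin R)).
  by rewrite sin0 !subr0 => ->; rewrite -[leRHS]mul1r ler_wpM2r// cos_le1.
have mainN (t : R) : 0 <= t -> - t <= sin t.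
  move=> t0; have [c _ /=] := @MVT_segment R (@sin R) (@cos R) 0 t t0
     (fun x _ => is_derive_sin x) (continuous_subspaceT (@continuous_sin R)).
  by rewrite sin0 !subr0 => ->; rewrite -mulN1r ler_wpM2r// cos_geN1.
rewrite ler_norml; have [y0|y0] := leP 0 y.
  by rewrite ger0_norm// main// mainN.
rewrite ltr0_norm// opprK.
have := main (- y); have := mainN (- y); rewrite sinN oppr_ge0 => /(_ (ltW y0)) + /(_ (ltW y0)).
by move=> ? ?; apply/andP; split; lra.
Qed.

Lemma cos_half y : 1 - cos y = 2 * sin (y / 2) ^+ 2.
Proof.
rewrite {1}(_ : y = (y / 2) *+ 2); last by rewrite -mulr_natr; field.
by rewrite cos_mulr2n cos2sin2 -mulr_natr; ring.
Qed.

Lemma onem_cos_ge0 y : 0 <= 1 - cos y.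
Proof. by rewrite subr_ge0 cos_le1. Qed.

Lemma onem_cos_le_sqr y : 1 - cos y <= y ^+ 2 / 2.
Proof.
rewrite cos_half; have := normr_sin_le (y / 2).
rewrite -(@ler_pXn2r _ 2)// ?nnegrE//.
rewrite !real_normK ?num_real// => h; lra.
Qed.

Lemma onem_cos_le y : 1 - cos y <= `|y|.
Proof.
rewrite cos_half; have := normr_sin_le (y / 2); have := sin_max (y / 2).
rewrite normrM (@ger0_norm _ 2^-1)// => h1 h2.
rewrite -(real_normK (num_real (sin (y / 2)))).
have := normr_ge0 (sin (y/2)); nra.
Qed.

Lemma normr_sin_sub_le y : `|sin y - y| <= y ^+ 2.
Proof.
have main (t : R) : 0 <= t -> `|sin t - t| <= t ^+ 2.
  move=> t0; have [c cin /=] := @MVT_segment R (@sin R) (@cos R) 0 t t0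
     (fun x _ => is_derive_sin x) (continuous_subspaceT (@continuous_sin R)).
  move: cin; rewrite in_itv /= => /andP[c0 ct].
  rewrite sin0 !subr0 => ->; rewrite -{2}[t]mul1r -mulrBl normrM.
  rewrite [X in _ * X]ger0_norm// expr2 ler_wpM2r//.
  rewrite distrC ger0_norm ?onem_cos_ge0//.
  by apply: le_trans (onem_cos_le c) _; rewrite ger0_norm.
have [y0|y0] := leP 0 y; first exact: main.
have := main (- y); rewrite sinN oppr_ge0 => /(_ (ltW y0)).
by rewrite sqrrN -opprD normrN.
Qed.

Lemma expRN_le_quad x : 0 <= x -> expR (- x) <= 1 - x + x ^+ 2.
Proof.
move=> x0; rewrite expRN.
have h : (1 + x)^-1 <= 1 - x + x ^+ 2.
  rewrite -[leLHS]mul1r ler_pdivrMr ?ltr_wpDr//; nra.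
apply: le_trans h; rewrite lef_pV2 ?posrE ?expR_gt0 ?ltr_wpDr//.
exact: expR_ge1Dx.
Qed.

Lemma cexpN_sub1_le z : 0 <= complex.Re z -> nc (1 - cexp (- z)) <= 3 * nc z.
Proof.
case: z => x y; set z := x +i* y => /= x0.
apply: (le_trans (nc_le_ReIm _)).
rewrite ReD ImD ReN ImN Re_cexp Im_cexp ReN ImN /= cosN sinN.
have e1 : expR (- x) <= 1 by rewrite expR_le1 oppr_le0.
have e2 := expR_ge1Dx (- x).
have e0 := expR_ge0 (- x).
have h1 := nc_Re z; have h2 := nc_Im z; rewrite /= ger0_norm// in h1 h2.
have c1 := onem_cos_le y; have c0 := onem_cos_ge0 y; have s1 := normr_sin_le y.
have -> : 1 - expR (- x) * cos y = (1 - expR (- x)) + expR (- x) * (1 - cos y) by ring.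
rewrite (_ : 0 - _ = expR (- x) * sin y); last by ring.
rewrite ger0_norm; last by rewrite addr_ge0 ?subr_ge0 ?mulr_ge0.
rewrite normrM (ger0_norm e0).
have : expR (- x) * (1 - cos y) <= 1 * `|y| by apply: ler_pM.
have : expR (- x) * `|sin y| <= 1 * `|y| by apply: ler_pM.
lra.
Qed.

(** In the right half-plane [e^(-z)] has modulus at most 1, so the second-order remainder is
    quadratic in [|z|] with an absolute constant, without a factor growing exponentially. *)
Lemma cexpN_taylor_le z : 0 <= complex.Re z ->
  nc (1 - cexp (- z) - z) <= 3 * nc z ^+ 2.
Proof.
case: z => x y; set z := x +i* y => /= x0.
rewrite nc_sqr /=; apply: (le_trans (nc_le_ReIm _)).
rewrite !ReD !ImD !ReN !ImN Re_cexp Im_cexp ReN ImN /= cosN sinN.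
have e1 : expR (- x) <= 1 by rewrite expR_le1 oppr_le0.
have e2 := expR_ge1Dx (- x); have e3 := expRN_le_quad x0.
have e0 := expR_ge0 (- x).
have c1 := onem_cos_le_sqr y; have c0 := onem_cos_ge0 y.
have s1 := normr_sin_le y; have s2 := normr_sin_sub_le y.
have -> : 1 - expR (- x) * cos y - x =
  (1 - expR (- x) - x) + expR (- x) * (1 - cos y) by ring.
rewrite (_ : _ - _ - y = (sin y - y) + (expR (- x) - 1) * sin y); last by ring.
have t1 : `|1 - expR (- x) - x| <= x ^+ 2 by rewrite ler_norml; apply/andP; split; lra.
have t2 : `|expR (- x) * (1 - cos y)| <= y ^+ 2 / 2.
  rewrite ger0_norm ?mulr_ge0// -[leRHS]mul1r; exact: ler_pM.
have t3 : `|(expR (- x) - 1) * sin y| <= x * `|y|.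
  by rewrite normrM; apply: ler_pM => //; rewrite ler_norml; apply/andP; split; lra.
have t4 := ler_normD (1 - expR (- x) - x) (expR (- x) * (1 - cos y)).
have t5 := ler_normD (sin y - y) ((expR (- x) - 1) * sin y).
have t6 : x * `|y| <= x ^+ 2 + y ^+ 2.
  rewrite -(real_normK (num_real y)); have := normr_ge0 y; have := sqr_ge0 (x - `|y|); nra.
have := sqr_ge0 y; lra.
Qed.

(** Factor out the power at the point with the smaller real part: in [n^(-b) = n^(-a) n^(-(b-a))]
    the first factor has modulus at most 1 and [b - a] stays in the right half-plane, where
    [cexpN_sub1_le] applies. *)
Lemma nat_cpowN_lip n (s t : R[i]) : 0 <= complex.Re s -> 0 <= complex.Re t ->
  nc (nat_cpowN n s - nat_cpowN n t) <= 3 * ln n%:R * nc (s - t).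
Proof.
have l0 : 0 <= ln n%:R :> R.
  by case: n => [|n]; [rewrite ln0|rewrite ln_ge0// ler1n].
have main (a b : R[i]) : 0 <= complex.Re a -> complex.Re a <= complex.Re b ->
    nc (nat_cpowN n a - nat_cpowN n b) <= 3 * ln n%:R * nc (a - b).
  move=> a0 ab.
  rewrite {1}(_ : b = a + (b - a)); last by rewrite addrC subrK.
  rewrite nat_cpowND -{1}[nat_cpowN n a]mulr1 -mulrBr ncM.
  rewrite -[leRHS]mul1r; apply: ler_pM; rewrite ?normc_ge0 ?nc_nat_cpowN_le1//.
  rewrite [nat_cpowN _ (b - a)]nat_cpowNE.
  apply: le_trans (cexpN_sub1_le _) _.
    by rewrite ReZ mulr_ge0// ReD ReN subr_ge0.
  by rewrite ncM ncR (ger0_norm l0) mulrA (ncBC b).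
move=> s0 t0; have [st|/ltW st] := leP (complex.Re s) (complex.Re t).
  exact: main.
by rewrite ncBC [X in _ * X]ncBC; exact: main.
Qed.

End ComplexExponential.
(** * Dirichlet polynomials *)

Section FiniteSums.
Variable R : realType.

Lemma cauchy_schwarz_sum (I : Type) (r : seq I) (P : pred I) (x y : I -> R) :
  (\sum_(i <- r | P i) x i * y i) ^+ 2 <=
  (\sum_(i <- r | P i) x i ^+ 2) * (\sum_(i <- r | P i) y i ^+ 2).
Proof.
elim: r => [|i r IH]; first by rewrite !big_nil expr0n mulr0.
rewrite !big_cons; case: (P i) => //.
set S := \sum_(j <- r | P j) x j * y j in IH *.
set A := \sum_(j <- r | P j) x j ^+ 2 in IH *.
set B := \sum_(j <- r | P j) y j ^+ 2 in IH *.
have A0 : 0 <= A by apply: sumr_ge0 => j _; exact: sqr_ge0.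
have B0 : 0 <= B by apply: sumr_ge0 => j _; exact: sqr_ge0.
(* Squaring reduces the cross term, through the induction hypothesis [S^2 <= A B], to the inequality
   between arithmetic and geometric means. *)
have key : 2 * (S * (x i * y i)) <= A * y i ^+ 2 + B * x i ^+ 2.
  have p0 : 0 <= A * y i ^+ 2 + B * x i ^+ 2.
    by rewrite addr_ge0// mulr_ge0// sqr_ge0.
  apply: le_trans (ler_norm _) _.
  rewrite -(@ler_pXn2r _ 2)// ?nnegrE// real_normK ?num_real//.
  apply: (@le_trans _ _ (4 * ((A * B) * (x i * y i) ^+ 2))).
    have -> : (2 * (S * (x i * y i))) ^+ 2 = 4 * (S ^+ 2 * (x i * y i) ^+ 2) by ring.
    by rewrite ler_wpM2l// ler_wpM2r// sqr_ge0.
  by have := sqr_ge0 (A * y i ^+ 2 - B * x i ^+ 2); nra.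
nra.
Qed.

(** With [v = ln (n+1) - ln n] one has [a / (n+1) <= a v <= e^(a v) - 1]. This is the comparison of
    [(n+1)^(-1-a)] with an integral, in a form that telescopes. *)
Lemma inv_mul_exp_ln_le (a : R) (n : nat) : 0 < a -> (0 < n)%N ->
  a / (1 + a) * expR (- ((1 + a) * ln n.+1%:R)) <=
  expR (- (a * ln n%:R)) - expR (- (a * ln n.+1%:R)).
Proof.
move=> a0 n0.
have n0' : 0 < n%:R :> R by rewrite ltr0n.
have n1' : 0 < n.+1%:R :> R by rewrite ltr0n.
set v := ln n.+1%:R - ln n%:R : R.
have hv : n.+1%:R^-1 <= v.
  have h : ln (n%:R / n.+1%:R) <= - n.+1%:R^-1 :> R.
    have -> : n%:R / n.+1%:R = 1 + - n.+1%:R^-1 :> R.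
      have := n1'; rewrite -natr1 => n1''.
      by field; rewrite gt_eqF.
    apply: le_ln1Dx.
    by rewrite ltrNl opprK invf_lt1// ltr1n ltnS.
  by rewrite -lerN2 opprB -ln_div ?posrE.
have -> : expR (- (a * ln n%:R)) = expR (- (a * ln n.+1%:R)) * expR (a * v).
  by rewrite -expRD /v; congr expR; ring.
have -> : expR (- ((1 + a) * ln n.+1%:R)) = expR (- (a * ln n.+1%:R)) * n.+1%:R^-1.
  rewrite -[X in _ * X^-1](@lnK _ n.+1%:R) ?posrE// -expRN -expRD; congr expR; ring.
rewrite mulrCA -[X in _ <= _ - X]mulr1 -mulrBr ler_wpM2l ?expR_ge0//.
have e1 := expR_ge1Dx (a * v).
have : a / (1 + a) * n.+1%:R^-1 <= a * n.+1%:R^-1.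
  by rewrite ler_wpM2r ?invr_ge0 ?ler0n// ler_pdivrMr ?addr_gt0//; nra.
have h1 : a * n.+1%:R^-1 <= a * v by rewrite ler_wpM2l// ltW.
move=> /le_trans; apply; apply: le_trans h1 _.
by rewrite lerBrDl.
Qed.

Lemma zeta_tail_le (a : R) (K N : nat) : 0 < a -> (0 < K)%N ->
  \sum_(K <= k < N) expR (- ((1 + a) * ln k.+1%:R)) <=
  (1 + a) / a * expR (- (a * ln K%:R)).
Proof.
move=> a0 K0.
have c0 : 0 < (1 + a) / a by rewrite divr_gt0// addr_gt0.
have step k : (0 < k)%N -> expR (- ((1 + a) * ln k.+1%:R)) <=
    (1 + a) / a * (expR (- (a * ln k%:R)) - expR (- (a * ln k.+1%:R))).
  move=> k0; rewrite -ler_pdivrMl// invf_div; exact: inv_mul_exp_ln_le.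
have [KN|NK] := leqP K N; last first.
  by rewrite big_geq ?(ltnW NK)// mulr_ge0 ?expR_ge0// ltW.
apply: (@le_trans _ _ ((1 + a) / a *
    (expR (- (a * ln K%:R)) - expR (- (a * ln N%:R))))).
  have -> : expR (- (a * ln K%:R)) - expR (- (a * ln N%:R)) =
      \sum_(K <= k < N) (expR (- (a * ln k%:R)) - expR (- (a * ln k.+1%:R))) :> R.
    have := telescope_sumr (fun k => - expR (- (a * ln k%:R)) : R) KN.
    rewrite opprK [RHS]addrC => <-.
    by apply: eq_bigr => k _; rewrite opprK addrC.
  rewrite mulr_sumr; apply: ler_sum_nat => k /andP[Kk _].
  by apply: step; exact: leq_trans Kk.
by rewrite ler_wpM2l ?(ltW c0)// gerBl expR_ge0.
Qed.

End FiniteSums.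

Section ComplexLimits.
Variable R : realType.
Implicit Types (u : nat -> R[i]) (l : R[i]).

(** The norm of [R[i]] is [R[i]]-valued; this restates convergence with real tolerances and the real
    modulus. *)
Lemma cvgcP (T : Type) (F : set_system T) (FF : Filter F) (u : T -> R[i]) l :
  (u x @[x --> F] --> l) <-> (forall e : R, 0 < e -> \forall x \near F, nc (l - u x) < e).
Proof.
split=> [/cvgrPdist_lt h e e0|h].
  have := h e%:C; rewrite ltcR => /(_ e0).
  by apply: filterS => x; rewrite lt_ncP.
apply/cvgrPdist_lt => e /complex_gt0P[-> e0].
by have := h _ e0; apply: filterS => x; rewrite lt_ncP.
Qed.

Lemma cvgc_ReIm (T : Type) (F : set_system T) (FF : Filter F) (u : T -> R[i]) (a b : R) :
  complex.Re (u x) @[x --> F] --> a -> complex.Im (u x) @[x --> F] --> b ->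
  u x @[x --> F] --> a +i* b.
Proof.
move=> /cvgrPdist_lt ha /cvgrPdist_lt hb; apply/cvgcP => e e0.
have e2 : 0 < e / 2 by rewrite divr_gt0.
near=> n; apply: le_lt_trans (nc_le_ReIm _) _.
rewrite ReD ImD ReN ImN /= [e]splitr; apply: ltrD; near: n; [exact: ha|exact: hb].
Unshelve. all: by end_near. Qed.

Lemma cvgc_lin (T : Type) (F : set_system T) (FF : Filter F) (v w : T -> R[i])
    (a b c : R[i]) : v x @[x --> F] --> b -> w x @[x --> F] --> c ->
  a * v x + w x @[x --> F] --> a * b + c.
Proof.
move=> /cvgcP hv /cvgcP hw; apply/cvgcP => e e0.
have na : 0 < nc a + 1 by rewrite ltr_wpDl// normc_ge0.
have e1 : 0 < e / 2 / (nc a + 1) by rewrite !divr_gt0.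
have e2 : 0 < e / 2 by rewrite divr_gt0.
near=> x.
have -> : a * b + c - (a * v x + w x) = a * (b - v x) + (c - w x) by ring.
apply: le_lt_trans (ncD _ _) _; rewrite [e]splitr; apply: ler_ltD; last first.
  by near: x; exact: hw.
rewrite ncM; apply: le_trans (_ : (nc a + 1) * (e / 2 / (nc a + 1)) <= _).
  apply: ler_pM; rewrite ?normc_ge0 ?lerDl//; apply/ltW.
  by near: x; exact: hv.
by rewrite mulrC divfK// gt_eqF.
Unshelve. all: by end_near. Qed.

Lemma cvgc_lim u l : u n @[n --> \oo] --> l -> limn u = l.
Proof. by apply: cvg_lim; exact: norm_hausdorff. Qed.

Lemma cvgc_nc_le u l (w : R[i]) (M : R) : u n @[n --> \oo] --> l ->
  (\forall n \near \oo, nc (u n - w) <= M) -> nc (l - w) <= M.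
Proof.
move=> /cvgcP ul uM; apply/ler_addgt0Pr => e e0.
have [n [h1 h2]] := @filter_ex _ \oo _ _ (filterI (ul _ e0) uM).
rewrite (_ : l - w = (l - u n) + (u n - w)); last by ring.
by apply: le_trans (ncD _ _) _; rewrite addrC lerD// ltW.
Qed.

Lemma cvgc_abs_series (a : nat -> R[i]) (M : R) :
  (forall n, \sum_(k < n) nc (a k) <= M) ->
  exists l, (\sum_(k < n) a k) @[n --> \oo] --> l.
Proof.
move=> aM.
have abs (p : nat -> R) : (forall k, `|p k| <= nc (a k)) -> cvgn (series p).
  move=> pa; apply: normed_cvg; apply: nondecreasing_is_cvgn.
    by apply: nondecreasing_series => k _ _ /=.
  exists M => _ [n _ <-]; apply: le_trans (aM n).
  by rewrite /= /series /= big_mkord; apply: ler_sum => k _; exact: pa.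
exists (limn (series (fun k => complex.Re (a k))) +i*
        limn (series (fun k => complex.Im (a k)))).
apply: cvgc_ReIm.
- have := abs (fun k => complex.Re (a k)) (fun k => nc_Re _).
  apply: cvg_trans; rewrite [X in _ `=>` nbhs (X @ _)](_ : _ = (fun n => complex.Re (\sum_(k < n) a k)))//.
  by apply/funext => n; rewrite Re_sum /series /= big_mkord.
- have := abs (fun k => complex.Im (a k)) (fun k => nc_Im _).
  apply: cvg_trans; rewrite [X in _ `=>` nbhs (X @ _)](_ : _ = (fun n => complex.Im (\sum_(k < n) a k)))//.
  by apply/funext => n; rewrite Im_sum /series /= big_mkord.
Qed.

End ComplexLimits.

Section DirichletPolynomials.
Variable R : realType.
Implicit Types (b c : nat -> R[i]) (h : nat -> R[i]).

(** The common abstraction of evaluation at a point, [n -> n^(-s)], and of the Bohr lift,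
    [n -> chi z n]. In the lemmas below the coefficients are chosen before [h], so that one
    Dirichlet polynomial represents the same expression in both settings. *)
Definition cmult h := h 1%N = 1 /\
  forall n k, (0 < n)%N -> (0 < k)%N -> h (n * k)%N = h n * h k.

Definition dsum h b N : R[i] := \sum_(k < N) b k * h k.+1.

Lemma dirichletE b N s : dirichlet b N s = dsum (fun n => nat_cpowN n s) b N.
Proof. by []. Qed.

Lemma cmult_nat_cpowN (s : R[i]) : cmult (fun n => nat_cpowN n s).
Proof. by split=> [|n k]; [exact: nat_cpowN1|exact: nat_cpowNM]. Qed.

Lemma dsum_widen h b N M : (N <= M)%N ->
  dsum h b N = dsum h (fun k => if (k < N)%N then b k else 0) M.
Proof.
move=> NM; rewrite /dsum (big_ord_widen M (fun k => b k * h k.+1) NM) big_mkcond.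
by apply: eq_bigr => k _; case: ifP; rewrite ?mul0r.
Qed.

Lemma dsum_add b N c M : exists d K, forall h,
  dsum h b N + dsum h c M = dsum h d K.
Proof.
exists (fun k => (if (k < N)%N then b k else 0) + (if (k < M)%N then c k else 0)).
exists (maxn N M) => h; rewrite (dsum_widen _ _ (leq_maxl N M)).
rewrite (dsum_widen _ _ (leq_maxr N M)) -big_split.
by apply: eq_bigr => k _; rewrite mulrDl.
Qed.

Lemma dsum_const (a : R[i]) : exists d K, forall h, cmult h -> dsum h d K = a.
Proof.
exists (fun=> a), 1%N => h [h1 _].
by rewrite /dsum big_ord1 h1 mulr1.
Qed.

Lemma dsum_mul b N c M : exists d K, forall h, cmult h ->
  dsum h b N * dsum h c M = dsum h d K.
Proof.
exists (fun k => \sum_(i < N) \sum_(j < M)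
   (if (i.+1 * j.+1 == k.+1)%N then b i * c j else 0)).
exists (N * M)%N => h [_ hM]; rewrite /dsum big_distrlr/=.
under [RHS]eq_bigr do rewrite mulr_suml.
rewrite [RHS]exchange_big/=; apply: eq_bigr => i _.
under [RHS]eq_bigr do rewrite mulr_suml.
rewrite [RHS]exchange_big/=; apply: eq_bigr => j _.
(* The coefficient of index [k] belongs to the integer [k + 1], so the product of the terms [i] and
   [j] lands at [p = (i+1)(j+1) - 1]. *)
have [p pE] : exists p, p.+1 = (i.+1 * j.+1)%N by exists (i.+1 * j.+1).-1; rewrite prednK.
have ltk : (p < N * M)%N by rewrite pE leq_mul// ltn_ord.
rewrite (bigD1 (Ordinal ltk))//= big1 => [|k kne].
  by rewrite pE eqxx addr0 hM// mulrACA.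
rewrite ifF ?mul0r//; apply: contraNF kne => /eqP e.
by apply/eqP/val_inj; apply: succn_inj; rewrite pE e.
Qed.

Lemma dsum_exp b N n : exists d K, forall h, cmult h -> dsum h b N ^+ n = dsum h d K.
Proof.
elim: n => [|n [d [K IH]]].
  by have [d [K E]] := dsum_const 1; exists d, K => h hm; rewrite expr0 E.
have [d' [K' E]] := dsum_mul b N d K.
by exists d', K' => h hm; rewrite exprS IH// E.
Qed.

Lemma dsum_sum (I : Type) (r : seq I) (P : pred I) (F : I -> (nat -> R[i]) -> R[i]) :
  (forall i, exists d K, forall h, cmult h -> F i h = dsum h d K) ->
  exists d K, forall h, cmult h -> \sum_(i <- r | P i) F i h = dsum h d K.
Proof.
move=> Fi; elim: r => [|i r [d [K IH]]].
  by exists (fun=> 0), 0%N => h _; rewrite big_nil /dsum big_ord0.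
have [di [Ki E]] := Fi i.
have [d' [K' E']] := dsum_add di Ki d K.
case Pi : (P i); last by exists d, K => h hm; rewrite big_cons Pi IH.
by exists d', K' => h hm; rewrite big_cons Pi IH// E// E'.
Qed.

End DirichletPolynomials.

Section Averages.
Variable R : realType.
Implicit Types (b : nat -> R[i]) (t x : R).

Definition eit x : R[i] := cexp (0 +i* x).

Lemma eitD x t : eit (x + t) = eit x * eit t.
Proof. by rewrite /eit -cexpD; congr cexp; apply: complexP; rewrite ?ReD ?ImD /= ?addr0. Qed.

Lemma eit0 : eit 0 = 1.
Proof. exact: cexp0. Qed.

Lemma Re_eit x : complex.Re (eit x) = cos x.
Proof. by rewrite Re_cexp expR0 mul1r. Qed.

Lemma eit_pi : eit pi = -1.
Proof. rewrite /eit /cexp [complex.Re _]/= [complex.Im _]/= expR0 mul1r cospi sinpi.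
by apply: complexP => //=; rewrite oppr0. Qed.

Lemma nc_eit x : nc (eit x) = 1.
Proof. by rewrite nc_cexp expR0. Qed.

Lemma eit_conj x : (eit x)^* = eit (- x).
Proof. by rewrite -cexp_conj. Qed.

Lemma nat_cpowN_eit n (s t : R) :
  nat_cpowN n (s +i* t) = (expR (- (s * ln n%:R)))%:C * eit (- (t * ln n%:R)).
Proof.
by rewrite /nat_cpowN /eit /cexp/= expR0 mul1r cosN sinN.
Qed.

Lemma nat_cpowN_it n (t : R) : nat_cpowN n (0 +i* t) = eit (- (t * ln n%:R)).
Proof. by rewrite nat_cpowN_eit mul0r oppr0 expR0 mul1r. Qed.

(* Translating the points by [pi / l] and doubling them kills the frequency
   [l] and keeps those already killed. *)
Lemma avg_points (L : seq R) : all (fun l => l != 0) L ->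
  exists T : seq R, (0 < size T)%N /\
    forall l, l \in L -> \sum_(t <- T) eit (l * t) = 0.
Proof.
elim: L => [_|l L IH /= /andP[l0 /IH[T [T0 TL]]]]; first by exists [:: 0].
exists (T ++ [seq t + pi / l | t <- T]); split; first by rewrite size_cat ltn_addr.
move=> l'; rewrite inE big_cat big_map/=.
have epi : eit (l * (pi / l)) = -1 by rewrite mulrCA mulfV// mulr1 eit_pi.
under [X in _ + X]eq_bigr do rewrite mulrDr eitD.
rewrite -mulr_suml => /orP[/eqP ->|/TL ->]; last by rewrite mul0r addr0.
by rewrite epi mulrN1 subrr.
Qed.

Lemma ln_nat_inj : {in [pred n | (0 < n)%N] &, injective (fun n : nat => ln n%:R : R)}.
Proof.
by move=> m n m0 n0 /(congr1 expR); rewrite !lnK ?posrE ?ltr0n// => /eqP; rewrite eqr_nat => /eqP.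
Qed.

(** Averaging [|D(it)|^2] over finitely many points that kill every frequency [ln (j+1) - ln (i+1)]
    with [i != j] leaves exactly the diagonal: a Parseval identity without limits of integral
    means. *)
Lemma dirichlet_mean_sqr b N (S : R) :
  (forall t, nc (dirichlet b N (0 +i* t)) <= S) ->
  \sum_(k < N) nc (b k) ^+ 2 <= S ^+ 2.
Proof.
move=> bS.
pose lam (p : 'I_N * 'I_N) : R := ln p.2.+1%:R - ln p.1.+1%:R.
have [|T [T0 TL]] := @avg_points [seq lam p | p <- enum [pred p : 'I_N * 'I_N | p.1 != p.2]].
  rewrite all_map; apply/allP => -[i j]; rewrite mem_enum inE /= subr_eq0.
  by apply: contra => /eqP /ln_nat_inj e; apply/eqP/val_inj; have := e isT isT; case.
have key : \sum_(t <- T) (nc (dirichlet b N (0 +i* t)) ^+ 2)%:C =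
    (size T)%:R * \sum_(k < N) (nc (b k) ^+ 2)%:C.
  transitivity (\sum_(t <- T) \sum_(i < N) \sum_(j < N)
      (b i * (b j)^* * eit ((ln j.+1%:R - ln i.+1%:R) * t))).
    apply: eq_bigr => t _; rewrite -nc_mul_conj /dirichlet rmorph_sum big_distrlr/=.
    apply: eq_bigr => i _; apply: eq_bigr => j _.
    rewrite rmorphM/= mulrACA; congr (_ * _).
    rewrite !nat_cpowN_it (_ : (ln _ - _) * _ = - (t * ln i.+1%:R) + - - (t * ln j.+1%:R)); last by ring.
    by rewrite eitD; congr (_ * _); exact: eit_conj.
  rewrite exchange_big mulr_sumr; apply: eq_bigr => i _.
  rewrite exchange_big (bigD1 i)//= [X in _ + X]big1 ?addr0 => [|j ji].
    under eq_bigr do rewrite subrr mul0r eit0 mulr1 nc_mul_conj.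
    by rewrite big_const_seq count_predT iter_addr addr0 mulr_natl.
  rewrite -mulr_sumr [X in _ * X](_ : _ = 0) ?mulr0//.
  apply: (TL (lam (i, j))); apply/mapP; exists (i, j) => //.
  by rewrite mem_enum inE /= eq_sym.
rewrite -!rmorph_sum /= -(rmorph_nat (real_complex R)) -rmorphM in key.
move: key => /(@complexI R) key.
rewrite -(ler_pM2l (_ : 0 < (size T)%:R :> R)) ?ltr0n// -key mulr_natl.
have -> : S ^+ 2 *+ size T = \sum_(t <- T) S ^+ 2.
  by rewrite big_const_seq count_predT iter_addr addr0.
apply: ler_sum => t _; apply: lerXn2r; rewrite ?nnegrE ?normc_ge0//.
exact: le_trans (normc_ge0 _) (bS 0).
Qed.

End Averages.
(** * The Hardy space *)

Section HardySpace.
Variable R : realType.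
Implicit Types (d f g : H2 R) (b : nat -> R[i]) (s : R[i]).

Lemma H2_sum_le d N : \sum_(k < N) nc (d k) ^+ 2 <= H2_rnorm d ^+ 2.
Proof. by have := H2_sq_le d N; rewrite /series /= big_mkord. Qed.

Lemma H2_norm_le_sums d (M : R) : 0 <= M ->
  (forall N, \sum_(k < N) nc (d k) ^+ 2 <= M ^+ 2) -> H2_rnorm d <= M.
Proof.
move=> M0 h; apply: H2_rnorm_le => // n.
by rewrite /series /= big_mkord.
Qed.

Lemma H2_coef_le d n : nc (d n) <= H2_rnorm d.
Proof.
rewrite -(@ler_pXn2r _ 2)// ?nnegrE ?normc_ge0 ?H2_rnorm_ge0//.
apply: le_trans (H2_sum_le d n.+1).
by rewrite big_ord_recr /= lerDr sumr_ge0// => i _; exact: sqr_ge0.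
Qed.

Definition trunc b N : nat -> R[i] := fun k => if (k < N)%N then b k else 0.

Lemma trunc_sum_le b N n :
  \sum_(k < n) nc (trunc b N k) ^+ 2 <= \sum_(k < N) nc (b k) ^+ 2.
Proof.
have -> : \sum_(k < N) nc (b k) ^+ 2 = \sum_(k < maxn n N) nc (trunc b N k) ^+ 2.
  rewrite (big_ord_widen _ (fun k => nc (b k) ^+ 2) (leq_maxr n N)) big_mkcond.
  by apply: eq_bigr => k _; rewrite /trunc; case: ifP => // _; rewrite nc0 expr0n.
rewrite (big_ord_widen _ (fun k => nc (trunc b N k) ^+ 2) (leq_maxl n N)).
by rewrite big_mkcond ler_sum// => k _; case: ifP => // _; exact: sqr_ge0.
Qed.

Lemma trunc_sqsummable b N : trunc b N \in @sqsummable R.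
Proof.
rewrite sqsummableE; apply/asboolP.
suff /sq_bounded[] : forall n, series (fun k => nc (trunc b N k) ^+ 2) n <=
  \sum_(k < N) nc (b k) ^+ 2 by [].
by move=> n; rewrite /series /= big_mkord trunc_sum_le.
Qed.

Definition H2poly b N : H2 R := MkH2 (trunc_sqsummable b N).

Lemma H2poly_norm b N : H2_rnorm (H2poly b N) ^+ 2 = \sum_(k < N) nc (b k) ^+ 2.
Proof.
have S0 : 0 <= \sum_(k < N) nc (b k) ^+ 2 by apply: sumr_ge0 => i _; exact: sqr_ge0.
apply/eqP; rewrite eq_le; apply/andP; split.
  rewrite -[leRHS]sqr_sqrtr//; apply: lerXn2r; rewrite ?nnegrE ?H2_rnorm_ge0 ?sqrtr_ge0//.
  apply: H2_norm_le_sums; first exact: sqrtr_ge0.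
  by move=> n; rewrite sqr_sqrtr//; exact: trunc_sum_le.
apply: le_trans (H2_sum_le _ N).
by apply: ler_sum => k _; rewrite /= /trunc ltn_ord.
Qed.

Lemma dirichlet_trunc b N M s : (N <= M)%N ->
  dirichlet (trunc b N) M s = dirichlet b N s.
Proof. by move=> NM; rewrite !dirichletE (dsum_widen _ _ NM). Qed.

Lemma H2poly_eval b N s : H2_eval (H2poly b N) s = dirichlet b N s.
Proof.
apply: cvgc_lim; apply/cvgcP => e e0; near=> n.
rewrite /= dirichlet_trunc ?subrr ?nc0//; near: n; exact: nbhs_infty_ge.
Unshelve. all: by end_near. Qed.

(** By Cauchy-Schwarz and [zeta_tail_le], a bound for the norm of evaluation at any [s] with
    [2 Re s >= 1 + a], restricted to series whose coefficients of shifted index below [K] vanish. *)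
Definition ztail (a : R) (K : nat) : R :=
  Num.sqrt ((1 + a) / a * expR (- (a * ln K%:R))).

Lemma ztail_small (a e : R) : 0 < a -> 0 < e -> exists K, (0 < K)%N /\ ztail a K <= e.
Proof.
move=> a0 e0.
have c0 : 0 < (1 + a) / a by rewrite divr_gt0// addr_gt0.
(* [K >= y] forces [K^(-a) <= e^2 a / (1 + a)]; the absolute value covers both signs of the
   logarithm. *)
pose y := expR (`|ln (a / (1 + a) * e ^+ 2)| / a) : R.
exists (Num.truncn y).+1; split=> //.
rewrite /ztail -[leRHS](ger0_norm (ltW e0)) -sqrtr_sqr ler_wsqrtr//.
rewrite -ler_pdivlMl// invf_div.
set x := _ * e ^+ 2; have x0 : 0 < x by rewrite mulr_gt0 ?exprn_gt0// divr_gt0// addr_gt0.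
rewrite -[leRHS]lnK ?posrE// ler_expR.
have : `|ln x| / a <= ln (Num.truncn y).+1%:R.
  rewrite -[leLHS](expRK) ler_ln ?posrE ?expR_gt0 ?ltr0n//.
  by apply/ltW; exact: Num.Theory.truncnS_gt.
rewrite ler_pdivrMr// mulrC => h.
have := ler_norm (- ln x); rewrite normrN; lra.
Qed.

Lemma dirichlet_sub_le d s (a : R) (K N : nat) : 0 < a -> 1 + a <= 2 * complex.Re s ->
  (0 < K)%N -> (K <= N)%N ->
  nc (dirichlet d N s - dirichlet d K s) <= H2_rnorm d * ztail a K /\
  \sum_(K <= k < N) nc (d k * nat_cpowN k.+1 s) <= H2_rnorm d * ztail a K.
Proof.
move=> a0 ha K0 KN.
have -> : dirichlet d N s - dirichlet d K s = \sum_(K <= k < N) d k * nat_cpowN k.+1 s.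
  rewrite /dirichlet -!(big_mkord xpredT (fun k => d k * nat_cpowN k.+1 s)).
  by rewrite (big_cat_nat (n := K))//= addrAC subrr add0r.
have main : \sum_(K <= k < N) nc (d k * nat_cpowN k.+1 s) <= H2_rnorm d * ztail a K.
  under eq_bigr do rewrite ncM.
  set A := \sum_(_ <= _ < _) _.
  have A0 : 0 <= A by apply: sumr_ge0 => k _; rewrite mulr_ge0 ?normc_ge0.
  rewrite -(@ler_pXn2r _ 2)// ?nnegrE ?mulr_ge0 ?H2_rnorm_ge0 ?sqrtr_ge0//.
  apply: le_trans (cauchy_schwarz_sum _ _ _ _) _.
  rewrite exprMn [X in _ <= _ * X]sqr_sqrtr; last by rewrite mulr_ge0 ?expR_ge0// divr_ge0 ?addr_ge0// ltW.
  apply: ler_pM; rewrite ?sumr_ge0//; [by move=> k _; exact: sqr_ge0|by move=> k _; exact: sqr_ge0| |].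
    apply: le_trans (H2_sum_le d N).
    rewrite -(big_mkord xpredT (fun k => nc (d k) ^+ 2)) [leRHS](big_cat_nat (n := K))//=.
    by rewrite lerDr sumr_ge0// => k _; exact: sqr_ge0.
  apply: le_trans (zeta_tail_le N a0 K0); apply: ler_sum => k _.
  rewrite nc_nat_cpowN expr2 -expRD ler_expR.
  have l0 : 0 <= ln k.+1%:R :> R by rewrite ln_ge0// ler1n.
  have := ler_wpM2l l0 ha; lra.
by split=> //; apply: le_trans (nc_sum _ _ _) main.
Qed.

Lemma H2_eval_cvg d s : halfplane (1 / 2) s ->
  dirichlet d N s @[N --> \oo] --> H2_eval d s.
Proof.
rewrite /halfplane /= => hs.
have a0 : 0 < 2 * complex.Re s - 1 by lra.
have h1 : 1 + (2 * complex.Re s - 1) <= 2 * complex.Re s by lra.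
have [] := @cvgc_abs_series R (fun k => d k * nat_cpowN k.+1 s)
  (nc (d 0%N * nat_cpowN 1 s) + H2_rnorm d * ztail (2 * complex.Re s - 1) 1).
  case=> [|n].
    by rewrite big_ord0 addr_ge0 ?normc_ge0// mulr_ge0 ?H2_rnorm_ge0 ?sqrtr_ge0.
  rewrite -(big_mkord xpredT (fun k => nc (d k * nat_cpowN k.+1 s))) big_ltn// lerD2l.
  by have [] := @dirichlet_sub_le d s _ 1 n.+1 a0 h1.
move=> l hl; rewrite /H2_eval (cvgc_lim (l := l))//.
Qed.

Lemma H2_eval_sub_le d s (a : R) (K : nat) : 0 < a -> 1 + a <= 2 * complex.Re s ->
  (0 < K)%N -> nc (H2_eval d s - dirichlet d K s) <= H2_rnorm d * ztail a K.
Proof.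
move=> a0 ha K0; apply: (cvgc_nc_le (u := fun N => dirichlet d N s)).
  by apply: H2_eval_cvg; rewrite /halfplane /=; lra.
near=> N; have [] := @dirichlet_sub_le d s _ K N a0 ha K0 => //.
by near: N; exact: nbhs_infty_ge.
Unshelve. all: by end_near. Qed.

Lemma H2_subE f g k : (f - g : H2 R) k = f k - g k.
Proof. by []. Qed.

Lemma H2_eval_sub f g s : halfplane (1 / 2) s ->
  H2_eval (f - g) s = H2_eval f s - H2_eval g s.
Proof.
move=> hs; apply: cvgc_lim.
have -> : (fun N => dirichlet (f - g : H2 R) N s) = (fun N => dirichlet f N s - dirichlet g N s).
  apply/funext => N; rewrite /dirichlet -sumrB; apply: eq_bigr => k _.
  by rewrite H2_subE mulrBl.
by apply: cvgB; exact: H2_eval_cvg.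
Qed.

(* Averaging [d(1 + it) (n+1)^{it}] over the points of [avg_points] isolates
   the coefficient of index [n] up to the tail of the series. *)
Lemma coef_functional (n : nat) (e : R) : 0 < e ->
  exists (T : seq R) (a : R -> R[i]), forall d,
    nc (d n - \sum_(t <- T) a t * H2_eval d (1 +i* t)) <= e * H2_rnorm d.
Proof.
move=> e0.
(* The moduli of the weights [a t] will add up to [n + 1]: the factor [n + 1] in them undoes the
   decay of [(n+1)^(-s)] on [Re s = 1]. *)
have e1 : 0 < e / n.+1%:R by rewrite divr_gt0.
have [K0 [K00 hK0]] := @ztail_small 1 _ ltr01 e1.
have [K [nK K1 hK]] : exists K, [/\ (n < K)%N, (0 < K)%N & ztail 1 K <= e / n.+1%:R].
  exists (maxn n.+1 K0); rewrite leq_maxl; split=> //; first by rewrite leq_max K00 orbT.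
  apply: le_trans hK0; rewrite ler_wsqrtr// ler_wpM2l ?divr_ge0// ler_expR !mul1r.
  by rewrite lerN2 ler_ln ?posrE ?ltr0n ?ler_nat ?leq_max ?K00 ?orbT// leqnn orbT.
pose lam (k : nat) : R := ln n.+1%:R - ln k.+1%:R.
have [|T [T0 TL]] := @avg_points R [seq lam k | k <- iota 0 K & k != n].
  rewrite all_map; apply/allP => k; rewrite mem_filter => /andP[kn _] /=.
  rewrite subr_eq0; apply: contra kn => /eqP /ln_nat_inj h.
  by have := h isT isT => -[->].
pose a (t : R) : R[i] := (size T)%:R^-1 * (n.+1%:R * eit (t * ln n.+1%:R)).
have Tn0 : (size T)%:R != 0 :> R[i] by rewrite pnatr_eq0 -lt0n.
have nca t : nc (a t) = (size T)%:R^-1 * n.+1%:R.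
  by rewrite /a ncM ncV ncM !nc_nat nc_eit mulr1.
exists T, a => d.
have poly : \sum_(t <- T) a t * dirichlet d K (1 +i* t) = d n.
  rewrite /dirichlet; under eq_bigr do rewrite mulr_sumr.
  rewrite exchange_big (bigD1 (Ordinal nK))//= [X in _ + X]big1 ?addr0 => [|k kn].
    transitivity (\sum_(t <- T) ((size T)%:R^-1 * d n)); last first.
      rewrite big_const_seq count_predT iter_addr addr0 -[X in X *+ _]mulr1.
      by rewrite -mulrnAr mulrC mulrA mulfV// mul1r.
    apply: eq_bigr => t _; rewrite nat_cpowN_eit mul1r expRN lnK ?posrE ?ltr0n//.
    rewrite /a rmorphV ?unitfE ?pnatr_eq0//= rmorph_nat.
    transitivity ((size T)%:R^-1 * d n * (n.+1%:R / n.+1%:R) *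
      (eit (t * ln n.+1%:R) * eit (- (t * ln n.+1%:R)))); first by ring.
    by rewrite -eitD subrr eit0 mulfV ?pnatr_eq0// !mulr1.
  transitivity (((size T)%:R^-1 * n.+1%:R * d k * (expR (- ln k.+1%:R))%:C) *
     \sum_(t <- T) eit (lam k * t)).
    rewrite mulr_sumr; apply: eq_bigr => t _; rewrite nat_cpowN_eit mul1r.
    have -> : lam k * t = t * ln n.+1%:R + - (t * ln k.+1%:R) by rewrite /lam; ring.
    by rewrite eitD /a; ring.
  rewrite TL ?mulr0//; apply/mapP; exists (val k) => //.
  by rewrite mem_filter mem_iota /= add0n ltn_ord andbT; exact: kn.
rewrite -poly -sumrB; apply: le_trans (nc_sum _ _ _) _.
apply: (@le_trans _ _ (\sum_(t <- T) ((size T)%:R^-1 * n.+1%:R * (H2_rnorm d * (e / n.+1%:R))))).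
  apply: ler_sum => t _; rewrite -mulrBr ncM nca ler_wpM2l ?mulr_ge0 ?invr_ge0//.
  rewrite ncBC; apply: le_trans (H2_eval_sub_le (a := 1) _ _ _ K1) _ => //=; first lra.
  by rewrite ler_wpM2l ?H2_rnorm_ge0.
rewrite big_const_seq count_predT iter_addr addr0 -[leLHS]mulr_natl.
have Tr : (size T)%:R != 0 :> R by rewrite pnatr_eq0 -lt0n.
have nr : n.+1%:R != 0 :> R by rewrite pnatr_eq0.
have -> : (size T)%:R * ((size T)%:R^-1 * n.+1%:R * (H2_rnorm d * (e / n.+1%:R))) =
  ((size T)%:R / (size T)%:R) * (n.+1%:R / n.+1%:R) * (e * H2_rnorm d) by ring.
by rewrite !mulfV// !mul1r.
Qed.

(** Bounded pointwise convergence implies weak convergence: [coef_functional] approximates a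
    coefficient by finitely many evaluations, uniformly on balls. The filter is arbitrary so that
    the lemma serves both for sequences and along ultrafilters. *)
Lemma coef_cvg (T : Type) (F : set_system T) (FF : Filter F) (u : T -> H2 R) d (M : R) :
  (\forall x \near F, H2_rnorm (u x) <= M) ->
  (forall s, halfplane (1 / 2) s -> H2_eval (u x) s @[x --> F] --> H2_eval d s) ->
  forall n, u x n @[x --> F] --> d n.
Proof.
move=> uM us n; apply/cvgcP => e e0.
pose B := `|M| + H2_rnorm d + 1.
have B0 : 0 < B by rewrite ltr_wpDl// addr_ge0 ?H2_rnorm_ge0.
have e1 : 0 < e / 2 / B by rewrite !divr_gt0.
have [T' [a h]] := coef_functional n e1.
have : (\sum_(t <- T') a t * H2_eval (u x) (1 +i* t)) @[x --> F] -->
       (\sum_(t <- T') a t * H2_eval d (1 +i* t)).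
  elim: T' {h} => [|t T' IH].
    by rewrite big_nil; under eq_fun do rewrite big_nil; exact: cvg_cst.
  rewrite big_cons; under eq_fun do rewrite big_cons.
  by apply: cvgc_lin IH; apply: us; rewrite /halfplane /=; lra.
move=> /cvgcP /(_ _ (divr_gt0 e0 (ltr0Sn _ 1))) lim.
near=> x.
have -> : d n - u x n = (d n - u x n - \sum_(t <- T') a t * H2_eval (d - u x) (1 +i* t))
    + (\sum_(t <- T') a t * H2_eval d (1 +i* t) - \sum_(t <- T') a t * H2_eval (u x) (1 +i* t)).
  rewrite -sumrB; have -> : \sum_(t <- T') a t * H2_eval (d - u x) (1 +i* t) =
      \sum_(t <- T') (a t * H2_eval d (1 +i* t) - a t * H2_eval (u x) (1 +i* t)).
    apply: eq_bigr => t _; rewrite H2_eval_sub ?mulrBr//.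
    by rewrite /halfplane /=; lra.
  by rewrite subrK.
apply: le_lt_trans (ncD _ _) _; rewrite [e]splitr; apply: ler_ltD; last by near: x.
apply: le_trans (h (d - u x)) _.
rewrite mulrAC ler_pdivrMr// ler_wpM2l ?divr_ge0 ?(ltW e0)//.
have -> : d - u x = d + (-1) *: u x by rewrite scaleN1r.
apply: le_trans (H2_ler_rnormD _ _) _.
rewrite H2_rnormZ ncN nc1 mul1r /B.
have : H2_rnorm (u x) <= M by near: x.
have := ler_norm M; lra.
Unshelve. all: by end_near. Qed.

End HardySpace.
(** * Square integrable complex functions *)

Section ComplexL2.
Context d (T : measurableType d) (R : realType) (m : probability T R).
Implicit Types (f g : T -> R) (F G H : T -> R[i]) (A : set T).

Definition intg f := m.-integrable [set: T] (EFin \o f).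
Definition cmeas G := measurable_fun [set: T] (fun x => complex.Re (G x)) /\
  measurable_fun [set: T] (fun x => complex.Im (G x)).
Definition pr A : R := fine (m A).

Lemma prE A : measurable A -> m A = (pr A)%:E.
Proof. by move=> mA; rewrite /pr fineK// fin_num_measure. Qed.

Lemma pr_ge0 A : 0 <= pr A.
Proof. by rewrite fine_ge0. Qed.

Lemma pr_mono A B : measurable A -> measurable B -> A `<=` B -> pr A <= pr B.
Proof. by move=> mA mB AB; rewrite -lee_fin -!prE// le_measure// inE. Qed.

Lemma intg_le f g : measurable_fun [set: T] f -> intg g -> (forall x, `|f x| <= g x) ->
  intg f.
Proof.
move=> mf ig fg; apply: le_integrable ig => //; first exact/measurable_EFinP.
by move=> x _ /=; rewrite lee_fin; apply: le_trans (fg x) (ler_norm _).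
Qed.

Lemma intgD f g : intg f -> intg g -> intg (fun x => f x + g x).
Proof. by move=> i1 i2; exact: (integrableD measurableT i1 i2). Qed.

Lemma intgZ (a : R) f : intg f -> intg (fun x => a * f x).
Proof. by move=> i1; exact: (integrableZl measurableT a i1). Qed.

Lemma intg_cst (a : R) : intg (fun=> a).
Proof. exact: finite_measure_integrable_cst. Qed.

Lemma intg_indic A : measurable A -> intg (fun x => \1_A x).
Proof. by move=> mA; exact: integrable_indic. Qed.

Lemma esp_indic A : measurable A -> \int[m]_x \1_A x = pr A.
Proof. by move=> mA; rewrite /Rintegral integral_indic// setIT. Qed.

Lemma esp_cst (a : R) : \int[m]_x a = a.
Proof. by rewrite /Rintegral integral_cst//= probability_setT mule1. Qed.

Lemma esp_le f g : intg f -> intg g -> (forall x, f x <= g x) ->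
  \int[m]_x f x <= \int[m]_x g x.
Proof. by move=> i1 i2 fg; apply: le_Rintegral. Qed.

Lemma esp_le_ae f g A : measurable A -> pr A = 0 -> intg f -> intg g ->
  (forall x, ~ A x -> f x <= g x) -> \int[m]_x f x <= \int[m]_x g x.
Proof.
move=> mA A0 i1 i2 fg.
have mA0 : m A = 0%E by rewrite prE// A0.
rewrite -lee_fin /Rintegral !fineK; [|exact: integrable_fin_num..].
rewrite (negligible_integral mA measurableT i1 mA0).
rewrite (negligible_integral mA measurableT i2 mA0).
apply: le_integral => //.
- exact: measurableD.
- by apply: (integrableS measurableT _ _ i1) => //; exact: measurableD.
- by apply: (integrableS measurableT _ _ i2) => //; exact: measurableD.
- by move=> x; rewrite inE => -[_ /fg]; rewrite /= lee_fin.
Qed.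

Lemma esp_dominated (f_ : nat -> T -> R) f g : (forall n, measurable_fun [set: T] (f_ n)) ->
  measurable_fun [set: T] f -> intg g ->
  (forall x, f_ n x @[n --> \oo] --> f x) ->
  (forall n x, `|f_ n x| <= g x) ->
  \int[m]_x f_ n x @[n --> \oo] --> \int[m]_x f x.
Proof.
move=> mf_ mf ig f_f f_g.
have [] := @dominated_convergence _ _ _ m [set: T] measurableT
  (fun n => EFin \o f_ n) (EFin \o f) (EFin \o g).
- by move=> n; exact/measurable_EFinP.
- exact/measurable_EFinP.
- by apply: aeW => x _; apply: cvg_EFin; [exact: nearW|exact: f_f].
- exact: ig.
- by apply: aeW => x n _ /=; rewrite lee_fin.
move=> iF _ h.
have i_ n : intg (f_ n) by apply: intg_le ig _.
have := fine_cvg (_ : \int[m]_x (f_ n x)%:E @[n --> \oo] --> (\int[m]_x f x)%:E)%E.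
apply; rewrite /Rintegral fineK//; exact: integrable_fin_num.
Qed.

Lemma cmeasD F G : cmeas F -> cmeas G -> cmeas (fun x => F x + G x).
Proof.
move=> [F1 F2] [G1 G2]; split.
- by under eq_fun do rewrite ReD; exact: measurable_funD.
- by under eq_fun do rewrite ImD; exact: measurable_funD.
Qed.

Lemma cmeasM F G : cmeas F -> cmeas G -> cmeas (fun x => F x * G x).
Proof.
move=> [F1 F2] [G1 G2]; split.
- by under eq_fun do rewrite ReM; apply: measurable_funB; exact: measurable_funM.
- by under eq_fun do rewrite ImM; apply: measurable_funD; exact: measurable_funM.
Qed.

Lemma cmeas_cst (a : R[i]) : cmeas (fun=> a).
Proof. by split; exact: measurable_cst. Qed.

Lemma cmeas_conj F : cmeas F -> cmeas (fun x => (F x)^*).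
Proof.
move=> [F1 F2]; split; first by under eq_fun do rewrite Re_conj.
by under eq_fun do rewrite Im_conj; exact: measurableT_comp.
Qed.

Lemma cmeasN F : cmeas F -> cmeas (fun x => - F x).
Proof.
move=> mF; under eq_fun do rewrite -mulN1r.
by apply: cmeasM => //; exact: cmeas_cst.
Qed.

Lemma cmeasB F G : cmeas F -> cmeas G -> cmeas (fun x => F x - G x).
Proof. by move=> mF mG; apply: cmeasD => //; exact: cmeasN. Qed.

Lemma cmeas_sum (I : Type) (r : seq I) (P : pred I) (F : I -> T -> R[i]) :
  (forall i, cmeas (F i)) -> cmeas (fun x => \sum_(i <- r | P i) F i x).
Proof.
move=> mF; elim: r => [|i r IH].
  by under eq_fun do rewrite big_nil; exact: cmeas_cst.
under eq_fun do rewrite big_cons; case: (P i) => //.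
exact: cmeasD.
Qed.

Lemma cmeas_prod (I : Type) (r : seq I) (P : pred I) (F : I -> T -> R[i]) :
  (forall i, cmeas (F i)) -> cmeas (fun x => \prod_(i <- r | P i) F i x).
Proof.
move=> mF; elim: r => [|i r IH].
  by under eq_fun do rewrite big_nil; exact: cmeas_cst.
under eq_fun do rewrite big_cons; case: (P i) => //.
exact: cmeasM.
Qed.

Lemma cmeas_exp F n : cmeas F -> cmeas (fun x => F x ^+ n).
Proof.
move=> mF; elim: n => [|n IH]; first by under eq_fun do rewrite expr0; exact: cmeas_cst.
by under eq_fun do rewrite exprS; exact: cmeasM.
Qed.

Lemma measurable_nc_sqr F : cmeas F -> measurable_fun [set: T] (fun x => nc (F x) ^+ 2).
Proof.
move=> [F1 F2]; under eq_fun do rewrite nc_sqr.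
by apply: measurable_funD; exact: measurable_funX.
Qed.

Lemma measurable_nc_ge F (e : R) : cmeas F -> 0 <= e -> measurable [set x | e <= nc (F x)].
Proof.
move=> mF e0.
rewrite (_ : [set _ | _] = (fun x => nc (F x) ^+ 2) @^-1` `[e ^+ 2, +oo[%classic).
  by rewrite -[X in measurable X]setTI; exact: measurable_nc_sqr.
apply/seteqP; split=> x /=; rewrite in_itv /= andbT.
- by move=> h; apply: lerXn2r; rewrite ?nnegrE ?normc_ge0.
- by rewrite ler_pXn2r// nnegrE normc_ge0.
Qed.

Definition l2 F := cmeas F /\ intg (fun x => nc (F x) ^+ 2).

Lemma l2_cmeas F : l2 F -> cmeas F. Proof. by case. Qed.

Lemma l2_bounded F (M : R) : cmeas F -> (forall x, nc (F x) <= M) -> l2 F.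
Proof.
move=> mF FM; split=> //; apply: (intg_le (g := fun=> M ^+ 2)).
- exact: measurable_nc_sqr.
- exact: intg_cst.
- move=> x; rewrite ger0_norm ?sqr_ge0//; apply: lerXn2r => //.
  by rewrite nnegrE normc_ge0.
  by rewrite nnegrE (le_trans (normc_ge0 _) (FM x)).
Qed.

Lemma l2_cst (a : R[i]) : l2 (fun=> a).
Proof. by apply: (@l2_bounded _ (nc a)) => //; exact: cmeas_cst. Qed.

Lemma ncD_sqr_le (z w : R[i]) : nc (z + w) ^+ 2 <= 2 * nc z ^+ 2 + 2 * nc w ^+ 2.
Proof.
have : nc (z + w) ^+ 2 <= (nc z + nc w) ^+ 2.
  by apply: lerXn2r; rewrite ?nnegrE ?addr_ge0 ?normc_ge0 ?ncD.
by have := sqr_ge0 (nc z - nc w); nra.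
Qed.

Lemma l2D F G : l2 F -> l2 G -> l2 (fun x => F x + G x).
Proof.
move=> [mF iF] [mG iG]; split; first exact: cmeasD.
apply: (intg_le (g := fun x => 2 * nc (F x) ^+ 2 + 2 * nc (G x) ^+ 2)).
- by apply: measurable_nc_sqr; exact: cmeasD.
- by apply: intgD; exact: intgZ.
- by move=> x; rewrite ger0_norm ?sqr_ge0// ncD_sqr_le.
Qed.

Lemma l2Z (a : R[i]) F : l2 F -> l2 (fun x => a * F x).
Proof.
move=> [mF iF]; split; first by apply: cmeasM => //; exact: cmeas_cst.
by under eq_fun do rewrite ncM exprMn; exact: intgZ.
Qed.

Lemma l2B F G : l2 F -> l2 G -> l2 (fun x => F x - G x).
Proof.
move=> lF lG; apply: l2D => //; under eq_fun do rewrite -mulN1r.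
exact: l2Z.
Qed.

Lemma l2_sum (I : Type) (r : seq I) (P : pred I) (F : I -> T -> R[i]) :
  (forall i, l2 (F i)) -> l2 (fun x => \sum_(i <- r | P i) F i x).
Proof.
move=> lF; elim: r => [|i r IH].
  by under eq_fun do rewrite big_nil; exact: l2_cst.
under eq_fun do rewrite big_cons; case: (P i) => //.
exact: l2D.
Qed.

Lemma l2_Lfun F : (fun x => complex.Re (F x)) \in Lfun m 2%:E ->
  (fun x => complex.Im (F x)) \in Lfun m 2%:E -> l2 F.
Proof.
move=> h1 h2; have i1 := Lfun2_integrable_sqr h1; have i2 := Lfun2_integrable_sqr h2.
split; last by under eq_fun do rewrite nc_sqr; exact: intgD.
move: h1 h2; rewrite !inE => /andP[/[!inE]/= mf _] /andP[/[!inE]/= mg _].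
by split.
Qed.

(** The real part of the inner product. Nothing is lost by dropping the imaginary part, because
    characters are always tested with an arbitrary complex coefficient. *)
Definition rip F G : R := \int[m]_x complex.Re (F x * (G x)^*).
Definition nrm2 F : R := \int[m]_x (nc (F x) ^+ 2).
Definition nrm F : R := Num.sqrt (nrm2 F).

Lemma intg_rip F G : l2 F -> l2 G -> intg (fun x => complex.Re (F x * (G x)^*)).
Proof.
move=> [mF iF] [mG iG].
apply: (intg_le (g := fun x => nc (F x) ^+ 2 + nc (G x) ^+ 2)).
- by have [] := cmeasM mF (cmeas_conj mG).
- exact: intgD.
- move=> x; apply: le_trans (nc_Re _) _; rewrite ncM nc_conj.
  have := normc_ge0 (F x); have := normc_ge0 (G x).
  by have := sqr_ge0 (nc (F x) - nc (G x)); nra.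
Qed.

Lemma nrm2_ge0 F : 0 <= nrm2 F.
Proof. by apply: Rintegral_ge0 => x _; exact: sqr_ge0. Qed.

Lemma nrm_ge0 F : 0 <= nrm F.
Proof. exact: sqrtr_ge0. Qed.

Lemma nrm_sqr F : nrm F ^+ 2 = nrm2 F.
Proof. by rewrite sqr_sqrtr// nrm2_ge0. Qed.

Lemma rip_nrm2 F : rip F F = nrm2 F.
Proof. by apply: eq_Rintegral => x _; rewrite nc_mul_conj. Qed.

Lemma ripC F G : rip F G = rip G F.
Proof.
apply: eq_Rintegral => x _; rewrite !ReM !Re_conj !Im_conj.
by ring.
Qed.

Lemma ripDl F G H : l2 F -> l2 G -> l2 H ->
  rip (fun x => F x + G x) H = rip F H + rip G H.
Proof.
move=> lF lG lH; rewrite /rip -RintegralD//; [|exact: intg_rip..].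
by apply: eq_Rintegral => x _; rewrite mulrDl ReD.
Qed.

Lemma ripBl F G H : l2 F -> l2 G -> l2 H ->
  rip (fun x => F x - G x) H = rip F H - rip G H.
Proof.
move=> lF lG lH; rewrite /rip -RintegralB//; [|exact: intg_rip..].
by apply: eq_Rintegral => x _; rewrite mulrBl ReD ReN.
Qed.

Lemma rip_suml (I : Type) (r : seq I) (P : pred I) (F : I -> T -> R[i]) H :
  (forall i, l2 (F i)) -> l2 H ->
  rip (fun x => \sum_(i <- r | P i) F i x) H = \sum_(i <- r | P i) rip (F i) H.
Proof.
move=> lF lH; elim: r => [|i r IH].
  rewrite big_nil /rip; under eq_Rintegral do rewrite big_nil mul0r /=.
  exact: esp_cst.
rewrite big_cons; case Pi: (P i); last first.
  by rewrite -IH /rip; under eq_Rintegral do rewrite big_cons Pi.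
rewrite -IH -ripDl//; last exact: l2_sum.
by rewrite /rip; under eq_Rintegral do rewrite big_cons Pi.
Qed.

Lemma ripBr F G H : l2 F -> l2 G -> l2 H ->
  rip H (fun x => F x - G x) = rip H F - rip H G.
Proof. by move=> lF lG lH; rewrite ripC ripBl// !(ripC H). Qed.

Lemma rip_sumr (I : Type) (r : seq I) (P : pred I) (F : I -> T -> R[i]) H :
  (forall i, l2 (F i)) -> l2 H ->
  rip H (fun x => \sum_(i <- r | P i) F i x) = \sum_(i <- r | P i) rip H (F i).
Proof. by move=> lF lH; rewrite ripC rip_suml//; apply: eq_bigr => i _; rewrite ripC. Qed.

Lemma ripZRl (a : R) F G : l2 F -> l2 G ->
  rip (fun x => a%:C * F x) G = a * rip F G.
Proof.
move=> lF lG; rewrite /rip -RintegralZl//; last exact: intg_rip.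
by apply: eq_Rintegral => x _; rewrite -mulrA ReZ.
Qed.

Lemma quadratic_ge0 (a b c : R) : 0 <= c ->
  (forall t : R, 0 <= a + 2 * t * b + t ^+ 2 * c) -> b ^+ 2 <= a * c.
Proof.
move=> c0 h; have [cz|cn] := eqVneq c 0; last first.
  have cp : 0 < c by rewrite lt_neqAle eq_sym cn.
  have := h (- b / c).
  have -> : a + 2 * (- b / c) * b + (- b / c) ^+ 2 * c = (a * c - b ^+ 2) / c by field.
  by rewrite pmulr_lge0 ?invr_gt0// subr_ge0.
subst c; rewrite mulr0; have [->|bn] := eqVneq b 0; first by rewrite expr0n.
(* For [c = 0] the expression is affine in [t]; a nonzero slope would let it reach -1 here. *)
have := h (- (a + 1) / (2 * b)).
have -> : a + 2 * (- (a + 1) / (2 * b)) * b + (- (a + 1) / (2 * b)) ^+ 2 * 0 = -1 by field.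
by rewrite ler0N1.
Qed.

Lemma nrm2_expand (t : R) F G : l2 F -> l2 G ->
  nrm2 (fun x => F x + t%:C * G x) = nrm2 F + 2 * t * rip F G + t ^+ 2 * nrm2 G.
Proof.
move=> lF lG; have lt := l2Z t%:C lG; have ls := l2D lF lt.
set Gt := fun x => _ in lt ls.
have z H : l2 H -> rip Gt H = t * rip G H by move=> lH; exact: ripZRl.
rewrite -rip_nrm2 ripDl// [rip F _]ripC [rip Gt _]ripC !ripDl//.
rewrite (ripC F Gt) !z// (ripC G Gt) z// !rip_nrm2 [rip G F]ripC; ring.
Qed.

Lemma rip_cs F G : l2 F -> l2 G -> rip F G ^+ 2 <= nrm2 F * nrm2 G.
Proof.
move=> lF lG; apply: quadratic_ge0; first exact: nrm2_ge0.
by move=> t; rewrite -nrm2_expand//; exact: nrm2_ge0.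
Qed.

Lemma rip_le F G : l2 F -> l2 G -> rip F G <= nrm F * nrm G.
Proof.
move=> lF lG; apply: le_trans (ler_norm _) _.
rewrite -(@ler_pXn2r _ 2)// ?nnegrE ?mulr_ge0 ?nrm_ge0//.
by rewrite real_normK ?num_real// exprMn !nrm_sqr rip_cs.
Qed.

Lemma nrm_triangle F G : l2 F -> l2 G -> nrm (fun x => F x + G x) <= nrm F + nrm G.
Proof.
move=> lF lG; rewrite -(@ler_pXn2r _ 2)// ?nnegrE ?addr_ge0 ?nrm_ge0//.
rewrite nrm_sqr.
have -> : nrm2 (fun x => F x + G x) = nrm2 F + 2 * 1 * rip F G + 1 ^+ 2 * nrm2 G.
  by rewrite -nrm2_expand//; apply: eq_Rintegral => x _; rewrite mul1r.
rewrite -!nrm_sqr; have := rip_le lF lG; nra.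
Qed.

Lemma nrmBC F G : nrm (fun x => F x - G x) = nrm (fun x => G x - F x).
Proof. by rewrite /nrm; congr Num.sqrt; apply: eq_Rintegral => x _; rewrite ncBC. Qed.

Lemma nrm_triangleB F G H : l2 F -> l2 G -> l2 H ->
  nrm (fun x => F x - H x) <= nrm (fun x => F x - G x) + nrm (fun x => G x - H x).
Proof.
move=> lF lG lH; apply: le_trans _ (nrm_triangle (l2B lF lG) (l2B lG lH)).
rewrite le_eqVlt; apply/orP; left; apply/eqP; rewrite /nrm; congr Num.sqrt.
by apply: eq_Rintegral => x _; congr (nc _ ^+ 2); ring.
Qed.

Lemma markov_nrm2 F (e : R) : l2 F -> 0 < e ->
  pr [set x | e <= nc (F x)] <= nrm2 F / e ^+ 2.
Proof.
move=> [mF iF] e0; have mA := measurable_nc_ge mF (ltW e0).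
rewrite ler_pdivlMr ?exprn_gt0// mulrC -esp_indic//.
rewrite -RintegralZl//; last exact: intg_indic.
apply: esp_le => //; first by apply: intgZ; exact: intg_indic.
move=> x; rewrite indicE; case: (boolP (x \in _)) => [|_].
  rewrite inE /= mulr1 => h; apply: lerXn2r; rewrite ?nnegrE ?normc_ge0//.
  exact: ltW.
by rewrite mulr0 sqr_ge0.
Qed.

Lemma nrm_le_ae F (M : R) A : measurable A -> pr A = 0 -> l2 F -> 0 <= M ->
  (forall x, ~ A x -> nc (F x) <= M) -> nrm F <= M.
Proof.
move=> mA A0 [mF iF] M0 FM.
rewrite -[leRHS](ger0_norm M0) -sqrtr_sqr ler_wsqrtr//.
rewrite -(esp_cst (M ^+ 2)); apply: (esp_le_ae mA A0) => //; first exact: intg_cst.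
move=> x /FM h; apply: lerXn2r; rewrite ?nnegrE ?normc_ge0//.
Qed.

End ComplexL2.
(** * Characters of the torus *)

Section Primes.

Lemma next_primeP n : [/\ (n < next_prime n)%N, prime (next_prime n) &
  forall p, prime p -> (n < p)%N -> (next_prime n <= p)%N].
Proof.
rewrite /next_prime; case: ex_minnP => q /andP[nq pq] qmin; split=> // p pp np.
by apply: qmin; rewrite np.
Qed.

Lemma nth_primeS j : nth_prime j.+1 = next_prime (nth_prime j).
Proof. by []. Qed.

Lemma nth_prime_prime j : prime (nth_prime j).
Proof. by rewrite /nth_prime iterS; have [] := next_primeP (iter j next_prime 0%N). Qed.

Lemma nth_prime_ltS j : (nth_prime j < nth_prime j.+1)%N.
Proof. by rewrite nth_primeS; have [] := next_primeP (nth_prime j). Qed.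

Lemma nth_prime_mono i j : (i < j)%N -> (nth_prime i < nth_prime j)%N.
Proof.
elim: j => // j IH; rewrite ltnS leq_eqVlt => /predU1P[->|/IH h].
  exact: nth_prime_ltS.
exact: ltn_trans h (nth_prime_ltS j).
Qed.

Lemma nth_prime_inj : injective nth_prime.
Proof.
move=> i j e; case: (ltngtP i j) => // /nth_prime_mono; by rewrite e ltnn.
Qed.

Lemma ltn_nth_prime j : (j < nth_prime j)%N.
Proof.
elim: j => [|j IH]; first exact/prime_gt0/nth_prime_prime.
exact: leq_ltn_trans IH (nth_prime_ltS j).
Qed.

Lemma nth_prime_surj p : prime p -> exists j, nth_prime j = p.
Proof.
move=> pp; have ex : exists j, (p <= nth_prime j)%N.
  by exists p; exact/ltnW/ltn_nth_prime.
case: (ex_minnP ex) => -[|j] hj jmin; [exists 0%N|exists j.+1].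
  apply/eqP; rewrite eqn_leq hj andbT.
  by have [_ _] := next_primeP 0; apply=> //; exact: prime_gt0.
apply/eqP; rewrite eqn_leq hj andbT nth_primeS.
have [_ _] := next_primeP (nth_prime j); apply=> //.
by rewrite ltnNge; apply/negP => /jmin; rewrite ltnn.
Qed.

Lemma logn_nth_prime_big n j : (0 < n)%N -> (n <= j)%N -> logn (nth_prime j) n = 0%N.
Proof.
move=> n0 nj; apply/eqP; rewrite -leqn0 leqNgt logn_gt0 mem_primes.
rewrite nth_prime_prime n0 /=; apply/negP => /(dvdn_leq n0).
by rewrite leqNgt (leq_ltn_trans nj (ltn_nth_prime j)).
Qed.

Lemma eq_from_logn_nth_prime n k : (0 < n)%N -> (0 < k)%N ->
  (forall j, logn (nth_prime j) n = logn (nth_prime j) k) -> n = k.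
Proof.
move=> n0 k0 h; apply: eqn_from_log => // p.
case: (boolP (prime p)) => [/nth_prime_surj[j <-]//|np].
by rewrite (lognE p n) (lognE p k) (negbTE np).
Qed.

Lemma prime_power_product_gt0 nu : (0 < prime_power_product nu)%N.
Proof.
by apply: prodn_gt0 => j; rewrite expn_gt0 prime_gt0// nth_prime_prime.
Qed.

Lemma logn_prime_power_product nu j :
  logn (nth_prime j) (prime_power_product nu) = `|(nu`_j)%R|%N.
Proof.
have main B : logn (nth_prime j) (\prod_(i < B) nth_prime i ^ `|(nu`_i)%R|)%N =
    if (j < B)%N then `|(nu`_j)%R|%N else 0%N.
  elim: B => [|B IH]; first by rewrite big_ord0 logn1.
  rewrite big_ord_recr /= lognM; last 2 first.
  - by apply: prodn_gt0 => i; rewrite expn_gt0 prime_gt0// nth_prime_prime.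
  - by rewrite expn_gt0 prime_gt0// nth_prime_prime.
  rewrite IH lognX logn_prime ?nth_prime_prime// (inj_eq nth_prime_inj) ltnS.
  case: ltngtP => [_|_|->]; rewrite ?muln0 ?addn0 ?muln1 ?add0n//.
rewrite main; case: ltnP => // h; by rewrite nth_default.
Qed.

End Primes.

Section TorusCharacters.
Variable R : realType.
Implicit Types (z w : torus R) (nu : seq int).

Definition co (j : nat) z : R[i] := val (z j).

Lemma nc_co j z : nc (co j z) = 1.
Proof.
by have /eqP := valP (z j); rewrite normc_nc => /(@complexI R).
Qed.

Lemma co_neq0 j z : co j z != 0.
Proof. by rewrite -nc_eq0 nc_co oner_eq0. Qed.

Lemma co_inv j z : (co j z)^-1 = (co j z)^*.
Proof.
apply: (mulfI (co_neq0 j z)); rewrite mulfV ?co_neq0// nc_mul_conj nc_co.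
by rewrite expr1n.
Qed.

Lemma open_ReIm (P : R -> R -> Prop) :
  (forall x y, P x y -> exists e, 0 < e /\ forall x' y', `|x - x'| < e -> `|y - y'| < e -> P x' y') ->
  open [set s : R[i] | P (complex.Re s) (complex.Im s)].
Proof.
move=> h; rewrite openE => s /= /h[e [e0 he]].
apply/nbhs_ballP; exists e%:C => /=; first by rewrite ltcR.
move=> t; rewrite /ball /= lt_ncP => st; apply: he.
- by apply: le_lt_trans st; apply: le_trans (nc_Re _); rewrite ReD ReN.
- by apply: le_lt_trans st; apply: le_trans (nc_Im _); rewrite ImD ImN.
Qed.

Lemma measurable_cylinder j (U : set R[i]) : open U ->
  measurable ([set z | U (co j z)] : set (torus R)).
Proof. by move=> oU; apply: sub_sigma_algebra; exists j, U. Qed.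

Lemma measurable_fun_rays (f : torus R -> R) :
  (forall a, measurable [set z | a < f z]) -> measurable_fun [set: torus R] f.
Proof.
move=> h; apply: (measurability _ (RGenOInfty.measurableE R)) => _ [_ [a ->] <-].
rewrite setTI (_ : _ @^-1` _ = [set z | a < f z])//.
by apply/seteqP; split=> z /=; rewrite in_itv /= andbT.
Qed.

Lemma cmeas_co j : cmeas (co j).
Proof.
split; apply: measurable_fun_rays => a.
- apply: (measurable_cylinder j (U := [set s | a < complex.Re s])).
  apply: (open_ReIm (P := fun x y => a < x)) => x y ax; exists (x - a); rewrite subr_gt0.
  by split=> // x' y' /ltr_normlP[]; lra.
- apply: (measurable_cylinder j (U := [set s | a < complex.Im s])).
  apply: (open_ReIm (P := fun x y => a < y)) => x y ay; exists (y - a); rewrite subr_gt0.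
  by split=> // x' y' _ /ltr_normlP[]; lra.
Qed.

Lemma cmeas_co_exp j (k : int) : cmeas (fun z => co j z ^ k).
Proof.
case: k => n; first by exact: cmeas_exp (cmeas_co j).
have -> : (fun z => co j z ^ Negz n) = (fun z => (co j z)^* ^+ n.+1).
  by apply/funext => z; rewrite conjE -co_inv exprVn.
by apply: cmeas_exp; apply: cmeas_conj; exact: cmeas_co.
Qed.

Lemma cmeas_character nu : cmeas (fun z => character nu z).
Proof. by apply: cmeas_prod => j; exact: cmeas_co_exp. Qed.

Lemma character_widen nu B z : (size nu <= B)%N ->
  character nu z = \prod_(j < B) co j z ^ (nu`_j)%R.
Proof.
move=> sB; rewrite /character (big_ord_widen B (fun j => co j z ^ (nu`_j)%R) sB) big_mkcond.
apply: eq_bigr => j _; case: ltnP => // h.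
by rewrite nth_default// expr0z.
Qed.

Lemma eq_character nu nu' z : (forall j, nu`_j = nu'`_j) -> character nu z = character nu' z.
Proof.
move=> h; rewrite (character_widen z (leq_maxl (size nu) (size nu'))).
rewrite (character_widen z (leq_maxr (size nu) (size nu'))).
by apply: eq_bigr => j _; rewrite h.
Qed.

Lemma ncXz (s : R[i]) (k : int) : nc s = 1 -> nc (s ^ k) = 1.
Proof. by case: k => n s1; rewrite /exprz ?ncV ncX s1 expr1n ?invr1. Qed.

Lemma nc_prod (I : Type) (r : seq I) (F : I -> R[i]) :
  nc (\prod_(i <- r) F i) = \prod_(i <- r) nc (F i).
Proof. by elim/big_ind2 : _ => [|x1 x2 y1 y2 <- <-|//]; rewrite ?nc1 ?ncM. Qed.

Lemma nc_character nu z : nc (character nu z) = 1.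
Proof.
by rewrite /character nc_prod big1// => j _; apply: ncXz; exact: nc_co.
Qed.

Definition char_add nu nu' :=
  mkseq (fun j => nu`_j + nu'`_j) (maxn (size nu) (size nu')).

Lemma character_mul nu nu' z :
  character nu z * character nu' z = character (char_add nu nu') z.
Proof.
rewrite (character_widen z (leq_maxl (size nu) (size nu'))).
rewrite (character_widen z (leq_maxr (size nu) (size nu'))) -big_split /=.
rewrite /character size_mkseq; apply: eq_bigr => j _.
by rewrite nth_mkseq// expfzDr// co_neq0.
Qed.

Lemma character_nil z : character [::] z = 1.
Proof. by rewrite /character big_ord0. Qed.

(** The length [n] is enough: the prime of index [j] exceeds [j], so the primes of index at least
    [n] do not divide [n]. *)
Definition expo (n : nat) : seq int := mkseq (fun j => Posz (logn (nth_prime j) n)) n.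

Lemma nth_expo n j : (0 < n)%N -> (expo n)`_j = Posz (logn (nth_prime j) n).
Proof.
move=> n0; rewrite /expo; case: (ltnP j n) => h; first by rewrite nth_mkseq.
by rewrite nth_default ?size_mkseq// logn_nth_prime_big.
Qed.

Definition chi z (n : nat) : R[i] := character (expo n) z.

Lemma cmult_chi z : cmult (chi z).
Proof.
split=> [|n k n0 k0].
  rewrite /chi (@eq_character _ [::]) ?character_nil// => j.
  by rewrite nth_expo// logn1 nth_nil.
rewrite /chi character_mul; apply: eq_character => j.
rewrite nth_expo ?muln_gt0 ?n0// lognM// /char_add.
set B := maxn _ _; case: (ltnP j B) => h.
  by rewrite nth_mkseq// !nth_expo.
rewrite nth_default ?size_mkseq//; move: h; rewrite /B geq_max !size_mkseq => /andP[h1 h2].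
by rewrite !logn_nth_prime_big.
Qed.

(** Exponent sequences that differ only by trailing zeros give the same character, so distinctness
    is expressed by an entry. Such an entry is what [rip_character_neq] rotates. *)
Lemma char_neq_chi nu n : (0 < n)%N ->
  ~~ (all (fun k => 0 <= k) nu && (prime_power_product nu == n)) ->
  exists j, nu`_j != (expo n)`_j.
Proof.
move=> n0; rewrite negb_and => /orP[|].
  move=> /allPn[k /(nthP 0)[j js <-] nuj]; exists j.
  by rewrite nth_expo//; apply: contraNneq nuj => ->.
move=> nun; apply/not_existsP => h; move/eqP: nun; apply.
apply: eq_from_logn_nth_prime => //; first exact: prime_power_product_gt0.
move=> j; rewrite logn_prime_power_product.
have := h j => /negP; rewrite negbK => /eqP ->.
by rewrite nth_expo.
Qed.

Lemma circle_eit_subproof (x : R) : `|eit x| == 1.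
Proof. by rewrite normc_nc nc_eit. Qed.

Definition rot (j : nat) (x : R) : torus R := fun i =>
  if i == j then exist _ (eit x) (circle_eit_subproof x) else exist _ 1 (circle1_subproof R).

Lemma eit_exprz (x : R) (k : int) : eit x ^ k = eit (k%:~R * x).
Proof.
have nat_case n : eit x ^+ n = eit (n%:R * x).
  elim: n => [|n IH]; first by rewrite expr0 mul0r eit0.
  by rewrite exprS IH -eitD; congr eit; rewrite -natr1; ring.
case: k => n; first by rewrite /exprz nat_case.
rewrite /exprz nat_case NegzE mulrNz mulNr.
apply: (mulIf (_ : eit (n.+1%:R * x) != 0)).
  by rewrite -nc_eq0 nc_eit oner_eq0.
by rewrite mulVf -?eitD ?addNr ?eit0// -nc_eq0 nc_eit oner_eq0.
Qed.

Lemma co_mul j w z : co j (torus_mul w z) = co j w * co j z.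
Proof. by []. Qed.

Lemma character_rot nu j x z :
  character nu (torus_mul (rot j x) z) = eit ((nu`_j)%:~R * x) * character nu z.
Proof.
pose B := maxn (size nu) j.+1; have sB : (size nu <= B)%N by rewrite leq_maxl.
have jB : (j < B)%N by rewrite leq_max ltnSn orbT.
rewrite !(character_widen _ sB) (bigD1 (Ordinal jB))//= [in RHS](bigD1 (Ordinal jB))//=.
rewrite mulrA; congr (_ * _).
  by rewrite co_mul expfzMl /co /rot eqxx /= eit_exprz.
apply: eq_bigr => i ij; rewrite co_mul expfzMl {1}/co /rot.
by rewrite -val_eqE /= in ij; rewrite (negbTE ij) /= exp1rz mul1r.
Qed.

Section Haar.
Variable m : probability (torus R) R.
Hypothesis m_haar : is_haar m.

Lemma measurable_torus_mul w : measurable_fun [set: torus R] (torus_mul w).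
Proof.
apply: (@measurability _ _ (torus R) (torus R) setT (torus_mul w) (@torus_cylinder R)) => //.
move=> _ [_ [j [U [oU ->]]] <-]; rewrite setTI.
rewrite (_ : _ @^-1` _ = [set z | [set s | U (co j w * s)] (co j z)])//.
apply: measurable_cylinder; rewrite openE => s /= Us.
have := oU; rewrite openE => /(_ _ Us) /nbhs_ballP[e /= e0 he].
apply/nbhs_ballP; exists e => // t; rewrite /ball /= => st; apply: he.
rewrite /ball /= -mulrBr normrM.
have /eqP := valP (w j); rewrite /co => -> ; by rewrite mul1r.
Qed.

Lemma haar_esp w (f : torus R -> R) : intg m f -> measurable_fun setT f ->
  (exists M, forall z, `|f z| <= M) ->
  \int[m]_z f (torus_mul w z) = \int[m]_z f z.
Proof.
move=> fi mf [M fM]; rewrite /Rintegral; congr fine.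
have mw := measurable_torus_mul w.
have := @integral_pushforward _ _ _ _ R _ mw m setT (EFin \o f).
rewrite preimage_setT => <- //; last 2 first.
- exact/measurable_EFinP.
- apply: (intg_le (g := fun=> M)); [exact: measurableT_comp|exact: intg_cst|by move=> x; exact: fM].
apply: eq_measure_integral => A mA _.
exact: m_haar.
Qed.

(** Rotating the coordinate [j] by the angle [pi / l], with [l] the difference of the exponents,
    multiplies the integrand by -1; by invariance the integral equals its opposite. *)
Lemma rip_character_neq (a b : R[i]) nu nu' j : nu`_j != nu'`_j ->
  rip m (fun z => a * character nu z) (fun z => b * character nu' z) = 0.
Proof.
move=> nj; set l := (nu`_j - nu'`_j)%:~R : R.
have l0 : l != 0 by rewrite /l intr_eq0 subr_eq0.
pose K z := a * character nu z * (b * character nu' z)^*.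
have mK : cmeas K.
  apply: cmeasM; first by apply: cmeasM; [exact: cmeas_cst|exact: cmeas_character].
  by apply: cmeas_conj; apply: cmeasM; [exact: cmeas_cst|exact: cmeas_character].
have ncK z : nc (K z) = nc a * nc b.
  by rewrite /K ncM nc_conj !ncM !nc_character !mulr1.
have flip z : K (torus_mul (rot j (pi / l)) z) = - K z.
  rewrite /K !character_rot.
  transitivity (eit ((nu`_j)%:~R * (pi / l)) * (eit ((nu'`_j)%:~R * (pi / l)))^* * K z).
    by rewrite /K !rmorphM/=; ring.
  rewrite conjE eit_conj -eitD (_ : _ + _ = pi) ?eit_pi ?mulN1r//.
  by rewrite -mulNr -mulrDl -rmorphN -rmorphD -/l mulrC divfK.
have mre := mK.1.
have bre z : `|complex.Re (K z)| <= nc a * nc b by rewrite -(ncK z); exact: nc_Re.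
have ire : intg m (fun z => complex.Re (K z)).
  by apply: (intg_le (g := fun=> nc a * nc b)) => //; exact: intg_cst.
have := haar_esp (rot j (pi / l)) ire mre (ex_intro _ _ bre).
under eq_Rintegral do rewrite flip ReN -mulN1r.
rewrite RintegralZl// mulN1r => /eqP; rewrite eq_sym -addr_eq0 -mulr2n mulrn_eq0 /=.
by move/eqP.
Qed.

Lemma rip_character_eq (a b : R[i]) nu nu' : (forall j, nu`_j = nu'`_j) ->
  rip m (fun z => a * character nu z) (fun z => b * character nu' z) = complex.Re (a * b^*).
Proof.
move=> h; rewrite -[RHS](esp_cst m); apply: eq_Rintegral => z _.
rewrite -(eq_character z h) rmorphM/= mulrACA nc_mul_conj nc_character expr1n.
by rewrite mulr1.
Qed.

Lemma l2_character (a : R[i]) nu : l2 m (fun z => a * character nu z).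
Proof.
apply: (@l2_bounded _ _ _ _ _ (nc a)); first by apply: cmeasM; [exact: cmeas_cst|exact: cmeas_character].
by move=> z; rewrite ncM nc_character mulr1.
Qed.

End Haar.
End TorusCharacters.
(** * Density of trigonometric polynomials *)

Section Density.
Variable R : realType.
Variable m : probability (torus R) R.
Implicit Types (F G H : torus R -> R[i]) (A : set (torus R)).

Definition tpoly G := exists L : seq (R[i] * seq int),
  forall z, G z = \sum_(p <- L) p.1 * character p.2 z.

Lemma tpolyD F G : tpoly F -> tpoly G -> tpoly (fun z => F z + G z).
Proof.
by move=> [L hL] [L' hL']; exists (L ++ L') => z; rewrite big_cat/= hL hL'.
Qed.

Lemma tpolyM F G : tpoly F -> tpoly G -> tpoly (fun z => F z * G z).
Proof.
move=> [L hL] [L' hL'].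
exists [seq (p.1 * q.1, char_add p.2 q.2) | p <- L, q <- L'] => z.
rewrite hL hL' big_allpairs_dep big_distrlr/=; apply: eq_bigr => p _; apply: eq_bigr => q _.
by rewrite -character_mul mulrACA.
Qed.

Lemma tpoly_cst (a : R[i]) : tpoly (fun=> a).
Proof. by exists [:: (a, [::])] => z; rewrite big_seq1 character_nil mulr1. Qed.

Lemma tpolyZ (a : R[i]) F : tpoly F -> tpoly (fun z => a * F z).
Proof. by apply: tpolyM; exact: tpoly_cst. Qed.

Lemma tpoly_exp F n : tpoly F -> tpoly (fun z => F z ^+ n).
Proof.
move=> lF; elim: n => [|n IH].
  by under eq_fun do rewrite expr0; exact: tpoly_cst.
by under eq_fun do rewrite exprS; exact: tpolyM.
Qed.

Lemma tpoly_bounded F : tpoly F -> exists M, 0 <= M /\ forall z, nc (F z) <= M.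
Proof.
move=> [L hL]; exists (\sum_(p <- L) nc p.1); split.
  by apply: sumr_ge0 => p _; exact: normc_ge0.
move=> z; rewrite hL; apply: le_trans (nc_sum _ _ _) _.
by apply: ler_sum => p _; rewrite ncM nc_character mulr1.
Qed.

Lemma tpoly_cmeas F : tpoly F -> cmeas F.
Proof.
move=> [L hL]; rewrite (_ : F = fun z => \sum_(p <- L) p.1 * character p.2 z); last exact/funext.
apply: cmeas_sum => p; apply: cmeasM; [exact: cmeas_cst|exact: cmeas_character].
Qed.

Lemma tpoly_l2 F : tpoly F -> l2 m F.
Proof.
move=> tF; have [M [_ hM]] := tpoly_bounded tF.
exact: l2_bounded (tpoly_cmeas tF) hM.
Qed.

Lemma tpoly_co_exp j (k : int) : tpoly (fun z => co j z ^ k).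
Proof.
exists [:: (1, rcons (nseq j 0) k)] => z; rewrite big_seq1 mul1r.
rewrite /character size_rcons size_nseq big_ord_recr /= big1 ?mul1r.
  by rewrite nth_rcons size_nseq ltnn eqxx.
by move=> i _; rewrite nth_rcons size_nseq ltn_ord nth_nseq ltn_ord expr0z.
Qed.

Lemma tpoly_Re_co j : tpoly (fun z => (complex.Re (co j z))%:C).
Proof.
rewrite (_ : (fun _ => _) = fun z => 2^-1 * (co j z ^ 1 + co j z ^ (-1))).
  by apply: tpolyZ; apply: tpolyD; exact: tpoly_co_exp.
by apply/funext => z; rewrite expr1z -invr_expz expr1z co_inv ReJ_add mulrC.
Qed.

Lemma tpoly_Im_co j : tpoly (fun z => (complex.Im (co j z))%:C).
Proof.
rewrite (_ : (fun _ => _) = fun z => (2^-1 * 'i%C) * (co j z ^ (-1) + -1 * co j z ^ 1)).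
  apply: tpolyZ; apply: tpolyD; first exact: tpoly_co_exp.
  by apply: tpolyZ; exact: tpoly_co_exp.
apply/funext => z; rewrite expr1z -invr_expz expr1z co_inv ImJ_sub mulN1r.
ring.
Qed.

Definition apx G := l2 m G /\
  forall e : R, 0 < e -> exists Q, tpoly Q /\ nrm m (fun z => G z - Q z) <= e.

Lemma nrm_le_scale (K : R) F G : l2 m F -> l2 m G -> 0 <= K ->
  (forall z, nc (F z) <= K * nc (G z)) -> nrm m F <= K * nrm m G.
Proof.
move=> [mF iF] [mG iG] K0 h.
rewrite -(@ler_pXn2r _ 2)// ?nnegrE ?mulr_ge0 ?nrm_ge0//.
rewrite exprMn !nrm_sqr /nrm2 -RintegralZl//.
apply: esp_le => //; first exact: intgZ.
move=> z; rewrite -exprMn; apply: lerXn2r; rewrite ?nnegrE ?mulr_ge0 ?normc_ge0//.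
Qed.

Lemma apx_tpoly F : tpoly F -> apx F.
Proof.
move=> tF; split; first exact: tpoly_l2.
move=> e e0; exists F; split=> //; rewrite /nrm /nrm2.
under eq_Rintegral do rewrite subrr nc0 expr0n /=.
by rewrite esp_cst sqrtr0 ltW.
Qed.

Lemma apx_lim G : l2 m G ->
  (forall e, 0 < e -> exists H, apx H /\ nrm m (fun z => G z - H z) <= e) -> apx G.
Proof.
move=> lG h; split=> // e e0; have e2 : 0 < e / 2 by rewrite divr_gt0.
have [H [[lH aH] GH]] := h _ e2; have [Q [tQ HQ]] := aH _ e2.
exists Q; split=> //; have lQ := tpoly_l2 tQ.
apply: le_trans (nrm_triangleB lG lH lQ) _; lra.
Qed.

Lemma apx_cvg G (H : nat -> torus R -> R[i]) : l2 m G -> (forall n, apx (H n)) ->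
  nrm2 m (fun z => G z - H n z) @[n --> \oo] --> (0 : R) -> apx G.
Proof.
move=> lG aH /cvgrPdist_lt h; apply: apx_lim => // e e0.
have e2 : 0 < e ^+ 2 by rewrite exprn_gt0.
have [n /=] := @filter_ex _ \oo _ _ (h _ e2).
rewrite sub0r normrN ger0_norm ?nrm2_ge0// => hn; exists (H n); split=> //.
rewrite -(@ler_pXn2r _ 2)// ?nnegrE ?nrm_ge0 ?(ltW e0)//.
by rewrite nrm_sqr ltW.
Qed.

Lemma apxD F G : apx F -> apx G -> apx (fun z => F z + G z).
Proof.
move=> [lF aF] [lG aG]; split; first exact: l2D.
move=> e e0; have e2 : 0 < e / 2 by rewrite divr_gt0.
have [P [tP hP]] := aF _ e2; have [Q [tQ hQ]] := aG _ e2.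
exists (fun z => P z + Q z); split; first exact: tpolyD.
have -> : (fun z => F z + G z - (P z + Q z)) = (fun z => (F z - P z) + (G z - Q z)).
  by apply/funext => z; ring.
apply: le_trans (nrm_triangle (l2B lF (tpoly_l2 tP)) (l2B lG (tpoly_l2 tQ))) _; lra.
Qed.

Lemma apxZ (a : R[i]) F : apx F -> apx (fun z => a * F z).
Proof.
move=> [lF aF]; split; first exact: l2Z.
move=> e e0; have na : 0 < nc a + 1 by rewrite ltr_wpDl// normc_ge0.
have e2 : 0 < e / (nc a + 1) by rewrite divr_gt0.
have [P [tP hP]] := aF _ e2.
exists (fun z => a * P z); split; first exact: tpolyZ.
apply: (@le_trans _ _ ((nc a + 1) * nrm m (fun z => F z - P z))); last first.
  by rewrite mulrC -ler_pdivlMr.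
apply: nrm_le_scale; [|exact: l2B (tpoly_l2 tP)|exact: ltW|].
  by apply: l2B; apply: l2Z => //; exact: tpoly_l2.
by move=> z; rewrite -mulrBr ncM ler_wpM2r ?normc_ge0// lerDl.
Qed.

Lemma apx_sum (I : Type) (r : seq I) (F : I -> torus R -> R[i]) :
  (forall i, apx (F i)) -> apx (fun z => \sum_(i <- r) F i z).
Proof.
move=> lF; elim: r => [|i r IH].
  by under eq_fun do rewrite big_nil; apply: apx_tpoly; exact: tpoly_cst.
by under eq_fun do rewrite big_cons; exact: apxD.
Qed.

Definition ind A : torus R -> R[i] := fun z => (\1_A z)%:C.

Lemma nc_ind_le1 A z : nc (ind A z) <= 1.
Proof. by rewrite /ind ncR indicE normr_nat lern1 leq_b1. Qed.

Lemma l2_ind A : measurable A -> l2 m (ind A).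
Proof.
move=> mA; apply: (@l2_bounded _ _ _ _ _ 1); last exact: nc_ind_le1.
by split; [exact: measurable_indic|exact: measurable_cst].
Qed.

(** These sets form a sigma-algebra: complements are affine, intersections come from products,
    countable unions from dominated convergence. Once it contains the cylinders it contains all
    measurable sets, which gives density without a uniform approximation theorem on the torus. *)
Definition apx_set A := measurable A /\ apx (ind A).

Lemma apx_setC A : apx_set A -> apx_set (~` A).
Proof.
move=> [mA aA]; split; first exact: measurableC.
rewrite (_ : ind _ = fun z => 1 + -1 * ind A z).
  by apply: apxD; [apply: apx_tpoly; exact: tpoly_cst|exact: apxZ].
apply/funext => z; rewrite /ind !indicE in_setC mulN1r.
by case: (z \in A); rewrite /= ?subrr ?subr0.
Qed.

Lemma apx_setI A B : apx_set A -> apx_set B -> apx_set (A `&` B).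
Proof.
move=> [mA [lA aA]] [mB [lB aB]]; split; first exact: measurableI.
have lAB := l2_ind (measurableI _ _ mA mB).
split=> // e e0; have e2 : 0 < e / 2 by rewrite divr_gt0.
(* [Q] is chosen before [P], because the accuracy required of [P] depends on the sup bound [M] of
   [Q]. *)
have [Q [tQ hQ]] := aB _ e2; have [M [M0 hM]] := tpoly_bounded tQ.
have M1 : 0 < M + 1 by rewrite ltr_wpDl.
have e3 : 0 < e / 2 / (M + 1) by rewrite divr_gt0.
have [P [tP hP]] := aA _ e3.
exists (fun z => P z * Q z); split; first exact: tpolyM.
have lP := tpoly_l2 tP; have lQ := tpoly_l2 tQ.
pose U z := ind A z * (ind B z - Q z); pose V z := (ind A z - P z) * Q z.
have mU : cmeas U by apply: cmeasM; [exact: l2_cmeas lA|exact: l2_cmeas (l2B lB lQ)].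
have mV : cmeas V by apply: cmeasM; [exact: l2_cmeas (l2B lA lP)|exact: l2_cmeas lQ].
have [P' [P0' hP']] := tpoly_bounded tP.
have lU : l2 m U.
  apply: (@l2_bounded _ _ _ _ _ (1 * (1 + M))) => // z.
  rewrite /U ncM; apply: ler_pM; rewrite ?normc_ge0 ?nc_ind_le1//.
  by apply: le_trans (ncB _ _) _; rewrite lerD ?nc_ind_le1.
have lV : l2 m V.
  apply: (@l2_bounded _ _ _ _ _ ((1 + P') * M)) => // z.
  rewrite /V ncM; apply: ler_pM; rewrite ?normc_ge0//.
  by apply: le_trans (ncB _ _) _; rewrite lerD ?nc_ind_le1.
have -> : (fun z => ind (A `&` B) z - P z * Q z) = (fun z => U z + V z).
  apply/funext => z; rewrite /U /V.
  have -> : ind (A `&` B) z = ind A z * ind B z.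
    by rewrite /ind -rmorphM /= !indicE in_setI -natrM mulnb.
  ring.
apply: le_trans (nrm_triangle lU lV) _.
have hU : nrm m U <= 1 * nrm m (fun z => ind B z - Q z).
  apply: nrm_le_scale => //; first exact: l2B.
  by move=> z; rewrite /U ncM ler_wpM2r ?normc_ge0 ?nc_ind_le1.
have hV : nrm m V <= (M + 1) * nrm m (fun z => ind A z - P z).
  apply: nrm_le_scale => //; [exact: l2B|exact: ltW|].
  move=> z; rewrite /V ncM mulrC ler_wpM2r ?normc_ge0//.
  by apply: le_trans (hM z) _; rewrite lerDl.
have : (M + 1) * nrm m (fun z => ind A z - P z) <= e / 2.
  by rewrite mulrC -ler_pdivlMr.
lra.
Qed.

Lemma apx_setT : apx_set [set: torus R].
Proof.
split=> //; rewrite (_ : ind _ = fun=> 1); first by apply: apx_tpoly; exact: tpoly_cst.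
by apply/funext => z; rewrite /ind indicE in_setT.
Qed.

Lemma apx_setU A B : apx_set A -> apx_set B -> apx_set (A `|` B).
Proof.
move=> aA aB; rewrite -[A `|` B]setCK setCU; apply: apx_setC.
by apply: apx_setI; exact: apx_setC.
Qed.

Lemma apx_set_cvg A (B : nat -> torus R -> R[i]) (K : R) : measurable A ->
  (forall n, apx (B n)) -> (forall n z, nc (B n z) <= K) ->
  (forall z, B n z @[n --> \oo] --> ind A z) -> apx_set A.
Proof.
move=> mA aB B1 Bl; split=> //.
have lA := l2_ind mA.
apply: (apx_cvg (H := B)) => //.
rewrite -(esp_cst m 0).
apply: (esp_dominated (g := fun=> (1 + K) ^+ 2)).
- move=> n; apply: measurable_nc_sqr; apply: cmeasB; first exact: l2_cmeas lA.
  by have [lB _] := aB n; exact: l2_cmeas lB.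
- exact: measurable_cst.
- exact: intg_cst.
- move=> z; apply/cvgrPdist_lt => e e0.
  have e1 : 0 < Num.min 1 e by rewrite lt_min ltr01.
  have /cvgcP /(_ _ e1) := Bl z; apply: filterS => n.
  rewrite lt_min => /andP[h1 h2]; rewrite sub0r normrN ger0_norm ?sqr_ge0//.
  apply: le_lt_trans h2; rewrite expr2 -[leRHS]mulr1.
  by rewrite ler_wpM2l ?normc_ge0 ?(ltW h1).
- move=> n z; rewrite ger0_norm ?sqr_ge0//.
  have h : nc (ind A z - B n z) <= 1 + K.
    by apply: le_trans (ncB _ _) _; rewrite lerD ?nc_ind_le1.
  by apply: lerXn2r => //; rewrite nnegrE ?normc_ge0// (le_trans (normc_ge0 _) h).
Qed.

Lemma apx_set_bigcup (A : nat -> set (torus R)) :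
  (forall n, apx_set (A n)) -> apx_set (\bigcup_n A n).
Proof.
move=> aA; pose B n := \big[setU/set0]_(i < n) A i.
have aB n : apx_set (B n).
  elim: n => [|n IH]; last by rewrite /B big_ord_recr; exact: apx_setU.
  rewrite /B big_ord0 -setCT; apply: apx_setC; exact: apx_setT.
have mA : measurable (\bigcup_n A n) by apply: bigcupT_measurable => n; have [] := aA n.
apply: (@apx_set_cvg _ (fun n => ind (B n)) 1) => //.
- by move=> n; have [] := aB n.
- by move=> n z; exact: nc_ind_le1.
move=> z; apply/cvgcP => e e0.
case: (pselect ((\bigcup_n A n) z)) => hz; last first.
  apply: nearW => n; rewrite (_ : _ - _ = 0) ?nc0//; apply/eqP; rewrite subr_eq0; apply/eqP.
  rewrite /ind !indicE !memNset// => Bz; apply: hz.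
  by move: Bz; rewrite /B -bigcup_mkord => -[i _ Ai]; exists i.
have [i _ Ai] := hz.
near=> n; rewrite (_ : _ - _ = 0) ?nc0//; apply/eqP; rewrite subr_eq0; apply/eqP.
rewrite /ind !indicE !mem_set//.
have ni : (i < n)%N by near: n; exact: nbhs_infty_gt.
rewrite /B -bigcup_mkord; by exists i.
Unshelve. all: by end_near. Qed.

Lemma bernoulli_ge (x : R) k : 0 <= x <= 1 -> 1 - k%:R * x <= (1 - x) ^+ k.
Proof.
move=> /andP[x0 x1]; elim: k => [|k IH]; first by rewrite mul0r subr0 expr0.
rewrite exprS; apply: (@le_trans _ _ ((1 - x) * (1 - k%:R * x))).
  by rewrite -natr1; have := ler0n R k; nra.
by rewrite ler_wpM2l ?subr_ge0.
Qed.

Lemma onem_exp_le (x : R) k : 0 <= x <= 1 -> (1 - x) ^+ k <= expR (- (k%:R * x)).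
Proof.
move=> /andP[x0 x1]; rewrite -mulrN expRM_natl; apply: lerXn2r.
- by rewrite nnegrE subr_ge0.
- by rewrite nnegrE expR_ge0.
- exact: expR_ge1Dx.
Qed.

(** Write [q = r^2]. A Bernoulli-type induction bounds [n r^n] by [1 / (1 - r)], and the remaining
    factor [r^n] tends to 0. *)
Lemma cvg_nat_mul_exp (q : R) : 0 <= q < 1 -> n%:R * q ^+ n @[n --> \oo] --> (0 : R).
Proof.
move=> /andP[q0 q1]; set r := Num.sqrt q.
have r0 : 0 <= r by exact: sqrtr_ge0.
have rq : r ^+ 2 = q by rewrite sqr_sqrtr.
have r1 : r < 1 by rewrite -(@ltr_pXn2r _ 2)// ?nnegrE// rq expr1n.
have bnd n : n%:R * r ^+ n <= (1 - r)^-1.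
  have h : (1 + n%:R * (1 - r)) * r ^+ n <= 1.
    elim: n => [|n IH]; first by rewrite mul0r addr0 expr0 mulr1.
    apply: le_trans IH; rewrite exprS mulrA ler_wpM2r ?exprn_ge0//.
    have : 0 <= (n%:R + 1) * (1 - r) ^+ 2 by rewrite mulr_ge0 ?sqr_ge0.
    rewrite -natr1; set k := n%:R; nra.
  rewrite -[leRHS]mul1r ler_pdivlMr ?subr_gt0//.
  by have := exprn_ge0 n r0; nra.
have main : (1 - r)^-1 * r ^+ n @[n --> \oo] --> (0 : R).
  rewrite -[X in _ --> X](mulr0 (1 - r)^-1); apply: cvgMr.
  by apply: cvg_expr; rewrite ger0_norm.
apply: (squeeze_cvgr _ (@cvg_cst _ (0 : R) _ _ _) main).
apply: nearW => n; apply/andP; split; first by rewrite mulr_ge0// exprn_ge0.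
rewrite -rq -exprM mulnC exprM expr2 mulrA ler_wpM2r ?exprn_ge0//.
Qed.

(* [(1 - p^n)^(n 2^n)] tends to the indicator of [p < 1/2]. *)
Lemma apx_half_space (p : torus R -> R) : tpoly (fun z => (p z)%:C) ->
  (forall z, 0 <= p z <= 1) -> apx_set [set z | p z < 1 / 2].
Proof.
move=> tp p01.
have mp : measurable_fun [set: torus R] p by have [] := tpoly_cmeas tp.
have pn n z : 0 <= p z ^+ n <= 1.
  by have /andP[p0 p1] := p01 z; rewrite exprn_ge0 ?exprn_ile1.
apply: (@apx_set_cvg _ (fun n z => ((1 - p z ^+ n) ^+ (n * 2 ^ n))%:C) 1).
- rewrite -[X in measurable X]setTI (_ : [set _ | _] = p @^-1` `]-oo, (1/2)[%classic).
    exact: mp.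
  by apply/seteqP; split=> z /=; rewrite in_itv.
- move=> n; apply: apx_tpoly.
  rewrite (_ : (fun _ => _) = fun z => (1 + -1 * (p z)%:C ^+ n) ^+ (n * 2 ^ n)).
    apply: tpoly_exp; apply: tpolyD; first exact: tpoly_cst.
    by apply: tpolyZ; exact: tpoly_exp.
  by apply/funext => z; rewrite mulN1r rmorphXn rmorphB rmorph1 rmorphXn.
- move=> n z; rewrite ncR ger0_norm ?exprn_ge0 ?exprn_ile1 ?subr_ge0 ?(andP (pn n z)).2//.
  by rewrite gerBl (andP (pn n z)).1.
move=> z; rewrite /ind indicE.
have /andP[p0 p1] := p01 z.
(* The two regimes are separated by [n (2p)^n]. For [p < 1/2] it tends to 0 and Bernoulli gives the
   limit 1; for [p >= 1/2] it is at least [n] and the power is at most [e^(-n)]. *)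
have eqn n : (n * 2 ^ n)%:R * p z ^+ n = n%:R * (2 * p z) ^+ n.
  by rewrite natrM natrX exprMn mulrA.
have lim_real (l : R) : (1 - p z ^+ n) ^+ (n * 2 ^ n) @[n --> \oo] --> l ->
   ((1 - p z ^+ n) ^+ (n * 2 ^ n))%:C @[n --> \oo] --> l%:C.
  move=> h; apply: cvgc_ReIm => //=; exact: cvg_cst.
apply: lim_real; case: (ltP (p z) (1/2)) => hp.
  rewrite mem_set//=.
  have lim1 : 1 - n%:R * (2 * p z) ^+ n @[n --> \oo] --> (1 : R).
    rewrite -[X in _ --> X]subr0; apply: cvgB; first exact: cvg_cst.
    by apply: cvg_nat_mul_exp; apply/andP; split; lra.
  apply: (squeeze_cvgr _ lim1 (@cvg_cst _ (1 : R) _ _ _)).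
  apply: nearW => n; rewrite -eqn bernoulli_ge//=.
  rewrite exprn_ile1 ?subr_ge0 ?(andP (pn n z)).2//.
  by rewrite gerBl (andP (pn n z)).1.
rewrite memNset /=; last by apply/negP; rewrite -leNgt.
apply: (squeeze_cvgr _ (@cvg_cst _ (0 : R) _ _ _) (@cvgn_expR R)).
apply: nearW => n; rewrite exprn_ge0 ?subr_ge0 ?(andP (pn n z)).2//=.
apply: le_trans (onem_exp_le _ (pn n z)) _.
rewrite ler_expR lerN2 eqn -[leLHS]mulr1 ler_wpM2l//.
by apply: exprn_ege1; lra.
Qed.

Lemma apx_real_half_space (x : torus R -> R) (a : R) : tpoly (fun z => (x z)%:C) ->
  (forall z, `|x z| <= 1) -> apx_set [set z | x z < a].
Proof.
(* The affine map [x -> 1/2 + b (x - a)] sends [[-1, 1]] into [[0, 1]] and the threshold [a] to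
   [1/2]. *)
move=> tx x1; pose b := (2 * (1 + `|a|))^-1.
have b0 : 0 < b by rewrite invr_gt0 mulr_gt0// ltr_pwDl.
have bE : b * (1 + `|a|) = 1 / 2.
  by rewrite /b invfM -mulrA mulVf ?mulr1 ?div1r// gt_eqF// ltr_pwDl.
have := @apx_half_space (fun z => 1 / 2 + b * (x z - a)).
rewrite (_ : [set z | _ < 1 / 2] = [set z | x z < a]).
  apply.
    rewrite (_ : (fun _ => _) = fun z => (1 / 2 - b * a)%:C + b%:C * (x z)%:C).
      by apply: tpolyD; [exact: tpoly_cst|exact: tpolyZ].
    by apply/funext => z; rewrite -rmorphM -rmorphD; congr (_%:C); ring.
  move=> z; have : b * `|x z - a| <= 1 / 2.
    rewrite -bE ler_wpM2l ?(ltW b0)//; apply: le_trans (ler_normB _ _) _.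
    by rewrite lerD.
  rewrite -{1}(ger0_norm (ltW b0)) -normrM ler_norml => /andP[h1 h2].
  by apply/andP; split; lra.
apply/seteqP; split=> z /=; first by rewrite gtrDl pmulr_rlt0// subr_lt0.
by rewrite gtrDl pmulr_rlt0// subr_lt0.
Qed.

Lemma apx_box j (a b a' b' : R) :
  apx_set [set z | a < complex.Re (co j z) < b /\ a' < complex.Im (co j z) < b'].
Proof.
have half (x : torus R -> R) (u v : R) : tpoly (fun z => (x z)%:C) ->
    (forall z, `|x z| <= 1) -> apx_set [set z | u < x z < v].
  move=> tx x1.
  rewrite (_ : [set z | _] = [set z | - x z < - u] `&` [set z | x z < v]).
    apply: apx_setI; last exact: apx_real_half_space.
    apply: apx_real_half_space; last by move=> z; rewrite normrN.
    rewrite (_ : (fun _ => _) = fun z => -1 * (x z)%:C); first exact: tpolyZ.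
    by apply/funext => z; rewrite rmorphN mulN1r.
  by apply/seteqP; split=> z /=; rewrite ltrN2 => /andP.
rewrite (_ : [set z | _] = [set z | a < complex.Re (co j z) < b] `&`
   [set z | a' < complex.Im (co j z) < b'])//.
apply: apx_setI; apply: half.
- exact: tpoly_Re_co.
- by move=> z; rewrite -(nc_co j z) nc_Re.
- exact: tpoly_Im_co.
- by move=> z; rewrite -(nc_co j z) nc_Im.
Qed.

(** An open set is the union of the rational boxes it contains. The boxes are enumerated through an
    encoding in [nat]; numbers that encode no box, or a box not inside [U], contribute the empty
    set. *)
Lemma apx_cylinder j (U : set R[i]) : open U -> apx_set [set z | U (co j z)].
Proof.
move=> oU.
have [pk [upk pkK]] : exists (pk : (rat * rat) * (rat * rat) -> nat) upk, pcancel pk upk.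
  by exists pickle, unpickle; exact: pickleK.
pose box (q : (rat * rat) * (rat * rat)) : set R[i] :=
  [set s | ratr q.1.1 < complex.Re s < ratr q.1.2 /\ ratr q.2.1 < complex.Im s < ratr q.2.2].
pose A n : set (torus R) := if upk n is Some q then
  (if `[< box q `<=` U >] then [set z | box q (co j z)] else set0) else set0.
rewrite (_ : [set z | _] = \bigcup_n A n).
  apply: apx_set_bigcup => n; rewrite /A; case: (upk n) => [q|].
    case: ifP => _; first exact: apx_box.
    by rewrite -setCT; apply: apx_setC; exact: apx_setT.
  by rewrite -setCT; apply: apx_setC; exact: apx_setT.
apply/seteqP; split=> z /=; last first.
  move=> [n _]; rewrite /A; case: (upk n) => [q|//].
  by case: asboolP => //= bU /bU.
move=> Uz; have := oU; rewrite openE => /(_ _ Uz) /nbhs_ballP[e /= /complex_gt0P[-> e0] he].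
set e' := complex.Re e in e0 he; set s := co j z in Uz he *.
have e2 : 0 < e' / 2 by rewrite divr_gt0.
have rats (x : R) : exists p q : rat, x - e' / 2 < ratr p < x /\ x < ratr q < x + e' / 2.
  have lo : x - e' / 2 < x by rewrite ltrBlDr ltrDl.
  have hi : x < x + e' / 2 by rewrite ltrDl.
  have [p] := rat_in_itvoo lo; have [q] := rat_in_itvoo hi.
  by rewrite !in_itv /= => hq hp; exists p, q.
have [p1 [q1 [/andP[h1 h2] /andP[h3 h4]]]] := rats (complex.Re s).
have [p2 [q2 [/andP[k1 k2] /andP[k3 k4]]]] := rats (complex.Im s).
exists (pk ((p1, q1), (p2, q2))) => //; rewrite /A pkK.
case: asboolP => [_|[]].
  by split; apply/andP; split.
move=> t [/= /andP[l1 l2] /andP[l3 l4]]; apply: he; rewrite /ball /= lt_ncP.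
apply: le_lt_trans (nc_le_ReIm _) _; rewrite ReD ImD ReN ImN.
have : `|complex.Re s - complex.Re t| < e' / 2 by rewrite ltr_norml; apply/andP; split; lra.
have : `|complex.Im s - complex.Im t| < e' / 2 by rewrite ltr_norml; apply/andP; split; lra.
lra.
Qed.

Lemma apx_measurable A : measurable A -> apx_set A.
Proof.
move: A; apply: smallest_sub; last first.
  by move=> _ [j [U [oU ->]]]; exact: apx_cylinder.
split; first by rewrite -setCT; apply: apx_setC; exact: apx_setT.
- by move=> A aA; rewrite setTD; exact: apx_setC.
- exact: apx_set_bigcup.
Qed.

(** The sum is the minimum of [M] and the integer part of [y]. In this form a staircase function is
    a finite sum of indicators of superlevel sets. *)
Lemma count_le_bounds (y : R) M : 0 <= y ->
  [/\ 0 <= \sum_(k < M) (k.+1%:R <= y :> R)%:R :> R,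
      \sum_(k < M) (k.+1%:R <= y :> R)%:R <= y &
      (y <= M%:R -> y - 1 <= \sum_(k < M) (k.+1%:R <= y :> R)%:R)].
Proof.
move=> y0.
have full N : N%:R <= y -> \sum_(k < N) (k.+1%:R <= y :> R)%:R = N%:R :> R.
  move=> Ny; rewrite (eq_bigr (fun=> 1)) ?sumr_const ?card_ord// => k _.
  by rewrite (le_trans _ Ny)// ler_nat.
split; first by apply: sumr_ge0.
- elim: M => [|M IH]; first by rewrite big_ord0.
  case: (leP M.+1%:R y) => h; first by rewrite full.
  by rewrite big_ord_recr/= [(_ <= y)]leNgt h /= addr0.
- elim: M => [|M IH] h.
    by rewrite big_ord0; have -> : y = 0; [apply/le_anti; rewrite h y0|lra].
  rewrite big_ord_recr/=; case: (leP y M%:R) => [/IH h'|h'].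
    by apply: le_trans h' _; rewrite lerDl.
  rewrite full ?(ltW h')// -(natr1 M) in h *.
  by have : 0 <= (M%:R + 1 <= y :> R)%:R :> R by []; lra.
Qed.

Lemma apx_nonneg (f : torus R -> R) : measurable_fun [set: torus R] f ->
  (forall z, 0 <= f z) -> intg m (fun z => f z ^+ 2) -> apx (fun z => (f z)%:C).
Proof.
move=> mf f0 if2.
have lf : l2 m (fun z => (f z)%:C).
  split; first by split=> //; exact: measurable_cst.
  rewrite (_ : (fun _ => _) = (fun z => f z ^+ 2))//.
  by apply/funext => z; rewrite ncR real_normK ?num_real.
(* [(n+1)^2] steps of height [1/(n+1)] reach up to [n + 1], so [g n z] is within [1/(n+1)] of [f z]
   as soon as [f z <= n + 1]. *)
pose g n z : R := n.+1%:R^-1 * \sum_(k < n.+1 * n.+1) (k.+1%:R <= n.+1%:R * f z :> R)%:R.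
have nf n z : 0 <= n.+1%:R * f z by rewrite mulr_ge0.
have gb n z : 0 <= g n z <= f z.
  have [h1 h2 _] := count_le_bounds (n.+1 * n.+1) (nf n z).
  by rewrite /g mulr_ge0//= ler_pdivrMl.
have ag n : apx (fun z => (g n z)%:C).
  rewrite (_ : (fun _ => _) = fun z => (n.+1%:R^-1)%:C *
     \sum_(k <- enum 'I_(n.+1 * n.+1)) ind [set z | k.+1%:R / n.+1%:R <= f z] z).
    apply: apxZ; apply: apx_sum => k; apply: (apx_measurable _).2.
    rewrite -[X in measurable X]setTI (_ : [set _ | _] = f @^-1` `[k.+1%:R / n.+1%:R, +oo[%classic).
      exact: mf.
    by apply/seteqP; split=> z /=; rewrite in_itv /= andbT.
  apply/funext => z; rewrite /g rmorphM /= big_enum /= rmorph_sum /=; congr (_ * _).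
  apply: eq_bigr => k _; rewrite /ind indicE; congr ((nat_of_bool _)%:R%:C).
  by apply/idP/idP; rewrite inE /= ler_pdivrMr// mulrC.
have mg n : measurable_fun [set: torus R] (g n) by have [[[]]] := ag n.
apply: (apx_cvg (H := fun n z => (g n z)%:C)) => //.
rewrite -(esp_cst m 0).
apply: (esp_dominated (g := fun z => f z ^+ 2)) => //.
- have mC (h : torus R -> R) : measurable_fun [set: torus R] h -> cmeas (fun z => (h z)%:C).
    by move=> mh; split=> //; exact: measurable_cst.
  by move=> n; apply: measurable_nc_sqr; apply: cmeasB; exact: mC.
- move=> z.
  have lim : f z - g n z @[n --> \oo] --> (0 : R).
    apply: (squeeze_cvgr _ (@cvg_cst _ (0 : R) _ _ _) (@cvg_harmonic R)).
    near=> n; rewrite subr_ge0 (andP (gb n z)).2 /=.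
    have fn : f z <= n.+1%:R.
      have : (Num.bound (f z) <= n)%N by near: n; exact: nbhs_infty_ge.
      move=> h; apply/ltW; apply: lt_le_trans (archi_boundP (f0 z)) _.
      by rewrite ler_nat leqW.
    have [_ _ h] := count_le_bounds (n.+1 * n.+1) (nf n z).
    have hle : n.+1%:R * f z <= (n.+1 * n.+1)%:R by rewrite natrM ler_wpM2l.
    have hn : 0 <= n.+1%:R^-1 :> R by rewrite invr_ge0.
    have := ler_wpM2l hn (h hle); rewrite mulrBr mulr1 mulrA mulVf ?pnatr_eq0// mul1r.
    by rewrite /g lerBlDr => h'; rewrite lerBlDr addrC.
  under eq_fun do rewrite -rmorphB ncR real_normK ?num_real// expr2.
  have h := cvgM lim lim; rewrite mulr0 in h; exact: h.
- move=> n z; rewrite -rmorphB ncR real_normK ?num_real// ger0_norm ?sqr_ge0//.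
  have /andP[g0 g1] := gb n z.
  by apply: lerXn2r; rewrite ?nnegrE ?subr_ge0// gerBl.
Unshelve. all: by end_near. Qed.

Lemma apx_l2 F : l2 m F -> apx F.
Proof.
move=> [[m1 m2] iF].
have real (f : torus R -> R) : measurable_fun [set: torus R] f ->
    intg m (fun z => f z ^+ 2) -> apx (fun z => (f z)%:C).
  move=> mf if2.
  have part (g : torus R -> R) : measurable_fun [set: torus R] g ->
      (forall z, 0 <= g z <= `|f z|) -> apx (fun z => (g z)%:C).
    move=> mg gf; apply: apx_nonneg => //; first by move=> z; have /andP[] := gf z.
    apply: intg_le if2 _; first exact: measurable_funX.
    move=> z; rewrite ger0_norm ?sqr_ge0// -(real_normK (num_real (f z))).
    by have /andP[g0 g1] := gf z; apply: lerXn2r; rewrite ?nnegrE.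
  rewrite (_ : (fun _ => _) = fun z => (Num.max (f z) 0)%:C + -1 * (Num.max (- f z) 0)%:C).
    apply: apxD; [|apply: apxZ]; apply: part.
    - exact: measurable_maxr.
    - by move=> z; rewrite le_max lexx orbT ge_max ler_norm normr_ge0.
    - by apply: measurable_maxr => //; exact: measurableT_comp.
    - by move=> z; rewrite le_max lexx orbT ge_max -normrN ler_norm normr_ge0.
  apply/funext => z; rewrite mulN1r -rmorphN -rmorphD; congr (_%:C).
  by rewrite !maxEle; case: (leP (f z) 0) => h; rewrite oppr_le0 ?(ltW h);
    case: (leP 0 (f z)) => h'; lra.
rewrite (_ : F = fun z => (complex.Re (F z))%:C + 'i%C * (complex.Im (F z))%:C); last first.
  by apply/funext => z; rewrite -complexE.
apply: apxD; [|apply: apxZ]; apply: real => //.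
- apply: intg_le iF _; first exact: measurable_funX.
  by move=> z; rewrite ger0_norm ?sqr_ge0// nc_sqr lerDl sqr_ge0.
- apply: intg_le iF _; first exact: measurable_funX.
  by move=> z; rewrite ger0_norm ?sqr_ge0// nc_sqr lerDr sqr_ge0.
Qed.

End Density.
(** * Bohr lifts and the boundary function *)

Section BohrLift.
Variable R : realType.
Variable m : probability (torus R) R.
Hypothesis m_haar : is_haar m.
Implicit Types (b c : nat -> R[i]) (F G : torus R -> R[i]).

Definition lift b N : torus R -> R[i] := fun z => dsum (chi z) b N.

Lemma tpoly_lift b N : tpoly (lift b N).
Proof.
exists [seq (b k, expo k.+1) | k <- iota 0 N] => z.
by rewrite big_map /lift /dsum -(big_mkord xpredT (fun k => b k * chi z k.+1)) /index_iota subn0.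
Qed.

Lemma l2_lift b N : l2 m (lift b N).
Proof. exact/tpoly_l2/tpoly_lift. Qed.

Lemma cmeas_lift b N : cmeas (lift b N).
Proof. exact/tpoly_cmeas/tpoly_lift. Qed.

Lemma rip_fourier F (a : R[i]) nu : l2 m F ->
  rip m F (fun z => a * character nu z) = complex.Re (fourier_coef m F nu * a^*).
Proof.
move=> lF; have lc (b : R[i]) := @l2_character R m b nu.
have i1 : intg m (fun z => complex.Re (F z * (character nu z)^*)).
  have := intg_rip lF (lc 1); congr intg.
  by apply/funext => z; rewrite mul1r.
have i2 : intg m (fun z => complex.Im (F z * (character nu z)^*)).
  have := intg_rip lF (lc 'i%C); congr intg.
  apply/funext => z; rewrite rmorphM mulrCA ReM /= mul0r sub0r mulN1r opprK //.
rewrite ReM /fourier_coef /= Re_conj Im_conj.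
rewrite -!RintegralZr// -RintegralB//; last 2 first.
- rewrite (_ : (fun _ => _) = fun z => complex.Re a * complex.Re (F z * (character nu z)^*)).
    exact: intgZ.
  by apply/funext => z; rewrite mulrC.
- rewrite (_ : (fun _ => _) = fun z => - complex.Im a * complex.Im (F z * (character nu z)^*)).
    exact: intgZ.
  by apply/funext => z; rewrite mulrC.
apply: eq_Rintegral => z _.
have -> : F z * (a * character nu z)^* = (F z * (character nu z)^*) * a^*.
  by rewrite rmorphM mulrA mulrAC.
by rewrite ReM Re_conj Im_conj.
Qed.

Lemma rip_lift_character b N (a : R[i]) nu :
  rip m (lift b N) (fun z => a * character nu z) =
  if all (fun k => 0 <= k) nu && ((prime_power_product nu).-1 < N)%N
  then complex.Re (b (prime_power_product nu).-1 * a^*) else 0.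
Proof.
have la := @l2_character R m a nu.
rewrite /lift /dsum rip_suml//; last by move=> k; exact: l2_character.
have neq (k : nat) : ~~ (all (fun k => 0 <= k) nu && (prime_power_product nu == k.+1)) ->
    rip m (fun z => b k * chi z k.+1) (fun z => a * character nu z) = 0.
  move=> /(char_neq_chi (ltn0Sn k))[j hj].
  by apply: (@rip_character_neq R m m_haar _ _ _ _ j); rewrite eq_sym.
have [nu0|nu0] := boolP (all _ nu); last first.
  by rewrite big1// => k _; apply: neq; rewrite (negbTE nu0).
have p0 := prime_power_product_gt0 nu.
case: ltnP => h /=.
  rewrite (bigD1 (Ordinal h))//= big1 ?addr0 => [|k kh].
    rewrite /chi prednK//; apply: (@rip_character_eq R m) => j.
    rewrite nth_expo// logn_prime_power_product.
    case: (ltnP j (size nu)) => hj; last by rewrite nth_default.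
    by rewrite gez0_abs//; apply: (allP nu0); exact: mem_nth.
  apply: neq; rewrite nu0 /=; apply: contra kh => /eqP e.
  by apply/eqP/val_inj; rewrite /= e.
rewrite big1// => k _; apply: neq; rewrite nu0 /=; apply/negP => /eqP e.
by move: h; rewrite e /= leqNgt ltn_ord.
Qed.

Lemma nrm2_lift b N : nrm2 m (lift b N) = \sum_(k < N) nc (b k) ^+ 2.
Proof.
rewrite -rip_nrm2 {2}/lift /dsum rip_sumr; [|by move=> k; exact: l2_character|exact: l2_lift].
apply: eq_bigr => k _; rewrite /chi rip_lift_character.
have -> : all (fun k => 0 <= k) (expo k.+1) by apply/allP => x /mapP[j _ ->].
have -> : prime_power_product (expo k.+1) = k.+1.
  apply: eq_from_logn_nth_prime => //; first exact: prime_power_product_gt0.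
  by move=> j; rewrite logn_prime_power_product nth_expo.
by rewrite /= ltn_ord nc_mul_conj.
Qed.

(** The difference [D] between [F] and its partial sum is orthogonal to every character of index at
    most [N], including those with a negative exponent, where both coefficients vanish. Hence
    [|D|^2 = (D, F - Q)] for the trigonometric polynomial [Q], and [|D| <= |F - Q|]. *)
Lemma lift_dist_cvg c F : l2 m F ->
  (forall nu : seq int, fourier_coef m F nu =
        if all (fun k => 0 <= k) nu then c (prime_power_product nu).-1 else 0) ->
  forall e : R, 0 < e -> exists N0, forall N, (N0 <= N)%N ->
    nrm m (fun z => F z - lift c N z) <= e.
Proof.
move=> lF Fc e e0.
have [_ /(_ _ e0) [Q [[L hL] FQ]]] := apx_l2 lF.
(* The sum dominates every index that occurs in [Q]. *)
exists (\sum_(p <- L) prime_power_product p.2)%N => N NL.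
have lS := l2_lift c N.
pose D z := F z - lift c N z; have lD : l2 m D := l2B lF lS.
have orth (a : R[i]) nu : ((prime_power_product nu).-1 < N)%N ->
    rip m D (fun z => a * character nu z) = 0.
  move=> h; rewrite /D ripBl//; last exact: l2_character.
  rewrite rip_fourier// Fc rip_lift_character h andbT.
  by case: ifP => _; rewrite ?subrr// mul0r /= subr0.
have DQ : rip m D Q = 0.
  rewrite (_ : Q = fun z => \sum_(p <- L) p.1 * character p.2 z); last exact/funext.
  rewrite rip_sumr//; last by move=> p; exact: l2_character.
  rewrite big_seq big1// => p pL; apply: orth; rewrite prednK ?prime_power_product_gt0//.
  by apply: leq_trans NL; rewrite (big_rem p)//= leq_addr.
have DS : rip m D (lift c N) = 0.
  rewrite /lift /dsum rip_sumr//; last by move=> k; exact: l2_character.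
  rewrite big1// => k _; apply: orth.
  have -> : prime_power_product (expo k.+1) = k.+1; last exact: ltn_ord.
  apply: eq_from_logn_nth_prime => //; first exact: prime_power_product_gt0.
  by move=> j; rewrite logn_prime_power_product nth_expo.
have lQ : l2 m Q by apply: tpoly_l2; exists L.
have key : nrm m D ^+ 2 <= nrm m D * nrm m (fun z => F z - Q z).
  rewrite nrm_sqr -rip_nrm2 {2}/D ripBr// DS subr0 -[rip m D F]subr0 -DQ -ripBr//.
  by apply: rip_le => //; exact: l2B.
have [D0|D0] := eqVneq (nrm m D) 0; first by rewrite -/D D0 ltW.
have Dp : 0 < nrm m D by rewrite lt_neqAle eq_sym D0 nrm_ge0.
by apply: le_trans FQ; move: key; rewrite expr2 ler_pM2l.
Qed.

Definition null_set (A : set (torus R)) := measurable A /\ pr m A = 0.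

Lemma null_bigcup (A : nat -> set (torus R)) :
  (forall n, null_set (A n)) -> null_set (\bigcup_n A n).
Proof.
move=> h; have mA : measurable (\bigcup_n A n) by apply: bigcupT_measurable => n; have [] := h n.
split=> //; apply/EFin_inj; rewrite -prE//; apply/eqP; rewrite eq_le measure_ge0 andbT.
apply: le_trans (measure_sigma_subadditive m _ mA (@subset_refl _ _)) _.
  by move=> n; have [] := h n.
rewrite eseries0// => n _ _; have [mn n0] := h n.
by have := prE m mn; rewrite n0.
Qed.

Lemma null_setU A B : null_set A -> null_set B -> null_set (A `|` B).
Proof.
move=> nA nB; rewrite -bigcup2E; apply: null_bigcup => -[|[|n]] //=.
by split=> //; rewrite /pr measure0.
Qed.

(* The [2k]-th moment of the lift is the squared coefficient norm of the [k]-th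
   power of the polynomial, hence at most [S ^+ (2 * k)]. *)
Lemma lift_ae_bound b N (S : R) : (forall t, nc (dirichlet b N (0 +i* t)) <= S) ->
  exists A, null_set A /\ forall z, ~ A z -> nc (lift b N z) <= S.
Proof.
move=> hS; have S0 : 0 <= S := le_trans (normc_ge0 _) (hS 0).
pose A j := [set z | S + j.+1%:R^-1 <= nc (lift b N z)].
have nA j : null_set (A j).
  have j0 : 0 < j.+1%:R^-1 :> R by rewrite invr_gt0.
  set S' := S + j.+1%:R^-1; have S'0 : 0 < S' by rewrite ltr_wpDl.
  have mA : measurable (A j).
    by apply: measurable_nc_ge; [exact: cmeas_lift|exact: ltW].
  split=> //; apply/eqP; rewrite eq_le pr_ge0 andbT.
  pose q := (S / S') ^+ 2.
  have q01 : 0 <= q < 1.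
    rewrite /q sqr_ge0 /= expr_lt1 ?divr_ge0 ?(ltW S'0)//.
    by rewrite ltr_pdivrMr// mul1r ltrDl.
  have bnd k : pr m (A j) <= q ^+ k.
    have [d [K hd]] := dsum_exp b N k.
    have mB : measurable [set z | S' ^+ k <= nc (lift d K z)].
      by apply: measurable_nc_ge; [exact: cmeas_lift|rewrite exprn_ge0 ?(ltW S'0)].
    apply: (@le_trans _ _ (pr m [set z | S' ^+ k <= nc (lift d K z)])).
      apply: pr_mono => // z /= Az.
      rewrite /lift -hd; last exact: cmult_chi.
      by rewrite ncX; apply: lerXn2r => //; rewrite nnegrE ?normc_ge0 ?(ltW S'0).
    apply: le_trans (markov_nrm2 (l2_lift d K) _) _; first exact: exprn_gt0.
    have -> : q ^+ k = (S ^+ k) ^+ 2 / (S' ^+ k) ^+ 2.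
      by rewrite /q !expr_div_n -!exprM ![(2 * k)%N]mulnC.
    rewrite nrm2_lift ler_wpM2r ?invr_ge0 ?exprn_ge0 ?sqr_ge0 ?(ltW S'0)//.
    apply: dirichlet_mean_sqr => t.
    rewrite dirichletE -hd; last exact: cmult_nat_cpowN.
    rewrite ncX; apply: lerXn2r; rewrite ?nnegrE ?normc_ge0//; exact: hS.
  have lim : q ^+ k @[k --> \oo] --> (0 : R).
    by apply: cvg_expr; rewrite ger0_norm; have /andP[] := q01.
  rewrite -(cvg_lim _ lim)//; apply: limr_ge; first by apply/cvg_ex; exists 0.
  by apply: nearW => k; exact: bnd.
exists (\bigcup_j A j); split; first exact: null_bigcup.
move=> z hz; apply/ler_addgt0Pr => e e0.
have [j je] : exists j : nat, j.+1%:R^-1 <= e.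
  exists (Num.truncn e^-1); rewrite -[leRHS]invrK lef_pV2 ?posrE ?invr_gt0//.
  exact/ltW/Num.Theory.truncnS_gt.
rewrite leNgt; apply/negP => h; apply: hz; exists j => //=.
by apply/ltW; apply: le_lt_trans h; rewrite lerD2l.
Qed.

(* Large discs centred on the real axis exhaust the half-plane. *)
Lemma lift_ae_halfplane b N (a B e : R) : 0 < e ->
  (forall t, a <= complex.Re (dirichlet b N (0 +i* t))) ->
  (forall t, nc (dirichlet b N (0 +i* t)) <= B) ->
  exists A, null_set A /\ forall z, ~ A z -> a - e <= complex.Re (lift b N z).
Proof.
move=> e0 ha hB; have B0 : 0 <= B := le_trans (normc_ge0 _) (hB 0).
pose C := B + `|a|; have C0 : 0 <= C by rewrite addr_ge0.
(* The values lie in the disc of centre [a + L] and radius [sqrt (L^2 + C^2)]. This radius is at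
   most [L + C^2 / (2 L) <= L + e], so the disc stays to the right of [a - e]. *)
pose L := C ^+ 2 / (2 * e) + 1.
have L0 : 0 < L by rewrite ltr_wpDl// divr_ge0 ?sqr_ge0// mulr_ge0// ltW.
have [d [K hd]] := dsum_const (- (a + L)%:C : R[i]).
have [d' [K' hd']] := dsum_add b N d K.
have shift h : cmult h -> dsum h d' K' = dsum h b N - (a + L)%:C.
  by move=> hm; rewrite -hd' hd.
have [|A [nA hA]] := @lift_ae_bound d' K' (Num.sqrt (L ^+ 2 + C ^+ 2)).
  move=> t; rewrite dirichletE shift; last exact: cmult_nat_cpowN.
  rewrite -dirichletE; set w := dirichlet _ _ _.
  rewrite -[leLHS](ger0_norm (normc_ge0 _)) -sqrtr_sqr ler_wsqrtr//.
  rewrite nc_sqr ReD ImD ReN ImN /= oppr0 addr0.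
  have := ha t; have := hB t; rewrite -/w => h1 h2.
  have h3 : (complex.Re w - a) ^+ 2 + complex.Im w ^+ 2 <= C ^+ 2.
    have -> : (complex.Re w - a) ^+ 2 + complex.Im w ^+ 2 = nc (w - a%:C) ^+ 2.
      by rewrite nc_sqr ReD ImD ReN ImN /= oppr0 addr0.
    apply: lerXn2r; rewrite ?nnegrE ?normc_ge0//.
    by apply: le_trans (ncB _ _) _; rewrite ncR lerD2r.
  nra.
exists A; split=> // z /hA.
rewrite /lift shift; last exact: cmult_chi.
set w := dsum _ _ _ => h.
have : nc (w - (a + L)%:C) ^+ 2 <= L ^+ 2 + C ^+ 2.
  rewrite -[leRHS]sqr_sqrtr ?addr_ge0 ?sqr_ge0//.
  by apply: lerXn2r; rewrite ?nnegrE ?normc_ge0 ?sqrtr_ge0.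
rewrite nc_sqr ReD ImD ReN ImN /= oppr0 addr0 => h1.
have h2 : C ^+ 2 <= 2 * L * e.
  have : C ^+ 2 / (2 * e) <= L by rewrite lerDl.
  by rewrite ler_pdivrMr ?mulr_gt0//; lra.
rewrite leNgt; apply/negP => h3.
have := sqr_ge0 (complex.Im w); nra.
Qed.

Definition lipc b N : R := \sum_(k < N) nc (b k) * (3 * ln k.+1%:R).

Lemma lipc_ge0 b N : 0 <= lipc b N.
Proof.
by apply: sumr_ge0 => k _; rewrite !mulr_ge0 ?normc_ge0 ?ln_ge0 ?ler1n.
Qed.

Lemma dirichlet_lip b N (s t : R[i]) : 0 <= complex.Re s -> 0 <= complex.Re t ->
  nc (dirichlet b N s - dirichlet b N t) <= lipc b N * nc (s - t).
Proof.
move=> s0 t0; rewrite /dirichlet -sumrB /lipc mulr_suml.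
apply: le_trans (nc_sum _ _ _) _; apply: ler_sum => k _.
by rewrite -mulrBr ncM -mulrA ler_wpM2l ?normc_ge0// nat_cpowN_lip.
Qed.

Lemma nrm_le_pointwise F (M : R) : 0 <= M -> l2 m F -> (forall z, nc (F z) <= M) -> nrm m F <= M.
Proof.
move=> M0 lF h; apply: (nrm_le_ae (A := set0)) => //.
by rewrite /pr measure0.
Qed.

(** * The range of the boundary function *)

Section BoundaryFunction.
Variables (c : nat -> R[i]) (phi : R[i] -> R[i]) (PhiS : torus R -> R[i]) (B : R).
Hypothesis phi_series : forall e : R, 0 < e ->
  {uniform halfplane e, dirichlet c @ \oo --> phi}.
Hypothesis phi_half : forall s : R[i], 0 < complex.Re s -> 1 / 2 < complex.Re (phi s).
Hypothesis phi_B : forall s : R[i], 0 < complex.Re s -> nc (phi s) <= B.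
Hypothesis PhiS_boundary : is_boundary_function m c PhiS.

Lemma phi_uniform (e d : R) : 0 < e -> 0 < d -> exists N0, forall N, (N0 <= N)%N ->
  forall s, e < complex.Re s -> nc (dirichlet c N s - phi s) <= d.
Proof.
move=> e0 d0.
have : nbhs (phi : {uniform` halfplane e -> R[i]})
    [set h | forall s, halfplane e s -> nc (h s - phi s) <= d].
  apply/uniform_nbhs; exists [set xy | ball xy.1 d%:C xy.2]; split.
    by rewrite -entourage_ballE; exists d%:C => //=; rewrite ltcR.
  move=> h hh s /hh; rewrite /ball /= lt_ncP ncBC; exact: ltW.
by move=> /(phi_series e0) [N0 _ hN0]; exists N0 => N /hN0.
Qed.

Lemma l2_PhiS : l2 m PhiS.
Proof. by have [h1 h2 _] := PhiS_boundary; exact: l2_Lfun. Qed.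

(** The coefficients of the translate [phi(. + x)], whose partial sums converge uniformly up to the
    imaginary axis because [Re (s + x)] stays bounded below by [x]. *)
Definition shc (x : R) : nat -> R[i] := fun k => c k * (expR (- (x * ln k.+1%:R)))%:C.

Lemma dirichlet_shc (x : R) N s : dirichlet (shc x) N s = dirichlet c N (s + x%:C).
Proof.
rewrite /dirichlet; apply: eq_bigr => k _.
rewrite nat_cpowND -mulrA; congr (_ * _); rewrite mulrC; congr (_ * _).
by rewrite nat_cpowN_eit mul0r oppr0 eit0 mulr1.
Qed.

Lemma lift_gap (b : nat -> R[i]) N0 N z : (N0 <= N)%N ->
  lift b N z - lift b N0 z = lift (fun k => if (k < N0)%N then 0 else b k) N z.
Proof.
move=> h; rewrite /lift (dsum_widen _ b h) /dsum -sumrB; apply: eq_bigr => k _.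
by case: ifP => _; rewrite ?subrr ?mul0r// subr0.
Qed.

(** The order of choices matters. [N0] comes from [L^2] convergence; then [x] is small enough to
    change the first [N0] terms little; then [N] is large enough for uniform convergence at that
    [x]. Beyond [N0] the damping factors [n^(-x) <= 1] let the tail of the original series dominate.
    Four errors of [e / 4] add up. *)
Lemma phi_lift_approx (e : R) : 0 < e -> exists x b N, [/\ 0 < x <= e,
  forall s, 0 <= complex.Re s -> nc (dirichlet b N s - phi (s + x%:C)) <= e &
  nrm m (fun z => PhiS z - lift b N z) <= e].
Proof.
move=> e0; have lP := l2_PhiS; have [_ _ Fc] := PhiS_boundary.
have e4 : 0 < e / 4 by rewrite divr_gt0.
have [N0 hN0] := lift_dist_cvg lP Fc e4.
pose M := lipc c N0; have M0 : 0 <= M := lipc_ge0 c N0.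
have M1 : 0 < M + 1 by rewrite ltr_wpDl.
pose x := Num.min e (e / 4 / (M + 1)).
have x0 : 0 < x by rewrite lt_min e0 divr_gt0.
(* Uniform convergence holds on open half-planes, while [Re (s + x) >= x] is not strict. *)
have x2 : 0 < x / 2 by rewrite divr_gt0.
have [N1 hN1] := phi_uniform x2 e0.
pose N := maxn N0 N1; exists x, (shc x), N; split.
- by rewrite x0 ge_min lexx.
- move=> s s0; rewrite dirichlet_shc; apply: hN1; first exact: leq_maxr.
  by rewrite ReD /=; lra.
have lc := l2_lift c; have lb := l2_lift (shc x).
apply: le_trans (nrm_triangleB lP (lc N0) (lb N)) _.
have h1 := hN0 N0 (leqnn _).
have h2 := nrm_triangleB (lc N0) (lb N0) (lb N).
have h3 : nrm m (fun z => lift c N0 z - lift (shc x) N0 z) <= e / 4.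
  apply: nrm_le_pointwise; [exact: ltW|exact: l2B|move=> z].
  have h : nc (lift c N0 z - lift (shc x) N0 z) <= M * x.
    rewrite /lift /dsum -sumrB /M /lipc mulr_suml; apply: le_trans (nc_sum _ _ _) _.
    apply: ler_sum => k _; rewrite -mulrBl ncM nc_character mulr1.
    rewrite /shc -{1}[c k]mulr1 -mulrBr ncM -[_ * x]mulrA ler_wpM2l ?normc_ge0//.
    have l0 : 0 <= ln k.+1%:R :> R by rewrite ln_ge0// ler1n.
    have xl : 0 <= x * ln k.+1%:R by rewrite mulr_ge0// ltW.
    have -> : 1 - (expR (- (x * ln k.+1%:R)))%:C = (1 - expR (- (x * ln k.+1%:R)))%:C :> R[i].
      by rewrite rmorphB.
    rewrite ncR ger0_norm; last by rewrite subr_ge0 expR_le1 oppr_le0.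
    by have := expR_ge1Dx (- (x * ln k.+1%:R)); lra.
  apply: le_trans h _; apply: (@le_trans _ _ ((M + 1) * (e / 4 / (M + 1)))).
    by apply: ler_pM; rewrite ?(ltW x0)// ?lerDl// /x ge_min lexx orbT.
  by rewrite mulrC divfK// gt_eqF.
have h4 : nrm m (fun z => lift (shc x) N0 z - lift (shc x) N z) <=
    nrm m (fun z => lift c N0 z - lift c N z).
  rewrite nrmBC [leRHS]nrmBC.
  have gap b : nrm m (fun z => lift b N z - lift b N0 z) =
      Num.sqrt (\sum_(k < N) nc (if (k < N0)%N then 0 else b k) ^+ 2).
    rewrite -(nrm2_lift (fun k => if (k < N0)%N then 0 else b k)) /nrm /nrm2.
    congr Num.sqrt; apply: eq_Rintegral => z _.
    by rewrite lift_gap// leq_maxl.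
  rewrite !gap ler_wsqrtr//; apply: ler_sum => k _; case: ifP => // _.
  apply: lerXn2r; rewrite ?nnegrE ?normc_ge0// /shc ncM -[leRHS]mulr1.
  rewrite ler_wpM2l ?normc_ge0// ncR ger0_norm ?expR_ge0// expR_le1 oppr_le0.
  by rewrite mulr_ge0 ?(ltW x0)// ln_ge0// ler1n.
have h5 := nrm_triangleB (lc N0) lP (lc N).
have h6 := hN0 N (leq_maxl _ _).
by rewrite [nrm m (fun x => lift c N0 x - PhiS x)]nrmBC in h5; lra.
Qed.

Lemma pr_le_all_eq0 A (u : nat -> R) : measurable A -> (forall n, pr m A <= u n) ->
  u n @[n --> \oo] --> (0 : R) -> pr m A = 0.
Proof.
move=> mA h lim; apply/eqP; rewrite eq_le pr_ge0 andbT -(cvg_lim _ lim)//.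
apply: limr_ge; first by apply/cvg_ex; exists 0.
by apply: nearW => k; exact: h.
Qed.

(** The approximating lifts satisfy the bounds almost everywhere up to [e n]. A point is bad at
    level [k] when all late lifts stay at distance at least [e k] from [PhiS]; by Markov these
    points form a null set. Off them each level has one good lift, which suffices to pass to the
    limit. *)
Lemma PhiS_range : exists A, null_set A /\
  forall z, ~ A z -> 1 / 2 <= complex.Re (PhiS z) /\ nc (PhiS z) <= B.
Proof.
pose e (n : nat) : R := n.+1%:R^-1.
have e0 n : 0 < e n by rewrite invr_gt0.
(* One [e n] is the distance to [phi] on a vertical line, the other is the loss in
   [lift_ae_halfplane]. *)
have /choice[P hP] n : exists P : (torus R -> R[i]) * set (torus R),
    [/\ l2 m P.1, nrm m (fun z => PhiS z - P.1 z) <= e n, null_set P.2 &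
     forall z, ~ P.2 z -> 1 / 2 - 2 * e n <= complex.Re (P.1 z) /\ nc (P.1 z) <= B + e n].
  have [x [b [N [/andP[x0 _] h1 h2]]]] := phi_lift_approx (e0 n).
  have t0 t : 0 < complex.Re ((0 +i* t) + x%:C : R[i]) by rewrite ReD /= add0r.
  have hB t : nc (dirichlet b N (0 +i* t)) <= B + e n.
    rewrite -[dirichlet _ _ _](subrK (phi ((0 +i* t) + x%:C))) addrC.
    by apply: le_trans (ncD _ _) _; rewrite lerD ?phi_B ?h1.
  have hR t : 1 / 2 - e n <= complex.Re (dirichlet b N (0 +i* t)).
    have := h1 (0 +i* t) (lexx _); have := phi_half (t0 t).
    set w := dirichlet _ _ _; set v := phi _ => hv /(le_trans (nc_Re _)).
    by rewrite ReD ReN ler_norml => /andP[]; lra.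
  have [A1 [nA1 hA1]] := lift_ae_bound hB.
  have [A2 [nA2 hA2]] := lift_ae_halfplane (e0 n) hR hB.
  exists (lift b N, A1 `|` A2); split=> //=; [exact: l2_lift|exact: null_setU|].
  move=> z /not_orP[/hA1 h3 /hA2 h4]; split=> //; lra.
pose C n k := [set z | e k <= nc (PhiS z - (P n).1 z)].
have mC n k : measurable (C n k).
  have [lPn _ _ _] := hP n.
  apply: measurable_nc_ge; [exact: l2_cmeas (l2B l2_PhiS lPn)|exact: ltW].
pose D k := \bigcap_n C (n + k)%N k.
have emono n k : e (n + k)%N <= e n.
  by rewrite /e lef_pV2 ?posrE// ler_nat ltnS leq_addr.
have nD k : null_set (D k).
  have mD : measurable (D k) by apply: bigcapT_measurable => n.
  split=> //; apply: (@pr_le_all_eq0 _ (fun n => e n / e k ^+ 2)) => //.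
    move=> n; have [lPn hn _ _] := hP (n + k)%N.
    have h : pr m (D k) <= pr m (C (n + k)%N k).
      by apply: pr_mono => // z; apply.
    apply: le_trans h _; apply: le_trans (markov_nrm2 (l2B l2_PhiS lPn) (e0 k)) _.
    rewrite ler_wpM2r ?invr_ge0 ?sqr_ge0// -nrm_sqr expr2.
    apply: le_trans (emono n k); apply: le_trans (_ : 1 * e (n + k)%N <= _); last by rewrite mul1r.
    apply: ler_pM; rewrite ?nrm_ge0//; apply: le_trans hn _ => //.
    by rewrite invf_le1// ler1n.
  by rewrite -(mul0r (e k ^+ 2)^-1); apply: cvgMl; exact: cvg_harmonic.
exists ((\bigcup_n (P n).2) `|` (\bigcup_k D k)); split.
  by apply: null_setU; apply: null_bigcup => // n; have [] := hP n.
move=> z /not_orP[h1 h2].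
have close k : exists n, [/\ e n <= e k, nc (PhiS z - (P n).1 z) < e k,
    1 / 2 - 2 * e n <= complex.Re ((P n).1 z) & nc ((P n).1 z) <= B + e n].
  apply: contrapT => hk; apply: h2; exists k => // n _; rewrite /C /= leNgt; apply/negP => h.
  apply: hk; exists (n + k)%N; have [_ _ _ /(_ z)[]] := hP (n + k)%N.
    by move=> h'; apply: h1; exists (n + k)%N.
  by move=> h3 h4; split=> //; rewrite addnC; exact: emono.
have small (d : R) : 0 < d -> exists k, e k <= d.
  move=> d0; exists (Num.truncn d^-1); rewrite -[leRHS]invrK lef_pV2 ?posrE ?invr_gt0//.
  exact/ltW/Num.Theory.truncnS_gt.
split; apply/ler_addgt0Pr => d d0.
- have d3 : 0 < d / 3 by rewrite divr_gt0.
  have [k hk] := small _ d3; have [n [a1 a2 a3 _]] := close k.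
  have := le_trans (nc_Re _) (ltW a2); rewrite ReD ReN ler_norml => /andP[]; lra.
- have d3 : 0 < d / 3 by rewrite divr_gt0.
  have [k hk] := small _ d3; have [n [a1 a2 _ a4]] := close k.
  by have := ncD (PhiS z - (P n).1 z) ((P n).1 z); rewrite subrK; lra.
Qed.

(** On the exceptional null set the boundary function is replaced by the admissible value [phi 1].
    Dirichlet polynomials can then be composed with it at every point, with bounds that hold
    everywhere. *)
Lemma exists_PhiR : exists PhiR, [/\ cmeas PhiR,
  forall z, 1 / 2 <= complex.Re (PhiR z), forall z, nc (PhiR z) <= B &
  exists A, null_set A /\ forall z, ~ A z -> PhiR z = PhiS z].
Proof.
have [A [[mA nA] hA]] := PhiS_range.
have p1 : 0 < complex.Re (1 : R[i]) by [].
exists (fun z => ind A z * phi 1 + (1 - ind A z) * PhiS z).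
have val z : [/\ A z & ind A z * phi 1 + (1 - ind A z) * PhiS z = phi 1] \/
    [/\ ~ A z & ind A z * phi 1 + (1 - ind A z) * PhiS z = PhiS z].
  rewrite /ind indicE; case: (pselect (A z)) => h; [left|right]; split=> //.
    by rewrite mem_set//= mul1r subrr mul0r addr0.
  by rewrite memNset//= mul0r subr0 mul1r add0r.
split.
- have mI : cmeas (ind A) by exact: l2_cmeas (l2_ind m mA).
  apply: cmeasD; first by apply: cmeasM => //; exact: cmeas_cst.
  apply: cmeasM; last exact: l2_cmeas l2_PhiS.
  by apply: cmeasB => //; exact: cmeas_cst.
- move=> z; have [[_ ->]|[h ->]] := val z; first exact/ltW/phi_half.
  by have [] := hA z h.
- move=> z; have [[_ ->]|[h ->]] := val z; first exact: phi_B.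
  by have [] := hA z h.
- exists A; split=> // z nz; by have [[]|[_ ->]] := val z.
Qed.

End BoundaryFunction.
End BohrLift.
(** * The norm identity *)

Section ExponentialApproximation.
Variable R : realType.
Implicit Types (x y w : R[i]).

Lemma subX_le x y (M : R) K : 1 <= M -> nc x <= M -> nc y <= M ->
  nc (x ^+ K - y ^+ K) <= K%:R * nc (x - y) * M ^+ K.
Proof.
move=> M1 xM yM; have M0 : 0 <= M by exact: le_trans M1.
elim: K => [|K IH]; first by rewrite !expr0 subrr nc0 !mul0r.
have -> : x ^+ K.+1 - y ^+ K.+1 = x * (x ^+ K - y ^+ K) + (x - y) * y ^+ K.
  by rewrite !exprS; ring.
apply: le_trans (ncD _ _) _; rewrite !ncM ncX.
have h1 : nc x * nc (x ^+ K - y ^+ K) <= M * (K%:R * nc (x - y) * M ^+ K).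
  by apply: ler_pM; rewrite ?normc_ge0.
have h2 : nc (x - y) * nc y ^+ K <= nc (x - y) * (M * M ^+ K).
  rewrite ler_wpM2l ?normc_ge0//; apply: le_trans (_ : M ^+ K <= _).
    by apply: lerXn2r; rewrite ?nnegrE ?normc_ge0.
  by rewrite -[leLHS]mul1r ler_wpM2r ?exprn_ge0.
apply: le_trans (lerD h1 h2) _; rewrite exprS -natr1.
by rewrite le_eqVlt; apply/orP; left; apply/eqP; ring.
Qed.

(** With [u = w / K], both [1 - u] and [e^(-u)] have modulus at most [e^(W/K)], whose [K]-th power
    is [e^W]. Replacing one factor at a time costs [K] differences of size at most [3 (W/K)^2]. *)
Lemma exp_approx w (W : R) K : 0 <= complex.Re w -> nc w <= W -> (0 < K)%N ->
  nc ((1 - (K%:R^-1)%:C * w) ^+ K - cexp (- w)) <= 3 * W ^+ 2 * expR W / K%:R.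
Proof.
move=> w0 wW K0; have W0 : 0 <= W := le_trans (normc_ge0 _) wW.
have Kp : 0 < K%:R :> R by rewrite ltr0n.
set u := (K%:R^-1)%:C * w.
have ncu : nc u <= W / K%:R.
  have iK : 0 <= K%:R^-1 :> R by rewrite invr_ge0 ltW.
  by rewrite /u ncM ncR ger0_norm// mulrC ler_wpM2r.
have u0 : 0 <= complex.Re u by rewrite /u ReZ mulr_ge0// invr_ge0 ltW.
have -> : cexp (- w) = cexp (- u) ^+ K.
  rewrite -cexpMn mulNrn; congr (cexp (- _)).
  rewrite -[u *+ K]mulr_natl -(rmorph_nat (real_complex R)) /u mulrA -rmorphM /=.
  by rewrite mulfV ?gt_eqF// mul1r.
have WK : 0 <= W / K%:R by apply: divr_ge0 => //; exact: ltW.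
have M1 : 1 <= expR (W / K%:R) by rewrite -[leLHS]expR0 ler_expR.
have h1 : nc (1 - u) <= expR (W / K%:R).
  apply: le_trans (ncB _ _) _; rewrite nc1; apply: le_trans (expR_ge1Dx _).
  by rewrite lerD2l.
have h2 : nc (cexp (- u)) <= expR (W / K%:R).
  rewrite nc_cexp ler_expR ReN; apply: le_trans (_ : 0 <= _) => //.
  by rewrite oppr_le0.
apply: le_trans (subX_le K M1 h1 h2) _.
have -> : expR (W / K%:R) ^+ K = expR W.
  by rewrite -expRM_natl mulrC divfK// gt_eqF.
have h3 : nc (1 - u - cexp (- u)) <= 3 * (W / K%:R) ^+ 2.
  rewrite addrAC; apply: le_trans (cexpN_taylor_le u0) _.
  by rewrite ler_wpM2l//; apply: lerXn2r; rewrite ?nnegrE ?normc_ge0.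
have -> : 3 * W ^+ 2 * expR W / K%:R = K%:R * (3 * (W / K%:R) ^+ 2) * expR W.
  by field; rewrite gt_eqF.
by rewrite ler_wpM2r ?expR_ge0// ler_wpM2l// ltW.
Qed.

End ExponentialApproximation.

Section HardyLimits.
Variable R : realType.
Implicit Types (b : nat -> R[i]).

Lemma H2poly_sub b b' N : H2poly (b - b') N = H2poly b N - H2poly b' N.
Proof.
apply/val_inj/funext => k.
change ((if (k < N)%N then b k - b' k else 0) =
  (if (k < N)%N then b k else 0) - (if (k < N)%N then b' k else 0)).
by case: ifP => _; rewrite ?subrr.
Qed.

Lemma H2poly_norm_le b N : H2_rnorm (H2poly b N) <= \sum_(k < N) nc (b k).
Proof.
have S0 n : 0 <= \sum_(k < n) nc (b k) by apply: sumr_ge0 => k _; exact: normc_ge0.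
rewrite -(@ler_pXn2r _ 2)// ?nnegrE ?H2_rnorm_ge0// H2poly_norm.
elim: N => [|N IH]; first by rewrite !big_ord0 expr0n.
rewrite !big_ord_recr/=; have := S0 N; have := normc_ge0 (b N); nra.
Qed.

Lemma H2_norm_H2poly_le (d : H2 R) N : H2_rnorm (H2poly d N) <= H2_rnorm d.
Proof.
rewrite -(@ler_pXn2r _ 2)// ?nnegrE ?H2_rnorm_ge0// H2poly_norm; exact: H2_sum_le.
Qed.

(** Lower semicontinuity of the norm under coefficientwise convergence: only finitely many
    coefficients are compared at a time, so no interchange of limits occurs. *)
Lemma H2_fatou (T : Type) (F : set_system T) (FF : ProperFilter F) (u : T -> H2 R)
    (d : H2 R) (M : R) : (forall n, u x n @[x --> F] --> d n) ->
  (\forall x \near F, H2_rnorm (u x) <= M) -> H2_rnorm d <= M.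
Proof.
move=> ud uM.
have M0 : 0 <= M.
  by have [x h] := filter_ex uM; exact: le_trans (H2_rnorm_ge0 _) h.
suff main N : H2_rnorm (H2poly d N) <= M.
  apply: H2_norm_le_sums => // N; rewrite -H2poly_norm.
  by apply: lerXn2r; rewrite ?nnegrE ?H2_rnorm_ge0.
apply/ler_addgt0Pr => e e0.
have e1 : 0 < e / N.+1%:R by rewrite divr_gt0.
have near_all : \forall x \near F, forall k : 'I_N, nc (d k - u x k) < e / N.+1%:R.
  apply: filter_forall => k.
  by have /cvgcP /(_ _ e1) := ud k.
have [x [h1 h2]] := filter_ex (filterI uM near_all).
have -> : H2poly d N = H2poly (u x) N + H2poly (d - u x) N.
  by rewrite [H2poly (_ - _) N]H2poly_sub addrC subrK.
apply: le_trans (H2_ler_rnormD _ _) _; apply: lerD.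
  by apply: le_trans (H2_norm_H2poly_le _ _) h1.
apply: le_trans (H2poly_norm_le _ _) _.
apply: (@le_trans _ _ (\sum_(k < N) (e / N.+1%:R))).
  by apply: ler_sum => k _; apply/ltW; exact: h2.
rewrite sumr_const card_ord -[leLHS]mulr_natl mulrCA -[leRHS]mulr1 ler_wpM2l ?(ltW e0)//.
by rewrite ler_pdivrMr// mul1r ler_nat.
Qed.

End HardyLimits.

Section NormIdentity.
Variable R : realType.
Variable m : probability (torus R) R.
Hypothesis m_haar : is_haar m.
Variables (phi : R[i] -> R[i]) (PhiR : torus R -> R[i]) (B : R).
Hypothesis phi_half : forall s : R[i], 0 < complex.Re s -> 1 / 2 < complex.Re (phi s).
Hypothesis phi_B : forall s : R[i], 0 < complex.Re s -> nc (phi s) <= B.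
Hypothesis PhiR_cmeas : cmeas PhiR.
Hypothesis PhiR_half : forall z, 1 / 2 <= complex.Re (PhiR z).
Hypothesis PhiR_B : forall z, nc (PhiR z) <= B.
Hypothesis approx : forall e : R, 0 < e -> exists x b N, [/\ 0 < x <= e,
  forall s, 0 <= complex.Re s -> nc (dirichlet b N s - phi (s + x%:C)) <= e &
  nrm m (fun z => PhiR z - lift b N z) <= e].
Implicit Types (a b : nat -> R[i]).

(** Here [phi] is accessible only through Dirichlet polynomials, so continuity is inherited from the
    Lipschitz bound of one of them. The shift [y] is kept below [1/2] so that [s - y] remains in the
    closed right half-plane. *)
Lemma phi_right_cont (s : R[i]) (e : R) : 1 / 2 < complex.Re s -> 0 < e ->
  exists d, 0 < d /\ forall x, 0 <= x <= d -> nc (phi (s + x%:C) - phi s) <= e.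
Proof.
move=> s0 e0; pose e' := Num.min (e / 3) (1 / 2).
have e'0 : 0 < e' by rewrite lt_min divr_gt0//=; lra.
have [y [b [N [/andP[y0 ye] h _]]]] := approx e'0.
have y12 : y <= 1 / 2 by apply: le_trans ye _; rewrite ge_min lexx orbT.
have e3 : e' <= e / 3 by rewrite ge_min lexx.
have L1 : 0 < lipc b N + 1 by rewrite ltr_wpDl// lipc_ge0.
exists (e / 3 / (lipc b N + 1)); split; first by rewrite !divr_gt0.
move=> x /andP[x0 xd].
pose t := s - y%:C.
have t0 : 0 <= complex.Re t by rewrite /t ReD ReN /=; lra.
have tx0 : 0 <= complex.Re (t + x%:C) by rewrite ReD /= addr_ge0.
have h1 := h t t0; have h2 := h _ tx0.
have E1 : t + y%:C = s by rewrite /t subrK.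
have E2 : t + x%:C + y%:C = s + x%:C by rewrite addrAC E1.
rewrite E1 in h1; rewrite E2 in h2.
have h3 := dirichlet_lip b N tx0 t0.
have h4 : lipc b N * nc (t + x%:C - t) <= e / 3.
  rewrite addrAC subrr add0r ncR ger0_norm//.
  apply: (@le_trans _ _ ((lipc b N + 1) * (e / 3 / (lipc b N + 1)))).
    by apply: ler_pM; rewrite ?lipc_ge0// lerDl.
  by rewrite mulrC divfK// gt_eqF.
have -> : phi (s + x%:C) - phi s = - (dirichlet b N (t + x%:C) - phi (s + x%:C)) +
   ((dirichlet b N (t + x%:C) - dirichlet b N t) + (dirichlet b N t - phi s)) by ring.
apply: le_trans (ncD _ _) _; rewrite ncN.
have := ncD (dirichlet b N (t + x%:C) - dirichlet b N t) (dirichlet b N t - phi s).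
lra.
Qed.

Definition fcomp a M : torus R -> R[i] := fun z => dirichlet a M (PhiR z).

Lemma nc_dirichlet_le a M (s : R[i]) : 0 <= complex.Re s ->
  nc (dirichlet a M s) <= \sum_(k < M) nc (a k).
Proof.
move=> s0; rewrite /dirichlet; apply: le_trans (nc_sum _ _ _) _.
apply: ler_sum => k _; rewrite ncM -[leRHS]mulr1 ler_wpM2l ?normc_ge0//.
exact: nc_nat_cpowN_le1.
Qed.

Lemma PhiR_ge0 z : 0 <= complex.Re (PhiR z).
Proof. by apply: le_trans (PhiR_half z); lra. Qed.

Lemma cmeas_fcomp a M : cmeas (fcomp a M).
Proof.
rewrite /fcomp /dirichlet; apply: cmeas_sum => k.
apply: cmeasM; first exact: cmeas_cst.
have [m1 m2] := PhiR_cmeas.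
have ml (f : torus R -> R) : measurable_fun [set: torus R] f ->
    measurable_fun [set: torus R] (fun z => - (ln k.+1%:R * f z)).
  by move=> mf; apply: measurableT_comp => //; exact: measurable_funM.
have mcos : measurable_fun [set: R] (@cos R).
  by apply: continuous_measurable_fun; exact: continuous_cos.
have msin : measurable_fun [set: R] (@sin R).
  by apply: continuous_measurable_fun; exact: continuous_sin.
split.
- rewrite (_ : (fun _ => _) = fun z => expR (- (ln k.+1%:R * complex.Re (PhiR z))) *
     cos (- (ln k.+1%:R * complex.Im (PhiR z)))).
    apply: measurable_funM; first by apply: measurableT_comp (ml _ m1); exact: measurable_expR.
    by apply: measurableT_comp (ml _ m2).
  by apply/funext => z; rewrite nat_cpowNE Re_cexp ReN ImN ReZ ImZ.
- rewrite (_ : (fun _ => _) = fun z => expR (- (ln k.+1%:R * complex.Re (PhiR z))) *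
     sin (- (ln k.+1%:R * complex.Im (PhiR z)))).
    apply: measurable_funM; first by apply: measurableT_comp (ml _ m1); exact: measurable_expR.
    by apply: measurableT_comp (ml _ m2).
  by apply/funext => z; rewrite nat_cpowNE Im_cexp ReN ImN ReZ ImZ.
Qed.

Lemma l2_fcomp a M : l2 m (fcomp a M).
Proof.
apply: (@l2_bounded _ _ _ m _ (\sum_(k < M) nc (a k)) (cmeas_fcomp a M)) => z.
by apply: nc_dirichlet_le; exact: PhiR_ge0.
Qed.

Lemma nrm2_le_lin (F G : torus R -> R[i]) (K e : R) A : null_set m A ->
  l2 m F -> l2 m G -> 0 <= K -> 0 <= e ->
  (forall z, ~ A z -> nc (F z) <= K * nc (G z) + e) ->
  nrm2 m F <= 2 * K ^+ 2 * nrm2 m G + 2 * e ^+ 2.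
Proof.
move=> [mA A0] [mF iF] [mG iG] K0 e0 h.
rewrite /nrm2 -RintegralZl// -(esp_cst m (2 * e ^+ 2)) -RintegralD//; last 2 first.
- exact: (intgZ (2 * K ^+ 2) iG).
- exact: intg_cst.
apply: (esp_le_ae mA A0) => //.
- by apply: intgD; [exact: intgZ|exact: intg_cst].
- move=> z /h hz; apply: sqrD_le => //; exact: normc_ge0.
Qed.

(* [(1 - w ln n / K)^K] approximates [n^(-w)] and is a polynomial in [w], so
   that substituting a Dirichlet polynomial for [w] yields another one. *)
Lemma fcomp_approx a M (e : R) : 0 < e -> exists x b N, [/\ 0 < x <= e,
  forall s, 0 <= complex.Re s ->
    nc (dirichlet b N s - dirichlet a M (phi (s + x%:C))) <= e &
  nrm m (fun z => fcomp a M z - lift b N z) <= e].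
Proof.
move=> e0; pose L := lipc a M; have L0 : 0 <= L := lipc_ge0 a M.
have L1 : 0 < L + 1 by rewrite ltr_wpDl.
(* The bound [1/4] keeps the values of [p] on vertical lines in [Re >= 1/4] and in the disc of
   radius [B + 1/4]. The last bound makes the outer Lipschitz error at most [e / 2]. *)
pose d := Num.min (Num.min e (1 / 4)) (e / 2 / (L + 1)).
have d0 : 0 < d by rewrite !lt_min e0 !divr_gt0.
have de : d <= e by rewrite !ge_min lexx.
have d4 : d <= 1 / 4 by rewrite !ge_min lexx orbT.
have Ld : L * d <= e / 2.
  apply: (@le_trans _ _ ((L + 1) * (e / 2 / (L + 1)))).
    by apply: ler_pM; rewrite ?(ltW d0)// ?lerDl// !ge_min lexx orbT.
  by rewrite mulrC divfK// gt_eqF.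
have [x [p [Np [/andP[x0 xd] hp1 hp2]]]] := approx d0.
pose B1 := B + 1 / 4.
have B0 : 0 <= B1.
  by rewrite addr_ge0//; apply: le_trans (normc_ge0 _) (PhiR_B point).
(* Constant dominating [K * nc (Q_K w - f w)] on the range of [p]. *)
pose C := \sum_(k < M) nc (a k) * (3 * (ln k.+1%:R * B1) ^+ 2 * expR (ln k.+1%:R * B1)).
have C0 : 0 <= C.
  apply: sumr_ge0 => k _; apply: mulr_ge0; first exact: normc_ge0.
  by apply: mulr_ge0; rewrite ?expR_ge0//; apply: mulr_ge0; rewrite ?sqr_ge0.
pose K := (Num.truncn (C / (e / 2))).+1.
have Kp : 0 < K%:R :> R by rewrite ltr0n.
have CK : C / K%:R <= e / 2.
  rewrite ler_pdivrMr// mulrC -ler_pdivrMr ?divr_gt0//.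
  exact/ltW/Num.Theory.truncnS_gt.
pose Q (w : R[i]) := \sum_(k < M) a k * (1 - (K%:R^-1)%:C * ((ln k.+1%:R)%:C * w)) ^+ K.
have hQ w : 0 <= complex.Re w -> nc w <= B1 -> nc (Q w - dirichlet a M w) <= e / 2.
  move=> w0 wB; apply: le_trans CK; rewrite /Q /dirichlet -sumrB /C mulr_suml.
  apply: le_trans (nc_sum _ _ _) _; apply: ler_sum => k _.
  rewrite -mulrBr ncM -mulrA ler_wpM2l ?normc_ge0// nat_cpowNE.
  have l0 : 0 <= ln k.+1%:R :> R by rewrite ln_ge0// ler1n.
  apply: exp_approx => //; first by rewrite ReZ mulr_ge0.
  by rewrite ncM ncR ger0_norm// ler_wpM2l.
have [b [N hb]] : exists b N, forall h, cmult h -> Q (dsum h p Np) = dsum h b N.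
  apply: dsum_sum => k.
  have [d1 [N1 h1]] := dsum_const (1 : R[i]).
  have [d2 [N2 h2]] := dsum_const (- ((K%:R^-1)%:C * (ln k.+1%:R)%:C) : R[i]).
  have [d3 [N3 h3]] := dsum_mul d2 N2 p Np.
  have [d4' [N4 h4]] := dsum_add d1 N1 d3 N3.
  have [d5 [N5 h5]] := dsum_exp d4' N4 K.
  have [d6 [N6 h6]] := dsum_const (a k).
  have [d7 [N7 h7]] := dsum_mul d6 N6 d5 N5.
  exists d7, N7 => h hm; rewrite -h7// h6// -h5// -h4 h1// -h3// h2//.
  by rewrite mulNr mulrA.
exists x, b, N; split; first by rewrite x0 (le_trans xd de).
- move=> s s0; rewrite dirichletE -hb; last exact: cmult_nat_cpowN.
  rewrite -dirichletE; set w := dirichlet p Np s.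
  have sx : 0 < complex.Re (s + x%:C) by rewrite ReD /= ltr_wpDl.
  have h1 := hp1 s s0; rewrite -/w in h1.
  have h2 := phi_half sx; have h3 := phi_B sx.
  set v := phi _ in h1 h2 h3 *.
  have w0 : 0 <= complex.Re w.
    have := le_trans (nc_Re _) h1; rewrite ReD ReN ler_norml => /andP[]; lra.
  have wB : nc w <= B1.
    rewrite -[w](subrK v); apply: le_trans (ncD _ _) _; rewrite /B1; lra.
  have h4 := hQ w w0 wB.
  have v0 : 0 <= complex.Re v by lra.
  have h5 := dirichlet_lip a M w0 v0.
  have h6 : lipc a M * nc (w - v) <= e / 2.
    by apply: le_trans _ Ld; rewrite ler_wpM2l.
  have -> : Q w - dirichlet a M v =
    (Q w - dirichlet a M w) + (dirichlet a M w - dirichlet a M v) by ring.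
  apply: le_trans (ncD _ _) _; lra.
have t0 t : 0 < complex.Re ((0 +i* t) + x%:C : R[i]) by rewrite ReD /= add0r.
have hB t : nc (dirichlet p Np (0 +i* t)) <= B1.
  rewrite -[dirichlet _ _ _](subrK (phi ((0 +i* t) + x%:C))) addrC.
  apply: le_trans (ncD _ _) _; rewrite lerD ?phi_B//.
  by apply: le_trans d4; exact: hp1.
have hR t : 1 / 4 <= complex.Re (dirichlet p Np (0 +i* t)).
  have := hp1 (0 +i* t) (lexx _); have := phi_half (t0 t).
  set w := dirichlet _ _ _; set v := phi _ => hv /(le_trans (nc_Re _)).
  by rewrite ReD ReN ler_norml => /andP[]; lra.
(* [lift_ae_halfplane] may use up the whole margin [1/4]: the estimates on [w] require only
   [Re w >= 0]. *)
have q4 : 0 < 1 / 4 :> R by lra.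
have [A1 [nA1 hA1]] := lift_ae_bound m_haar hB.
have [A2 [nA2 hA2]] := lift_ae_halfplane m_haar q4 hR hB.
have nA := null_setU nA1 nA2.
have lPhi : l2 m PhiR by exact: l2_bounded PhiR_cmeas PhiR_B.
have lP : l2 m (fun z => PhiR z - lift p Np z) by apply: l2B => //; exact: l2_lift.
have e2 : 0 <= e / 2 by rewrite divr_ge0 ?ltW.
have := @nrm2_le_lin (fun z => fcomp a M z - lift b N z)
  (fun z => PhiR z - lift p Np z) L (e / 2) _ nA _ lP L0 e2.
have lF : l2 m (fun z => fcomp a M z - lift b N z).
  by apply: l2B; [exact: l2_fcomp|exact: l2_lift].
move=> /(_ lF) h.
have {}h : nrm2 m (fun z => fcomp a M z - lift b N z) <=
    2 * L ^+ 2 * nrm2 m (fun z => PhiR z - lift p Np z) + 2 * (e / 2) ^+ 2.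
  apply: h => z /not_orP[/hA1 z1 /hA2 z2].
  rewrite /lift -hb; last exact: cmult_chi.
  rewrite -/(lift p Np z); set w := lift p Np z in z1 z2 *.
  have w0 : 0 <= complex.Re w by move: z2; rewrite subrr.
  have h4 := hQ w w0 z1.
  have h5 := dirichlet_lip a M (PhiR_ge0 z) w0.
  rewrite /fcomp (_ : _ - _ = (dirichlet a M (PhiR z) - dirichlet a M w) -
     (Q w - dirichlet a M w)); last by ring.
  apply: le_trans (ncB _ _) _; rewrite -/L in h5; lra.
rewrite -(@ler_pXn2r _ 2)// ?nnegrE ?nrm_ge0 ?(ltW e0)//.
rewrite nrm_sqr; apply: le_trans h _.
rewrite -nrm_sqr.
(* The Lipschitz part and the exponential approximation each contribute [2 (e/2)^2], for a total of
   [e^2]. *)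
have h6 : (L * nrm m (fun z => PhiR z - lift p Np z)) ^+ 2 <= (e / 2) ^+ 2.
  apply: lerXn2r; [by rewrite nnegrE mulr_ge0 ?nrm_ge0|by rewrite nnegrE|].
  by apply: le_trans Ld; rewrite ler_wpM2l.
rewrite exprMn in h6; lra.
Qed.

Lemma H2_rnorm_nrm_lift b N : H2_rnorm (H2poly b N) = nrm m (lift b N).
Proof.
rewrite /nrm (nrm2_lift m_haar) -H2poly_norm sqrtr_sqr ger0_norm//.
exact: H2_rnorm_ge0.
Qed.

Lemma H2_rnorm_sub_lift b N b' N' : H2_rnorm (H2poly b N - H2poly b' N') =
  nrm m (fun z => lift b N z - lift b' N' z).
Proof.
pose K := maxn N N'.
have E (b0 : nat -> R[i]) N0 : (N0 <= K)%N -> H2poly b0 N0 = H2poly (trunc b0 N0) K.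
  move=> h; apply/val_inj/funext => k; rewrite /= /trunc.
  by case: ltnP => //= h'; case: ltnP => //= h''; have := leq_trans h' h; rewrite leqNgt ltnS h''.
rewrite (E b N) ?leq_maxl// (E b' N') ?leq_maxr// -H2poly_sub H2_rnorm_nrm_lift.
congr (nrm m _); apply/funext => z; rewrite /lift.
rewrite (dsum_widen _ b (leq_maxl N N')) (dsum_widen _ b' (leq_maxr N N')).
by rewrite /dsum -sumrB; apply: eq_bigr => k _; rewrite -mulrBl.
Qed.

Variable C_phi : {linear H2 R -> H2 R}.
Hypothesis phi_symbol : is_composition_operator phi C_phi.

(** The polynomials [u n] are close to [f o phi(. + x)] on the half-plane and, lifted, to [f o PhiR]
    on the torus. The first fact identifies their coefficientwise limit as [C_phi f]; the second
    controls the norm of that limit. *)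
Lemma norm_identity a M : H2_rnorm (C_phi (H2poly a M)) = nrm m (fcomp a M).
Proof.
set d := C_phi _.
pose e (n : nat) : R := n.+1%:R^-1.
have e0 n : 0 < e n by rewrite invr_gt0.
have elim0 : e n @[n --> \oo] --> (0 : R) by exact: cvg_harmonic.
have /choice[t ht] n : exists t : R * (nat -> R[i]) * nat,
   [/\ 0 < t.1.1 <= e n,
    forall s, 0 <= complex.Re s ->
      nc (dirichlet t.1.2 t.2 s - dirichlet a M (phi (s + t.1.1%:C))) <= e n &
    nrm m (fun z => fcomp a M z - lift t.1.2 t.2 z) <= e n].
  by have [x [b [N h]]] := fcomp_approx a M (e0 n); exists (x, b, N).
pose u n := H2poly (t n).1.2 (t n).2.
have uM n : H2_rnorm (u n) <= nrm m (fcomp a M) + e n.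
  have [_ _ h] := ht n; rewrite H2_rnorm_nrm_lift.
  have l0 := @l2_cst _ _ _ m (0 : R[i]).
  have sub0 (b : torus R -> R[i]) : nrm m b = nrm m (fun z => b z - 0).
    by congr (nrm m _); apply/funext => z; rewrite subr0.
  rewrite sub0 [X in _ <= X + _]sub0 addrC.
  apply: le_trans (nrm_triangleB (l2_lift _ _ _) (l2_fcomp a M) l0) _.
  by rewrite lerD2r nrmBC.
have eval s : halfplane (1 / 2) s -> H2_eval (u n) s @[n --> \oo] --> H2_eval d s.
  move=> hs; rewrite (phi_symbol _ hs) H2poly_eval; apply/cvgcP => r r0.
  rewrite /halfplane /= in hs.
  pose L := lipc a M; have L1 : 0 < L + 1 by rewrite ltr_wpDl// lipc_ge0.
  have r1 : 0 < r / 4 / (L + 1) by rewrite !divr_gt0.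
  have [dl [dl0 hdl]] := phi_right_cont hs r1.
  have r4 : 0 < r / 4 by rewrite divr_gt0.
  have s0 : 0 < complex.Re s by lra.
  near=> n; have [/andP[x0 xe] h _] := ht n.
  have en1 : e n <= dl.
    by apply/ltW; near: n; have /cvgrPdist_lt /(_ _ dl0) := elim0; apply: filterS => n;
      rewrite sub0r normrN ger0_norm ?(ltW (e0 n)).
  have en2 : e n <= r / 4.
    by apply/ltW; near: n; have /cvgrPdist_lt /(_ _ r4) := elim0; apply: filterS => n;
      rewrite sub0r normrN ger0_norm ?(ltW (e0 n)).
  rewrite /u H2poly_eval; set x := (t n).1.1 in x0 xe h *.
  have h1 := h s (ltW s0).
  have h2 : nc (phi (s + x%:C) - phi s) <= r / 4 / (L + 1).
    by apply: hdl; rewrite (ltW x0) (le_trans xe en1).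
  have sx : 0 < complex.Re (s + x%:C) by rewrite ReD /= addr_gt0.
  have p1 : 0 <= complex.Re (phi s) by have := phi_half s0; lra.
  have p2 : 0 <= complex.Re (phi (s + x%:C)) by have := phi_half sx; lra.
  have h3 := dirichlet_lip a M p2 p1.
  have h4 : lipc a M * nc (phi (s + x%:C) - phi s) <= r / 4.
    apply: (@le_trans _ _ ((L + 1) * (r / 4 / (L + 1)))).
      by apply: ler_pM; rewrite ?lipc_ge0 ?normc_ge0// lerDl.
    by rewrite mulrC divfK// gt_eqF.
  rewrite ncBC (_ : _ - _ = (dirichlet (t n).1.2 (t n).2 s - dirichlet a M (phi (s + x%:C)))
     + (dirichlet a M (phi (s + x%:C)) - dirichlet a M (phi s))); last by ring.
  apply: le_lt_trans (ncD _ _) _; lra.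
have coef : forall n, u k n @[k --> \oo] --> d n.
  apply: (@coef_cvg _ _ _ _ u d (nrm m (fcomp a M) + 1)) => //.
  apply: nearW => n; apply: le_trans (uM n) _; rewrite lerD2l.
  by rewrite /e invf_le1// ler1n.
(* Coefficientwise convergence alone could lose norm. The lifts of [u k] and [u n] approximate the
   same function, so [u k - u n] is small, and this estimate passes to the limit in [k]. *)
have close n : H2_rnorm (d - u n) <= 2 * e n.
  apply: (@H2_fatou _ _ \oo _ (fun k => u k - u n)).
    move=> k; apply/cvgcP => r r0; have /cvgcP /(_ _ r0) := coef k.
    by apply: filterS => j; rewrite !H2_subE; congr (nc _ < _); ring.
  near=> k; rewrite H2_rnorm_sub_lift.
  apply: le_trans (nrm_triangleB (l2_lift _ _ _) (l2_fcomp a M) (l2_lift _ _ _)) _.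
  have [_ _ h1] := ht n; have [_ _ h2] := ht k.
  have : e k <= e n.
    rewrite /e lef_pV2 ?posrE// ler_nat ltnS; near: k; exact: nbhs_infty_ge.
  by rewrite nrmBC; lra.
have dist n : `|H2_rnorm d - nrm m (fcomp a M)| <= 3 * e n.
  have h1 := close n; have [_ _ h] := ht n.
  have h2 : H2_rnorm d <= H2_rnorm (d - u n) + H2_rnorm (u n).
    by rewrite -{1}[d](subrK (u n)) H2_ler_rnormD.
  have h3 : H2_rnorm (u n) <= H2_rnorm (d - u n) + H2_rnorm d.
    have -> : u n = (-1) *: (d - u n) + d by rewrite scaleN1r opprB subrK.
    apply: le_trans (H2_ler_rnormD _ _) _; rewrite H2_rnormZ ncN nc1 mul1r.
    by rewrite scaleN1r opprB subrK.
  have h4 : nrm m (fcomp a M) <= H2_rnorm (u n) + e n.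
    rewrite H2_rnorm_nrm_lift.
    have -> : fcomp a M = (fun z => lift (t n).1.2 (t n).2 z + (fcomp a M z - lift (t n).1.2 (t n).2 z)).
      by apply/funext => z; rewrite addrC subrK.
    apply: le_trans (nrm_triangle (l2_lift _ _ _) _) _.
      by apply: l2B; [exact: l2_fcomp|exact: l2_lift].
    by rewrite lerD2l.
  have h5 := uM n; rewrite ler_norml; apply/andP; split; lra.
apply/eqP; rewrite -subr_eq0 -normr_le0.
have lim : 3 * e n @[n --> \oo] --> (0 : R) by rewrite -(mulr0 3); exact: cvgMr.
rewrite -(cvg_lim _ lim)//; apply: limr_ge; first by apply/cvg_ex; exists 0.
by apply: nearW => n; exact: dist.
Unshelve. all: by end_near. Qed.

End NormIdentity.
(** * A discrete Carleson embedding *)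

Section FiniteCarleson.
Variable R : realType.
Variables (I : finType) (sg ta w : I -> R) (C : R).
Hypothesis sg0 : forall i, 0 < sg i.
Hypothesis w0 : forall i, 0 <= w i.

(** The squared distance from the point [i] to the mirror image of the point [j] in the boundary
    line. *)
Definition dist2 i j := (sg i + sg j) ^+ 2 + (ta i - ta j) ^+ 2.

Hypothesis C0 : 0 <= C.
Hypothesis test : forall i, \sum_j w j * (sg i / dist2 i j) <= C.

Lemma dist2_gt0 i j : 0 < dist2 i j.
Proof. by rewrite ltr_wpDr ?sqr_ge0// exprn_gt0// addr_gt0. Qed.

Lemma dist2C i j : dist2 i j = dist2 j i.
Proof. by rewrite /dist2; ring. Qed.

Lemma dist2_triangle i j k : dist2 i k <= 2 * dist2 i j + 2 * dist2 k j.
Proof.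
rewrite /dist2; have := sqr_ge0 ((ta i - ta j) - (ta j - ta k)).
have := sqr_ge0 ((sg i + sg j) - (sg k + sg j)).
have := sg0 i; have := sg0 j; have := sg0 k; nra.
Qed.

(* The part of the Poisson kernel [(sg i + sg j) / dist2 i j] below the
   diagonal [sg i = sg j]. *)
Definition tker i j : R := if sg j <= sg i then sg i / dist2 i j else 0.

Lemma tker_ge0 i j : 0 <= tker i j.
Proof.
rewrite /tker; case: ifP => // _.
by apply: divr_ge0; apply/ltW; [exact: sg0|exact: dist2_gt0].
Qed.

Lemma tker_test i : \sum_j w j * tker i j <= C.
Proof.
apply: le_trans (test i); apply: ler_sum => j _; rewrite ler_wpM2l// /tker.
case: ifP => // _; apply: divr_ge0; apply/ltW; [exact: sg0|exact: dist2_gt0].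
Qed.

Lemma tker_max i k : Num.max (sg i) (sg k) / dist2 i k <= tker i k + tker k i.
Proof.
have h1 := tker_ge0 i k; have h2 := tker_ge0 k i.
rewrite /tker (dist2C k i) in h1 h2 *; case: (leP (sg i) (sg k)) => h.
  by rewrite lerDr; case: ifP h1.
by rewrite (ltW h) addr0.
Qed.

(** By [dist2_triangle] one of the distances from [i] and [k] to [j] is at least half the distance
    between [i] and [k]. The corresponding factor is then at most [4 max(sg i, sg k) / dist2 i k],
    which [tker_max] bounds; the other factor is kept. *)
Lemma tker_mul i j k : tker i j * tker k j <=
  4 * (tker i k + tker k i) * (tker i j + tker k j).
Proof.
have dik := dist2_gt0 i k.
have mx := tker_max i k.
have h1 := tker_ge0 i j; have h2 := tker_ge0 k j.
have h3 := tker_ge0 i k; have h4 := tker_ge0 k i.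
have key x l : (x = i \/ x = k) -> dist2 i k <= 4 * dist2 x l ->
    tker x l <= 4 * (tker i k + tker k i).
  move=> xik hd; apply: (@le_trans _ _ (4 * (Num.max (sg i) (sg k) / dist2 i k))); last first.
    by rewrite ler_wpM2l.
  have m0 : 0 <= Num.max (sg i) (sg k) by rewrite le_max ltW.
  rewrite /tker; case: ifP => _; last by rewrite mulr_ge0// divr_ge0// ltW.
  rewrite ler_pdivrMr ?dist2_gt0// mulrCA -mulrA mulrC.
  apply: (@le_trans _ _ (Num.max (sg i) (sg k))).
    by case: xik => ->; rewrite le_max lexx ?orbT.
  rewrite [leRHS](_ : _ = (4 * dist2 x l / dist2 i k) * Num.max (sg i) (sg k)); last by ring.
  by rewrite ler_peMl// ler_pdivlMr// mul1r.
have : dist2 i k <= 4 * dist2 i j \/ dist2 i k <= 4 * dist2 k j.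
  have := dist2_triangle i j k; case: (leP (dist2 i j) (dist2 k j)) => h; [right|left]; lra.
move=> [/(key i j (or_introl erefl)) h|/(key k j (or_intror erefl)) h]; nra.
Qed.

(* By [tker_mul] and the test condition, the matrix [V] of [tker] satisfies
   [V V^* <= 8 C (V + V^* )] entrywise, which bounds [V] on [l^2(w)]. *)
Lemma tker_bilinear (g : I -> R) : (forall i, 0 <= g i) ->
  \sum_i \sum_j w i * w j * (g i * g j) * tker i j <= 16 * C * \sum_i w i * g i ^+ 2.
Proof.
move=> g0.
set G := \sum_i w i * g i ^+ 2.
have G0 : 0 <= G by apply: sumr_ge0 => i _; rewrite mulr_ge0// sqr_ge0.

(* [h] is the transposed kernel applied to [g], [S] its squared norm and [P] its pairing with [g].
   The bounds [S <= 16 C P] and [P^2 <= G S] together give [P <= 16 C G]. *)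
pose h j := \sum_i w i * g i * tker i j.
pose S := \sum_j w j * h j ^+ 2.
pose P := \sum_k w k * (g k * h k).
have S0 : 0 <= S by apply: sumr_ge0 => i _; rewrite mulr_ge0// sqr_ge0.
have h0 j : 0 <= h j by apply: sumr_ge0 => i _; rewrite !mulr_ge0// tker_ge0.
have P0 : 0 <= P by apply: sumr_ge0 => i _; rewrite !mulr_ge0.
have PE : \sum_i \sum_j w i * w j * (g i * g j) * tker i j = P.
  rewrite exchange_big; apply: eq_bigr => k _; rewrite /h !mulr_sumr.
  by apply: eq_bigr => i _; ring.
rewrite PE.

have SE : S = \sum_i \sum_k w i * w k * (g i * g k) * \sum_j w j * (tker i j * tker k j).
  rewrite /S; under eq_bigr do rewrite expr2 {1}/h mulr_suml mulr_sumr.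
  rewrite exchange_big; apply: eq_bigr => i _.
  under eq_bigr do rewrite {1}/h !mulr_sumr.
  rewrite exchange_big; apply: eq_bigr => k _.
  by rewrite mulr_sumr; apply: eq_bigr => j _; ring.
have SP : S <= 16 * C * P.
  have E : 16 * C * P = \sum_i \sum_k w i * w k * (g i * g k) * (8 * C * (tker i k + tker k i)).
    have sym : \sum_i \sum_k w i * w k * (g i * g k) * tker k i = P.
      by rewrite exchange_big -PE; apply: eq_bigr => i _; apply: eq_bigr => k _; ring.
    have -> : 16 * C * P = 8 * C * (P + P) by ring.
    rewrite -{1}PE -sym -big_split mulr_sumr; apply: eq_bigr => i _ /=.
    rewrite -big_split mulr_sumr; apply: eq_bigr => k _ /=; ring.
  rewrite E SE; apply: ler_sum => i _; apply: ler_sum => k _.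
  rewrite ler_wpM2l ?mulr_ge0//.
  apply: (@le_trans _ _ (\sum_j (4 * (tker i k + tker k i) * (w j * tker i j + w j * tker k j)))).
    apply: ler_sum => j _; rewrite -[X in _ <= _ * X]mulrDr [leRHS]mulrCA ler_wpM2l//.
    exact: tker_mul.
  rewrite -mulr_sumr big_split /=.
  have t1 := tker_test i; have t2 := tker_test k.
  have := tker_ge0 i k; have := tker_ge0 k i.
  set a := \sum_j w j * tker i j in t1 *; set b := \sum_j w j * tker k j in t2 *.
  nra.
have PGS : P ^+ 2 <= G * S.
  have -> : P = \sum_k (Num.sqrt (w k) * g k) * (Num.sqrt (w k) * h k).
    by apply: eq_bigr => k _; rewrite mulrACA -expr2 sqr_sqrtr.
  apply: le_trans (cauchy_schwarz_sum _ _ _ _) _.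
  by rewrite le_eqVlt; apply/orP; left; apply/eqP; congr (_ * _); apply: eq_bigr => k _;
    rewrite exprMn sqr_sqrtr.
have [->|Pn] := eqVneq P 0; first by rewrite !mulr_ge0.
have Pp : 0 < P by rewrite lt_neqAle eq_sym Pn.
rewrite -(ler_pM2r Pp) -expr2; apply: le_trans PGS _.
rewrite mulrC; apply: le_trans (ler_wpM2r G0 SP) _.
by rewrite le_eqVlt; apply/orP; left; apply/eqP; ring.
Qed.

(** A sum is at most twice a maximum, so by [tker_max] the Poisson kernel is at most twice the
    symmetrised [tker]: 64 is 4 times the 16 of [tker_bilinear]. *)
Lemma poisson_bilinear (g : I -> R) : (forall i, 0 <= g i) ->
  \sum_i \sum_j w i * w j * (g i * g j) * ((sg i + sg j) / dist2 i j)
  <= 64 * C * \sum_i w i * g i ^+ 2.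
Proof.
move=> g0; have := tker_bilinear g0; set P := \sum_i _; set G := \sum_i _ => h.
apply: (@le_trans _ _ (4 * P)); last lra.
have sym : \sum_i \sum_k w i * w k * (g i * g k) * tker k i = P.
  by rewrite exchange_big; apply: eq_bigr => i _; apply: eq_bigr => k _; ring.
have -> : 4 * P = 2 * (P + P) by ring.
rewrite -{2}sym /P -big_split mulr_sumr; apply: ler_sum => i _ /=.
rewrite -big_split mulr_sumr; apply: ler_sum => k _ /=.
rewrite -mulrDr [leRHS]mulrCA ler_wpM2l ?mulr_ge0//.
apply: (@le_trans _ _ (2 * (Num.max (sg i) (sg k) / dist2 i k))).
  rewrite mulrA ler_wpM2r ?invr_ge0 ?(ltW (dist2_gt0 i k))//.
  have : sg i <= Num.max (sg i) (sg k) by rewrite le_max lexx.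
  have : sg k <= Num.max (sg i) (sg k) by rewrite le_max lexx orbT.
  lra.
by rewrite ler_wpM2l// tker_max.
Qed.

End FiniteCarleson.

(** * The Gram kernel as a perturbed Poisson kernel *)

Section ZetaKernel.
Variable R : realType.
Implicit Types (z : R[i]).

Lemma ln_succ_sub_bounds (n : nat) : (0 < n)%N ->
  [/\ 0 <= ln n.+1%:R - ln n%:R :> R, ln n.+1%:R - ln n%:R <= n%:R^-1 :> R &
      n%:R^-1 - (ln n.+1%:R - ln n%:R) <= n%:R^-1 ^+ 2 :> R].
Proof.
move=> n0; have np : 0 < n%:R :> R by rewrite ltr0n.
have np' : 0 < n.+1%:R :> R by rewrite ltr0n.
have np1 := np'; rewrite -natr1 in np1.
rewrite -ln_div ?posrE//; split.
- by rewrite ln_ge0// ler_pdivlMr// mul1r ler_nat.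
- have -> : n.+1%:R / n%:R = 1 + n%:R^-1 :> R by rewrite -natr1; field; rewrite gt_eqF.
  by apply: le_ln1Dx; apply: lt_trans (ltrN10 _) _; rewrite invr_gt0.
- have h : ln (n%:R / n.+1%:R) <= - n.+1%:R^-1 :> R.
    have -> : n%:R / n.+1%:R = 1 + - n.+1%:R^-1 :> R.
      by rewrite -natr1; field; rewrite gt_eqF.
    by apply: le_ln1Dx; rewrite ltrNl opprK invf_lt1// ltr1n ltnS.
  have e : ln (n.+1%:R / n%:R) = - ln (n%:R / n.+1%:R) :> R.
    by rewrite !ln_div ?posrE// opprB.
  have h2 : n%:R^-1 - n.+1%:R^-1 <= n%:R^-1 ^+ 2 :> R.
    have -> : n%:R^-1 - n.+1%:R^-1 = n%:R^-1 * n.+1%:R^-1 :> R.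
      by rewrite -natr1; field; rewrite !gt_eqF.
    by rewrite expr2 ler_wpM2l ?invr_ge0 ?(ltW np)// lef_pV2 ?posrE// ler_nat.
  by rewrite e opprK; apply: le_trans h2; rewrite lerD2l.
Qed.

(** The subtracted quotient is the integral of [x^(-1-z)] over [[n, n+1]]. Its difference from the
    value at [n] is of order [(1 + |z|) / n^2], hence summable uniformly for bounded [z]. *)
Lemma zeta_term_approx z (n : nat) : 0 < complex.Re z -> (0 < n)%N ->
  nc (nat_cpowN n (1 + z) - (nat_cpowN n z - nat_cpowN n.+1 z) / z) <=
  (1 + 3 * nc z) * n%:R^-1 ^+ 2.
Proof.
move=> z0 n0; set u := ln n.+1%:R - ln n%:R : R.
have [u0 u1 u2] := ln_succ_sub_bounds n0.
have zn0 : z != 0 by apply: contraTneq z0 => ->; rewrite ltxx.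
have np : 0 < n%:R :> R by rewrite ltr0n.
have E1 : nat_cpowN n (1 + z) = (n%:R^-1)%:C * nat_cpowN n z.
  rewrite nat_cpowND; congr (_ * _).
  have -> : (1 : R[i]) = 1 +i* 0 by [].
  by rewrite nat_cpowN_eit mul1r mul0r oppr0 eit0 mulr1 expRN lnK ?posrE.
have E2 : nat_cpowN n.+1 z = nat_cpowN n z * cexp (- (u%:C * z)).
  rewrite !nat_cpowNE -cexpD; congr cexp.
  by rewrite /u rmorphB /=; ring.
have E3 : nat_cpowN n (1 + z) - (nat_cpowN n z - nat_cpowN n.+1 z) / z =
    nat_cpowN n z * ((n%:R^-1)%:C - u%:C - (1 - cexp (- (u%:C * z)) - u%:C * z) / z).
  rewrite E1 E2; set x := cexp _; set y := nat_cpowN _ _; set p := _%:C; set q := u%:C.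
  clearbody x y p q.
  by field; exact: zn0.
have un : u ^+ 2 <= n%:R^-1 ^+ 2.
  by apply: lerXn2r; rewrite ?nnegrE ?invr_ge0 ?(ltW np).
have uz0 : 0 <= complex.Re (u%:C * z) by rewrite ReZ mulr_ge0// ltW.
have nz : 0 < nc z by rewrite lt_neqAle eq_sym nc_eq0 zn0 normc_ge0.
rewrite E3 -rmorphB /= ncM -[leRHS]mul1r; apply: ler_pM; rewrite ?normc_ge0//.
  by apply: nc_nat_cpowN_le1; exact: ltW.
apply: le_trans (ncB _ _) _; rewrite [leRHS]mulrDl mul1r; apply: lerD.
  rewrite ncR ler_norml; apply/andP; split; last exact: u2.
  by apply: le_trans (_ : 0 <= _); rewrite ?oppr_le0 ?sqr_ge0// subr_ge0.
rewrite ncM ncV ler_pdivrMr//; apply: le_trans (cexpN_taylor_le uz0) _.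
rewrite ncM ncR ger0_norm// exprMn.
have : u ^+ 2 * nc z ^+ 2 <= n%:R^-1 ^+ 2 * nc z ^+ 2 by rewrite ler_wpM2r ?sqr_ge0.
lra.
Qed.

Lemma sum_inv_sqr_le N : \sum_(k < N) k.+1%:R^-1 ^+ 2 <= 2 :> R.
Proof.
(* Strengthened for the induction: the increment [1/(N+1) - 1/(N+2)] dominates the next term. *)
suff : \sum_(k < N.+1) k.+1%:R^-1 ^+ 2 <= 2 - N.+1%:R^-1 :> R.
  rewrite big_ord_recr /=; have : 0 <= N.+1%:R^-1 :> R by rewrite invr_ge0.
  set p := \sum_(k < N) _; set q := N.+1%:R^-1 ^+ 2; set r := N.+1%:R^-1 => r0 h.
  have q0 : 0 <= q by exact: sqr_ge0.
  lra.
elim: N => [|N IH]; first by rewrite big_ord_recr big_ord0 /= invr1 expr1n; lra.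
rewrite big_ord_recr /=.
set x := N.+1%:R^-1 in IH; set y := N.+2%:R^-1.
suff : y ^+ 2 <= x - y by lra.
have np : 0 < N.+1%:R :> R by rewrite ltr0n.
have np2 : 0 < N.+1%:R + 1 :> R by rewrite natr1 ltr0n.
have -> : x - y = y * x by rewrite /x /y -(natr1 N.+1); field; rewrite !gt_eqF.
rewrite expr2 ler_wpM2l ?invr_ge0// /x /y lef_pV2 ?posrE ?ltr0n// ler_nat//.
Qed.

Lemma zeta_partial_Re z (N : nat) : 0 < complex.Re z ->
  `|complex.Re (\sum_(k < N) nat_cpowN k.+1 (1 + z))| <=
  complex.Re z / nc z ^+ 2 + nc (nat_cpowN N.+1 z) / nc z + 2 * (1 + 3 * nc z).
Proof.
move=> z0; have zn0 : z != 0 by apply: contraTneq z0 => ->; rewrite ltxx.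
have nz : 0 < nc z by rewrite lt_neqAle eq_sym nc_eq0 zn0 normc_ge0.
have tel : \sum_(k < N) (nat_cpowN k.+1 z - nat_cpowN k.+2 z) / z = (1 - nat_cpowN N.+1 z) / z.
  rewrite -mulr_suml; congr (_ / _); elim: N => [|N IH].
    by rewrite big_ord0 nat_cpowN1 subrr.
  by rewrite big_ord_recr /= IH; ring.
have -> : \sum_(k < N) nat_cpowN k.+1 (1 + z) = z^-1 - nat_cpowN N.+1 z / z +
   \sum_(k < N) (nat_cpowN k.+1 (1 + z) - (nat_cpowN k.+1 z - nat_cpowN k.+2 z) / z).
  by rewrite sumrB tel; field; exact: zn0.
rewrite !ReD ReN.
have h1 : complex.Re z^-1 = complex.Re z / nc z ^+ 2.
  case: z {z0 zn0 tel} nz => x y nz /=; rewrite nc_sqr//.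
have h2 := nc_Re (nat_cpowN N.+1 z / z); rewrite ncM ncV in h2.
have h3 : `|complex.Re (\sum_(k < N) (nat_cpowN k.+1 (1 + z) -
    (nat_cpowN k.+1 z - nat_cpowN k.+2 z) / z))| <= 2 * (1 + 3 * nc z).
  apply: le_trans (nc_Re _) _; apply: le_trans (nc_sum _ _ _) _.
  apply: (@le_trans _ _ (\sum_(k < N) (1 + 3 * nc z) * k.+1%:R^-1 ^+ 2)).
    by apply: ler_sum => k _; exact: zeta_term_approx.
  rewrite -mulr_sumr mulrC ler_wpM2r ?sum_inv_sqr_le//.
  by rewrite addr_ge0// mulr_ge0// normc_ge0.
have h4 : 0 <= complex.Re z / nc z ^+ 2 by rewrite divr_ge0 ?sqr_ge0// ltW.
apply: le_trans (ler_normD _ _) _; apply: lerD => //.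
by apply: le_trans (ler_normB _ _) _; rewrite h1 (ger0_norm h4); exact: lerD.
Qed.

End ZetaKernel.

(** * Embedding into a finite sum of point masses, by duality *)

Section DiscreteEmbedding.
Variable R : realType.
Variables (I : finType) (sg ta w : I -> R) (C Z W kap : R).
Hypothesis kap0 : 0 < kap.
Hypothesis sg_kap : forall i, kap <= sg i.
Hypothesis w0 : forall i, 0 <= w i.
Hypothesis test : forall i, \sum_j w j * (sg i / dist2 sg ta i j) <= C.
Hypothesis C0 : 0 <= C.
Hypothesis Z0 : 0 <= Z.
Hypothesis mass : \sum_i w i <= W.
Hypothesis diam : forall i j, nc ((sg i + sg j) +i* (ta i - ta j)) <= Z.

Let pt i : R[i] := (1 / 2 + sg i) +i* ta i.
Let zz i j : R[i] := (sg i + sg j) +i* (ta i - ta j).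

Lemma sg_gt0 i : 0 < sg i.
Proof. exact: lt_le_trans (sg_kap i). Qed.

Lemma nat_cpowN_conj n (s : R[i]) : (nat_cpowN n s)^* = nat_cpowN n s^*.
Proof.
rewrite !nat_cpowNE -cexp_conj; congr cexp.
by apply: complexP; rewrite ?(Re_conj, Im_conj, ReN, ImN, ReZ, ImZ) ?(Re_conj, Im_conj)// mulrN.
Qed.

Lemma mul_pt_conj n i j : nat_cpowN n (pt i) * (nat_cpowN n (pt j))^* = nat_cpowN n (1 + zz i j).
Proof.
rewrite conjE nat_cpowN_conj -nat_cpowND; congr nat_cpowN.
by apply: complexP; rewrite !(ReD, ImD, Re_conj, Im_conj) /=; field.
Qed.

(** Expanding the squares gives the Gram matrix. Since [g] is real, exchanging [i] and [j]
    conjugates the terms, so that only real parts survive. *)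
Lemma dual_quadratic (g : I -> R) N :
  \sum_(n < N) nc (\sum_i (w i * g i)%:C * nat_cpowN n.+1 (pt i)) ^+ 2 =
  \sum_i \sum_j w i * w j * (g i * g j) *
    complex.Re (\sum_(n < N) nat_cpowN n.+1 (1 + zz i j)).
Proof.
apply: (@complexI R); rewrite rmorph_sum /=.
under eq_bigr do rewrite -nc_mul_conj rmorph_sum big_distrlr /=.
have -> : \sum_(n < N) \sum_i \sum_j (w i * g i)%:C * nat_cpowN n.+1 (pt i) *
      ((w j * g j)%:C * nat_cpowN n.+1 (pt j))^* =
    \sum_i \sum_j (w i * w j * (g i * g j))%:C * (\sum_(n < N) nat_cpowN n.+1 (1 + zz i j)).
  rewrite exchange_big; apply: eq_bigr => i _; rewrite exchange_big; apply: eq_bigr => j _.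
  rewrite mulr_sumr; apply: eq_bigr => n _; rewrite -mul_pt_conj rmorphM /=.
  have conjcM (r : R) (x : R[i]) : conjc (r%:C * x) = r%:C * conjc x.
    by apply: complexP; rewrite !(Re_conj, Im_conj, ReZ, ImZ) ?mulrN.
  by rewrite !conjE conjcM !rmorphM /=; ring.
set S := \sum_i _.
have ReS : complex.Re S = \sum_i \sum_j w i * w j * (g i * g j) *
    complex.Re (\sum_(n < N) nat_cpowN n.+1 (1 + zz i j)).
  by rewrite Re_sum; apply: eq_bigr => i _; rewrite Re_sum; apply: eq_bigr => j _; rewrite ReZ.
have ImS : complex.Im S = 0.
  pose t i j := w i * w j * (g i * g j) * complex.Im (\sum_(n < N) nat_cpowN n.+1 (1 + zz i j)).
  have E : complex.Im S = \sum_i \sum_j t i j.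
    by rewrite Im_sum; apply: eq_bigr => i _; rewrite Im_sum; apply: eq_bigr => j _; rewrite ImZ.
  have anti i j : t j i = - t i j.
    rewrite /t -mulrN -ImN; have -> : w j * w i * (g j * g i) = w i * w j * (g i * g j) by ring.
    congr (_ * _); rewrite ImN !Im_sum -sumrN.
    apply: eq_bigr => n _; rewrite -Im_conj nat_cpowN_conj; congr (complex.Im (nat_cpowN _ _)).
    by apply: complexP; rewrite ?Re_conj ?Im_conj !(ReD, ImD) /=; ring.
  have : complex.Im S = - complex.Im S.
    rewrite {1}E exchange_big E -sumrN; apply: eq_bigr => i _; rewrite -sumrN.
    by apply: eq_bigr => j _; rewrite anti.
  by move=> /eqP; rewrite -addr_eq0 -mulr2n mulrn_eq0 /= => /eqP.
by apply: complexP; rewrite -/S ?ReS ?ImS.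
Qed.

(** The left side increases with [N], so [N] may be enlarged until the boundary term of
    [zeta_partial_Re] is at most 1. The kernel is then at most Poisson plus a constant:
    [poisson_bilinear] handles the first, Cauchy-Schwarz with total mass [W] the second. *)
Lemma dual_bound (g : I -> R) N :
  \sum_(n < N) nc (\sum_i (w i * g i)%:C * nat_cpowN n.+1 (pt i)) ^+ 2 <=
  (64 * C + (1 + 2 * (1 + 3 * Z)) * W) * \sum_i w i * g i ^+ 2.
Proof.
(* [ln (N'+1) >= L] means [(N'+1)^(-2 kap) <= 2 kap], and [2 kap] is a lower bound for the modulus
   of every [zz i j]. *)
pose L := - ln (2 * kap) / (2 * kap).
pose N' := maxn N (Num.truncn (expR L)).
apply: (@le_trans _ _ (\sum_(n < N') nc (\sum_i (w i * g i)%:C * nat_cpowN n.+1 (pt i)) ^+ 2)).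
  rewrite (big_ord_widen N' (fun n => nc (\sum_i (w i * g i)%:C * nat_cpowN n.+1 (pt i)) ^+ 2) (leq_maxl _ _)).
  by rewrite big_mkcond; apply: ler_sum => n _; case: ifP => // _; exact: sqr_ge0.
rewrite dual_quadratic.
have k2 : 0 < 2 * kap by rewrite mulr_gt0.
have zre i j : 2 * kap <= complex.Re (zz i j).
  by rewrite /=; have := sg_kap i; have := sg_kap j; lra.
have tail i j : nc (nat_cpowN N'.+1 (zz i j)) / nc (zz i j) <= 1.
  have nz : 2 * kap <= nc (zz i j).
    by apply: le_trans (zre i j) _; apply: le_trans (ler_norm _) (nc_Re _).
  rewrite ler_pdivrMr ?(lt_le_trans k2)// mul1r; apply: le_trans nz.
  rewrite nc_nat_cpowN -[leRHS]lnK ?posrE// ler_expR.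
  have hL : L <= ln N'.+1%:R.
    rewrite -[leLHS]expRK ler_ln ?posrE ?expR_gt0//.
    apply: le_trans (ltW (Num.Theory.truncnS_gt _)) _.
    by rewrite ler_nat ltnS leq_maxr.
  have l0 : 0 <= ln N'.+1%:R :> R by rewrite ln_ge0// ler1n.
  have : ln N'.+1%:R * (2 * kap) <= ln N'.+1%:R * complex.Re (zz i j) by rewrite ler_wpM2l.
  have : L * (2 * kap) <= ln N'.+1%:R * (2 * kap) by rewrite ler_wpM2r// ltW.
  rewrite /L divfK ?gt_eqF//; lra.
set D := 1 + 2 * (1 + 3 * Z).
apply: (@le_trans _ _ (\sum_i \sum_j w i * w j * (`|g i| * `|g j|) *
    ((sg i + sg j) / dist2 sg ta i j + D))).
  apply: ler_sum => i _; apply: ler_sum => j _.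
  rewrite -!mulrA; apply: ler_wpM2l => //; apply: ler_wpM2l => //.
  rewrite !mulrA; apply: le_trans (ler_norm _) _; rewrite !normrM ler_wpM2l ?mulr_ge0//.
  have zp : 0 < complex.Re (zz i j) by exact: lt_le_trans (zre i j).
  apply: le_trans (zeta_partial_Re N' zp) _.
  have -> : nc (zz i j) ^+ 2 = dist2 sg ta i j by rewrite nc_sqr.
  rewrite -!addrA lerD2l /D; have := tail i j; have := diam i j; rewrite -/(zz i j); lra.
have -> : \sum_i \sum_j w i * w j * (`|g i| * `|g j|) * ((sg i + sg j) / dist2 sg ta i j + D) =
   \sum_i \sum_j w i * w j * (`|g i| * `|g j|) * ((sg i + sg j) / dist2 sg ta i j) +
   D * (\sum_i w i * `|g i|) ^+ 2.
  rewrite expr2 big_distrlr /= mulr_sumr -big_split; apply: eq_bigr => i _.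
  rewrite mulr_sumr -big_split; apply: eq_bigr => j _ /=; ring.
rewrite [leRHS]mulrDl; apply: lerD.
  have := @poisson_bilinear R I sg ta w C sg_gt0 w0 C0 test (fun i => `|g i|) (fun i => normr_ge0 _).
  by under [X in _ <= _ * X -> _]eq_bigr do rewrite real_normK ?num_real//.
have D0 : 0 <= D by rewrite /D addr_ge0// mulr_ge0// addr_ge0// mulr_ge0.
rewrite -mulrA ler_wpM2l//.
have -> : \sum_i w i * `|g i| = \sum_i Num.sqrt (w i) * (Num.sqrt (w i) * `|g i|).
  by apply: eq_bigr => i _; rewrite mulrA -expr2 sqr_sqrtr.
apply: le_trans (cauchy_schwarz_sum _ _ _ _) _.
apply: ler_pM; rewrite ?sumr_ge0//; try by move=> i _; exact: sqr_ge0.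
  by under eq_bigr do rewrite sqr_sqrtr//.
by under eq_bigr do rewrite exprMn sqr_sqrtr// real_normK ?num_real//.
Qed.

(** Testing the dual bound on [g = Re f] itself writes [U] as a pairing of the coefficients with the
    dual sums, so that [U^2 <= A (eta U)] and one factor [U] cancels. *)
Lemma discrete_embedding_Re (a : nat -> R[i]) N :
  \sum_i w i * complex.Re (dirichlet a N (pt i)) ^+ 2 <=
  (64 * C + (1 + 2 * (1 + 3 * Z)) * W) * \sum_(n < N) nc (a n) ^+ 2.
Proof.
pose g i := complex.Re (dirichlet a N (pt i)).
set eta := 64 * C + _; set A := \sum_(n < N) _; set U := \sum_i _.
have A0 : 0 <= A by apply: sumr_ge0 => n _; exact: sqr_ge0.
have U0 : 0 <= U by apply: sumr_ge0 => i _; rewrite mulr_ge0// sqr_ge0.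
have dual := dual_bound g N; rewrite -/eta in dual.
have UE : U = complex.Re (\sum_(n < N) a n * \sum_i (w i * g i)%:C * nat_cpowN n.+1 (pt i)).
  transitivity (complex.Re (\sum_i (w i * g i)%:C * dirichlet a N (pt i))).
    rewrite Re_sum; apply: eq_bigr => i _; rewrite ReZ /g; ring.
  congr complex.Re; rewrite /dirichlet.
  under eq_bigr do rewrite mulr_sumr; rewrite exchange_big; apply: eq_bigr => n _.
  by rewrite mulr_sumr; apply: eq_bigr => i _; ring.
have UA : U ^+ 2 <= A * (eta * U).
  apply: (@le_trans _ _ ((\sum_(n < N) nc (a n) * nc (\sum_i (w i * g i)%:C * nat_cpowN n.+1 (pt i))) ^+ 2)).
    apply: lerXn2r; rewrite ?nnegrE//.
      by apply: sumr_ge0 => n _; rewrite mulr_ge0 ?normc_ge0.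
    rewrite UE; apply: le_trans (ler_norm _) _; apply: le_trans (nc_Re _) _.
    by apply: le_trans (nc_sum _ _ _) _; apply: ler_sum => n _; rewrite ncM.
  by apply: le_trans (cauchy_schwarz_sum _ _ _ _) _; rewrite ler_wpM2l.
have [->|Un] := eqVneq U 0.
  have W0 : 0 <= W by apply: le_trans mass; exact: sumr_ge0.
  by rewrite mulr_ge0// addr_ge0 ?mulr_ge0 ?addr_ge0 ?mulr_ge0 ?addr_ge0 ?mulr_ge0.
have Up : 0 < U by rewrite lt_neqAle eq_sym Un.
by rewrite -(ler_pM2r Up) -expr2; apply: le_trans UA _; rewrite mulrCA mulrA.
Qed.

Lemma discrete_embedding (a : nat -> R[i]) N :
  \sum_i w i * nc (dirichlet a N (pt i)) ^+ 2 <=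
  2 * (64 * C + (1 + 2 * (1 + 3 * Z)) * W) * \sum_(n < N) nc (a n) ^+ 2.
Proof.
have h1 := discrete_embedding_Re a N.
have h2 := discrete_embedding_Re (fun n => - 'i%C * a n) N.
have E i : complex.Re (dirichlet (fun n => - 'i%C * a n) N (pt i)) = complex.Im (dirichlet a N (pt i)).
  have -> : dirichlet (fun n => - 'i%C * a n) N (pt i) = - 'i%C * dirichlet a N (pt i).
    by rewrite /dirichlet mulr_sumr; apply: eq_bigr => n _; rewrite -mulrA.
  by rewrite ReM /= oppr0 mul0r sub0r mulN1r opprK.
have nci n : nc (- 'i%C * a n) = nc (a n).
  by rewrite ncM ncN [X in X * _](_ : _ = 1) ?mul1r// /Normc.normc expr0n expr1n add0r sqrtr1.
have nciS : \sum_(n < N) nc (- 'i%C * a n) ^+ 2 = \sum_(n < N) nc (a n) ^+ 2.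
  by apply: eq_bigr => n _; rewrite nci.
have ES : \sum_i w i * complex.Re (dirichlet (fun n => - 'i%C * a n) N (pt i)) ^+ 2 =
    \sum_i w i * complex.Im (dirichlet a N (pt i)) ^+ 2.
  by apply: eq_bigr => i _; rewrite E.
rewrite nciS ES in h2.
under eq_bigr do rewrite nc_sqr mulrDr.
rewrite big_split /=.

lra.
Qed.

End DiscreteEmbedding.

(** * From masses of dyadic boxes to the kernel test *)

Section FiniteTest.
Variable R : realType.
Variables (I : finType) (sg ta w : I -> R) (A : R).
Hypothesis sg0 : forall i, 0 < sg i.
Hypothesis w0 : forall i, 0 <= w i.
Hypothesis A0 : 0 <= A.

Let near_box i (k : nat) j := (sg j <= 2 ^+ k * sg i) && (`|ta j - ta i| <= 2 ^+ k * sg i).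

Hypothesis box : forall i k, \sum_(j | near_box i k j) w j <= A * (2 ^+ k * sg i).

Lemma near_box_ex i j : exists k, near_box i k j.
Proof.
set x := (sg j + `|ta j - ta i|) / sg i; exists (Num.truncn x).+1.
have h : x <= 2 ^+ (Num.truncn x).+1.
  apply: le_trans (ltW (Num.Theory.truncnS_gt _)) _.
  by rewrite -natrX ler_nat ltnW// ltn_expl.
rewrite /x ler_pdivrMr// -/x in h.
have := normr_ge0 (ta j - ta i); have := sg0 j => h1 h2.
by apply/andP; split; lra.
Qed.

Lemma far_box_kernel i j k : ~~ near_box i k j ->
  sg i / dist2 sg ta i j <= 2^-1 ^+ k * 2^-1 ^+ k / sg i.
Proof.
rewrite /near_box negb_and -!ltNge => h.
have d0 : 0 < dist2 sg ta i j by exact: dist2_gt0.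
have e : 2 ^+ k * 2^-1 ^+ k = 1 :> R by rewrite -exprMn divff ?expr1n ?pnatr_eq0.
have p0 : 0 < 2 ^+ k :> R by rewrite exprn_gt0.
have hd : (2 ^+ k * sg i) ^+ 2 <= dist2 sg ta i j.
  have si := sg0 i; have sj := sg0 j.
  have q0 : 0 <= 2 ^+ k * sg i by rewrite mulr_ge0// ltW.
  rewrite /dist2; case/orP: h => h.
    have := sqr_ge0 (ta i - ta j).
    suff : (2 ^+ k * sg i) ^+ 2 <= (sg i + sg j) ^+ 2 by lra.
    by apply: lerXn2r; rewrite ?nnegrE//; lra.
  have := sqr_ge0 (sg i + sg j).
  suff : (2 ^+ k * sg i) ^+ 2 <= (ta i - ta j) ^+ 2 by lra.
  rewrite -[leRHS]real_normK ?num_real// distrC.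
  by apply: lerXn2r; rewrite ?nnegrE// ltW.
rewrite ler_pdivrMr//; set u := _ / sg i.
have u0 : 0 <= u by rewrite divr_ge0 ?mulr_ge0 ?exprn_ge0 ?invr_ge0// ltW.
apply: le_trans (ler_wpM2l u0 hd).
rewrite /u (_ : _ / _ * _ = (2 ^+ k * 2^-1 ^+ k) * (2 ^+ k * 2^-1 ^+ k) * sg i).
  by rewrite e !mul1r.
by move: (2 ^+ k) (2^-1 ^+ k) => x y; field; rewrite gt_eqF.
Qed.

Lemma sum_half_le K : \sum_(k < K) 2^-1 ^+ k <= 2 :> R.
Proof.
have -> : \sum_(k < K) 2^-1 ^+ k = 2 - 2 * 2^-1 ^+ K :> R.
  by elim: K => [|K IH]; rewrite ?big_ord0 ?big_ord_recr /= ?IH ?exprS ?expr0; field.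
by rewrite gerBl mulr_ge0// exprn_ge0// invr_ge0.
Qed.

(* The kernel is at most [4^(1-k) / sg i] on the [k]-th dyadic box around [i]. *)
Lemma test_of_boxes i : \sum_j w j * (sg i / dist2 sg ta i j) <= 8 * A.
Proof.
pose kk j := ex_minn (near_box_ex i j).
pose K := (\max_j kk j).+1.
have kK j : (kk j < K)%N by rewrite ltnS; exact: (leq_bigmax j).
pose c (k : nat) : R := 4 * (2^-1 ^+ k * 2^-1 ^+ k / sg i).
have c0 k : 0 <= c k.
  by rewrite mulr_ge0// divr_ge0 ?mulr_ge0 ?exprn_ge0 ?invr_ge0// ltW.
have ptw j : sg i / dist2 sg ta i j <= \sum_(k < K) c k * (near_box i k j)%:R.
  apply: (@le_trans _ _ (c (kk j))); last first.
    rewrite (bigD1 (Ordinal (kK j)))//=.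
    have -> : near_box i (kk j) j by rewrite /kk; case: ex_minnP.
    by rewrite mulr1 lerDl sumr_ge0// => k _; rewrite mulr_ge0.
  rewrite /kk; case: ex_minnP => -[|k] _ kmin.
    have d0 : 0 < dist2 sg ta i j by exact: dist2_gt0.
    have si := sg0 i; have sj := sg0 j.
    rewrite /c expr0 !mul1r ler_pdivrMr//.
    rewrite [leRHS](_ : _ = 4 * dist2 sg ta i j / sg i); last by ring.
    by rewrite ler_pdivlMr//; have := sqr_ge0 (ta i - ta j); rewrite /dist2; nra.
  have : ~~ near_box i k j by apply/negP => /kmin; rewrite ltnn.
  move=> /far_box_kernel; rewrite /c !exprS => /le_trans; apply.
  by rewrite le_eqVlt; apply/orP; left; apply/eqP; field; rewrite gt_eqF.
apply: (@le_trans _ _ (\sum_(k < K) c k * \sum_(j | near_box i k j) w j)).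
  apply: (@le_trans _ _ (\sum_j w j * \sum_(k < K) c k * (near_box i k j)%:R)).
    by apply: ler_sum => j _; rewrite ler_wpM2l.
  under eq_bigr do rewrite mulr_sumr.
  rewrite exchange_big; apply: ler_sum => k _ /=.
  rewrite [X in _ <= _ * X]big_mkcond mulr_sumr; apply: ler_sum => j _.
  by case: (near_box i k j); rewrite ?mulr1 ?mulr0// mulrC.
(* On the box [k] the kernel bound [4 * 4^(-k) / sg i] meets a mass of at most [A 2^k sg i]. The
   products decay geometrically with ratio [1/2], whence [8 A]. *)
apply: (@le_trans _ _ (\sum_(k < K) (4 * A) * 2^-1 ^+ k)).
  apply: ler_sum => k _; apply: le_trans (ler_wpM2l (c0 k) (box i k)) _.
  have e : 2 ^+ k * 2^-1 ^+ k = 1 :> R by rewrite -exprMn divff ?expr1n ?pnatr_eq0.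
  rewrite /c [leLHS](_ : _ = (2 ^+ k * 2^-1 ^+ k) * (4 * A * 2^-1 ^+ k)); first by rewrite e mul1r.
  by move: (2 ^+ k) (2^-1 ^+ k) => x y; field; rewrite gt_eqF.
rewrite -mulr_sumr; apply: le_trans (ler_wpM2l _ (sum_half_le K)) _; first by rewrite mulr_ge0.
by rewrite le_eqVlt; apply/orP; left; apply/eqP; ring.
Qed.

End FiniteTest.

(** * Discretisation of the boundary measure on a grid *)

Section Grid.
Context d (T : measurableType d) (R : realType) (m : probability T R).
Variables (F : T -> R[i]) (B eps del : R).
Hypothesis F_cmeas : cmeas F.
Hypothesis F_half : forall z, 1 / 2 <= complex.Re (F z).
Hypothesis F_B : forall z, nc (F z) <= B.
Hypothesis eps0 : 0 <= eps.
Hypothesis del0 : 0 < del.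
Hypothesis del1 : del <= 1.
Hypothesis carl : forall t l, 0 < l -> l <= del ->
  pr m (F @^-1` carleson_square (t, l)) <= eps * l.

Definition rect (i j : interval R) : set T :=
  [set z | complex.Re (F z) \in i /\ complex.Im (F z) \in j].

Lemma measurable_rect i j : measurable (rect i j).
Proof.
have [m1 m2] := F_cmeas.
have -> : rect i j = ((fun z => complex.Re (F z)) @^-1` [set` i]) `&`
    ((fun z => complex.Im (F z)) @^-1` [set` j]) by [].
apply: measurableI; rewrite -[X in measurable X]setTI.
  by apply: m1 => //; exact: measurable_itv.
by apply: m2 => //; exact: measurable_itv.
Qed.

Lemma rect_carleson (t l : R) : F @^-1` carleson_square (t, l) =
  rect `[1 / 2, 1 / 2 + l] `[t, t + l].
Proof. by apply/seteqP; split => z; rewrite /rect /= !in_itv. Qed.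

Lemma rect_sub i j i' j' : {subset i <= i'} -> {subset j <= j'} -> rect i j `<=` rect i' j'.
Proof. by move=> ii jj z [/ii h1 /jj h2]. Qed.

Lemma pr_setU_le (A A' : set T) : measurable A -> measurable A' ->
  pr m (A `|` A') <= pr m A + pr m A'.
Proof.
move=> mA mA'; rewrite -lee_fin EFinD -!prE//; first exact: measureU2.
exact: measurableU.
Qed.

Lemma pr_setD (A A' : set T) : measurable A -> measurable A' -> A' `<=` A ->
  pr m A' + pr m (A `\` A') <= pr m A.
Proof.
move=> mA mA' AA; have mD : measurable (A `\` A') by exact: measurableD.
rewrite -lee_fin EFinD -!prE// -measureU//; last by rewrite setDIK.
by rewrite setDUK.
Qed.

Lemma pr_sum_disjoint (J : eqType) (r : seq J) (A : J -> set T) (X : set T) :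
  uniq r -> (forall p, measurable (A p)) -> measurable X ->
  (forall p q z, A p z -> A q z -> p = q) -> {in r, forall p, A p `<=` X} ->
  \sum_(p <- r) pr m (A p) <= pr m X.
Proof.
move=> ur mA mX disj; elim: r ur X mX => [|p r IH] /= ur X mX AX.
  by rewrite big_nil pr_ge0.
case/andP: ur => pr_ ur; rewrite big_cons.
apply: le_trans (pr_setD mX (mA p) (AX p (mem_head _ _))); rewrite lerD2l.
apply: IH => //; first exact: measurableD.
move=> q qr z Aq; split; first by apply: AX Aq; rewrite inE qr orbT.
by move=> Ap; move: pr_; rewrite (disj _ _ _ Ap Aq) qr.
Qed.

Lemma pr_strip n t l : 0 < l -> l <= del ->
  pr m (rect `[1 / 2, 1 / 2 + l] `[t, t + n%:R * l[) <= n%:R * (eps * l).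
Proof.
move=> l0 ld; elim: n => [|n IH].
  rewrite mul0r mul0r (_ : rect _ _ = set0); first by rewrite /pr measure0.
  apply/seteqP; split => z // -[_]; rewrite in_itv /= addr0 => /andP[h1 h2].
  by have := le_lt_trans h1 h2; rewrite ltxx.
have -> : n.+1%:R * (eps * l) = n%:R * (eps * l) + eps * l by rewrite -natr1; ring.
have c := carl (t + n%:R * l) l0 ld; rewrite rect_carleson in c.
apply: le_trans (lerD IH c).
apply: le_trans (pr_setU_le (measurable_rect _ _) (measurable_rect _ _)).
apply: pr_mono; [exact: measurable_rect|by apply: measurableU; exact: measurable_rect|].
move=> z [h1]; rewrite in_itv /= => /andP[h2 h3].
have [h|h] := ltP (complex.Im (F z)) (t + n%:R * l); [left|right]; split => //.
  by rewrite in_itv /= h2.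
by rewrite in_itv /= h /= -addrA -{2}(mul1r l) -mulrDl natr1 ltW.
Qed.

(** The Carleson bound is available only up to side [del]. A taller box of width at most [del] is
    therefore covered by a stack of squares of side [min(s, del)], whose total height is at most
    [3 s] plus one side, hence at most [4 s]. *)
Lemma pr_box s t : 0 < s ->
  pr m (rect `[1 / 2, 1 / 2 + Num.min s del] `[t - s, t + 2 * s[) <= 4 * eps * s.
Proof.
move=> s0; set l := Num.min s del.
have l0 : 0 < l by rewrite lt_min s0.
have ld : l <= del by rewrite ge_min lexx orbT.
have ls : l <= s by rewrite ge_min lexx.
set n := (Num.truncn (3 * s / l)).+1.
have n1 : 3 * s <= n%:R * l by rewrite -ler_pdivrMr// ltW// Num.Theory.truncnS_gt.
have n2 : n%:R * l <= 4 * s.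
  have : (Num.truncn (3 * s / l))%:R <= 3 * s / l.
    by rewrite Num.Theory.truncn_le// divr_ge0 ?mulr_ge0// ltW.
  rewrite ler_pdivlMr// /n -natr1 mulrDl mul1r; lra.
apply: (@le_trans _ _ (n%:R * (eps * l))); last first.
  by rewrite mulrCA [leRHS](_ : _ = eps * (4 * s)) ?ler_wpM2l//; ring.
apply: le_trans (pr_strip n (t - s) l0 ld); apply: pr_mono; try exact: measurable_rect.
apply: rect_sub => // x; rewrite !in_itv /= => /andP[-> h] /=; apply: lt_le_trans h _; lra.
Qed.

Variable J : nat.
Hypothesis J0 : (0 < J)%N.
Let kap : R := del / J%:R.
Let K : nat := (Num.truncn (2 * B / kap)).+1.

Lemma kap_gt0 : 0 < kap.
Proof. by rewrite divr_gt0// ltr0n. Qed.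

Definition cell (p : 'I_J * 'I_K) : set T :=
  rect `[1 / 2 + p.1%:R * kap, 1 / 2 + p.1.+1%:R * kap[ `[p.2%:R * kap - B, p.2.+1%:R * kap - B[.

(** The right edge of the cell is used, so that the point mass stays at distance at least [kap] from
    the boundary line. *)
Definition cell_sg (p : 'I_J * 'I_K) : R := p.1.+1%:R * kap.
Definition cell_ta (p : 'I_J * 'I_K) : R := p.2%:R * kap - B.

Lemma grid_uniq (x : R) (a b : nat) : a%:R * kap <= x -> x < a.+1%:R * kap ->
  b%:R * kap <= x -> x < b.+1%:R * kap -> a = b.
Proof.
move=> a1 a2 b1 b2; have := le_lt_trans a1 b2; have := le_lt_trans b1 a2.
rewrite !ltr_pM2r ?kap_gt0// !ltr_nat !ltnS => h1 h2.
by apply/eqP; rewrite eqn_leq h1 h2.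
Qed.

Lemma cell_uniq p q z : cell p z -> cell q z -> p = q.
Proof.
case: p q => [a b] [a' b'] [] /=; rewrite !in_itv /= => /andP[h1 h2] /andP[h3 h4] [] /=.
rewrite !in_itv /= => /andP[k1 k2] /andP[k3 k4].
congr (_, _); apply: val_inj => /=.
  by apply: (@grid_uniq (complex.Re (F z) - 1 / 2)); lra.
by apply: (@grid_uniq (complex.Im (F z) + B)); lra.
Qed.

Lemma grid_cover (x : R) : 0 <= x ->
  (Num.truncn (x / kap))%:R * kap <= x < (Num.truncn (x / kap)).+1%:R * kap.
Proof.
move=> x0; rewrite -ler_pdivlMr ?kap_gt0// -ltr_pdivrMr ?kap_gt0//.
by apply: Num.Theory.truncn_itv; rewrite divr_ge0// ltW// kap_gt0.
Qed.

Lemma cell_cover z : complex.Re (F z) < 1 / 2 + del -> exists p, cell p z.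
Proof.
move=> h; set x := complex.Re (F z) - 1 / 2; set y := complex.Im (F z) + B.
have x0 : 0 <= x by rewrite subr_ge0.
have := le_trans (nc_Im (F z)) (F_B z); rewrite ler_norml => /andP[hi hi'].
have y0 : 0 <= y by rewrite /y; lra.
have /andP[x1 x2] := grid_cover x0; have /andP[y1 y2] := grid_cover y0.
have xJ : (Num.truncn (x / kap) < J)%N.
  have : x < J%:R * kap by rewrite /kap mulrC divfK ?gt_eqF ?ltr0n// /x; lra.
  by move=> /(le_lt_trans x1); rewrite ltr_pM2r ?kap_gt0// ltr_nat.
have yK : (Num.truncn (y / kap) < K)%N.
  rewrite ltnS; apply: Num.Theory.le_truncn; rewrite ler_pM2r ?invr_gt0 ?kap_gt0// /y; lra.
exists (Ordinal xJ, Ordinal yK); split; rewrite in_itv /=.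
  by apply/andP; move: x1 x2; rewrite /x; split; lra.
by apply/andP; move: y1 y2; rewrite /y; split; lra.
Qed.

Lemma cell_sg_ge p : kap <= cell_sg p.
Proof. by rewrite /cell_sg ler_peMl ?ler1n// ltW// kap_gt0. Qed.

Lemma cell_sg_le p : cell_sg p <= del.
Proof.
have -> : del = J%:R * kap by rewrite /kap mulrC divfK// gt_eqF// ltr0n.
by rewrite /cell_sg ler_pM2r ?kap_gt0// ler_nat.
Qed.

Lemma cell_ta_itv p : 0 <= B -> - B <= cell_ta p <= B.
Proof.
move=> B0; rewrite /cell_ta; have k0 := kap_gt0.
have h1 : 0 <= p.2%:R * kap by rewrite mulr_ge0// ltW.
have h2 : p.2%:R * kap <= 2 * B.
  rewrite -ler_pdivlMr//; apply: le_trans (_ : (Num.truncn (2 * B / kap))%:R <= _).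
    by rewrite ler_nat -ltnS; case: (p.2).
  by rewrite Num.Theory.truncn_le// divr_ge0 ?mulr_ge0// ltW.
by apply/andP; split; lra.
Qed.

Lemma cell_box i (k : nat) :
  \sum_(j | (cell_sg j <= 2 ^+ k * cell_sg i) && (`|cell_ta j - cell_ta i| <= 2 ^+ k * cell_sg i))
    pr m (cell j) <= 4 * eps * (2 ^+ k * cell_sg i).
Proof.
set s := 2 ^+ k * cell_sg i.
(* A cell extends [kap] above its ordinate [cell_ta]; with [kap <= s] it fits in the box of
   [pr_box], which reaches [s] below and [2 s] above. *)
have sk : kap <= s.
  apply: le_trans (cell_sg_ge i) _; rewrite ler_peMl ?exprn_ege1 ?ler1n//.
  exact: le_trans (ltW kap_gt0) (cell_sg_ge i).
have s0 : 0 < s := lt_le_trans kap_gt0 sk.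
apply: le_trans (pr_box (cell_ta i) s0).
rewrite -big_filter; apply: pr_sum_disjoint.
- by rewrite filter_uniq// index_enum_uniq.
- by move=> p; exact: measurable_rect.
- exact: measurable_rect.
- exact: cell_uniq.
move=> p; rewrite mem_filter => /andP[/andP[h1]]; rewrite ler_norml => /andP[h2 h3] _.
have hd := cell_sg_le p.
apply: rect_sub => x; rewrite !in_itv /= => /andP[x1 x2].
  apply/andP; split.
    by apply: le_trans x1; rewrite lerDl mulr_ge0// ltW// kap_gt0.
  by apply: le_trans (ltW x2) _; rewrite lerD2l le_min h1.
rewrite -natr1 in x2; rewrite /cell_ta in h2 h3 *.
by apply/andP; split; lra.
Qed.

Lemma cell_mass : 0 <= B -> \sum_p pr m (cell p) <= eps * (2 * B + 1).
Proof.
(* Squares of side [del] covering the height [2 B] overshoot by at most [del <= 1]. *)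
move=> B0; set n := (Num.truncn (2 * B / del)).+1.
have n1 : 2 * B < n%:R * del by rewrite -ltr_pdivrMr// Num.Theory.truncnS_gt.
have n2 : n%:R * del <= 2 * B + 1.
  have h : (Num.truncn (2 * B / del))%:R * del <= 2 * B.
    by rewrite -ler_pdivlMr// Num.Theory.truncn_le// divr_ge0 ?mulr_ge0// ltW.
  have -> : n%:R * del = (Num.truncn (2 * B / del))%:R * del + del by rewrite /n -natr1; ring.
  exact: lerD.
apply: (@le_trans _ _ (n%:R * (eps * del))); last by rewrite mulrCA ler_wpM2l.
apply: le_trans (pr_strip n (- B) del0 (lexx _)).
apply: pr_sum_disjoint.
- by rewrite index_enum_uniq.
- by move=> p; exact: measurable_rect.
- exact: measurable_rect.
- exact: cell_uniq.
move=> p _ z [h1 h2]; split.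
  have hd := cell_sg_le p; move: h1; rewrite !in_itv /= => /andP[x1 x2].
  rewrite F_half /=; apply: le_trans (ltW x2) _; rewrite lerD2l; exact: hd.
have := le_trans (nc_Im (F z)) (F_B z); rewrite ler_norml in_itv /= => /andP[-> hi] /=.
lra.
Qed.

Lemma cell_dist p z : cell p z -> nc (F z - ((1 / 2 + cell_sg p) +i* cell_ta p)) <= 2 * kap.
Proof.
move=> [] /=; rewrite !in_itv /= => /andP[x1 x2] /andP[y1 y2].
apply: le_trans (nc_le_ReIm _) _; rewrite ReD ImD ReN ImN /=.
rewrite /cell_sg /cell_ta.
have a1 : `|complex.Re (F z) - (1 / 2 + p.1.+1%:R * kap)| <= kap.
  by rewrite ler_norml; move: x1 x2; rewrite -natr1 => x1 x2; apply/andP; split; lra.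
have a2 : `|complex.Im (F z) - (p.2%:R * kap - B)| <= kap.
  by rewrite ler_norml; move: y1 y2; rewrite -natr1 => y1 y2; apply/andP; split; lra.
lra.
Qed.

End Grid.
(** * Measures satisfying the vanishing Carleson condition *)

Section VanishingCarleson.
Variable R : realType.
Variable m : probability (torus R) R.
Variables (F : torus R -> R[i]) (B : R).
Hypothesis F_cmeas : cmeas F.
Hypothesis F_half : forall z, 1 / 2 <= complex.Re (F z).
Hypothesis F_B : forall z, nc (F z) <= B.

Lemma esp_sum_indic (I : eqType) (r : seq I) (b : I -> R) (A : I -> set (torus R)) :
  (forall p, measurable (A p)) ->
  intg m (fun z => \sum_(p <- r) b p * \1_(A p) z) /\
  \int[m]_z (\sum_(p <- r) b p * \1_(A p) z) = \sum_(p <- r) b p * pr m (A p).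
Proof.
move=> mA; elim: r => [|p r [IH1 IH2]].
  rewrite (_ : (fun _ => _) = fun=> 0); last by apply/funext => z; rewrite big_nil.
  by split; [exact: intg_cst|rewrite esp_cst big_nil].
rewrite (_ : (fun _ => _) = fun z => b p * \1_(A p) z + \sum_(q <- r) b q * \1_(A q) z); last first.
  by apply/funext => z; rewrite big_cons.
have i1 : intg m (fun z => b p * \1_(A p) z) by apply: intgZ; exact: intg_indic.
split; first exact: intgD.
rewrite RintegralD// RintegralZl//; last exact: intg_indic.
by rewrite esp_indic// IH2 big_cons.
Qed.

(** The constant of [discrete_embedding] divided by [eps]: [C = 8 * 4 eps] from the dyadic boxes,
    [W = eps (2 B + 1)] from the total mass, and diameter [Z = 2 + 2 B], since [sg] is at most 1 and
    ordinates differ by at most [2 B]. *)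
Let box_bound : R := 2 * (64 * 32 + (1 + 2 * (1 + 3 * (2 + 2 * B))) * (2 * B + 1)).

Lemma B_nonneg : 0 <= B.
Proof. exact: le_trans (normc_ge0 _) (F_B (fun=> point)). Qed.

Lemma box_bound_gt0 : 0 < box_bound.
Proof.
have B0 := B_nonneg; rewrite mulr_gt0// ltr_wpDr//.
by rewrite mulr_ge0 ?addr_ge0// mulr_ge0// addr_ge0// mulr_ge0// addr_ge0// mulr_ge0.
Qed.

Section Level.
Variables (eps del : R).
Hypothesis eps0 : 0 <= eps.
Hypothesis del0 : 0 < del.
Hypothesis del1 : del <= 1.
Hypothesis carl : forall t l, 0 < l -> l <= del ->
  pr m (F @^-1` carleson_square (t, l)) <= eps * l.

Let corner (J : nat) (p : 'I_J * 'I_(Num.truncn (2 * B / (del / J%:R))).+1) : R[i] :=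
  (1 / 2 + cell_sg p) +i* cell_ta p.

Lemma grid_bound (J : nat) a N : (0 < J)%N ->
  \sum_p pr m (cell F p) * nc (dirichlet a N (@corner J p)) ^+ 2 <=
  box_bound * eps * \sum_(n < N) nc (a n) ^+ 2.
Proof.
move=> J0; have B0 := B_nonneg.
have k0 := kap_gt0 del0 J0.
have sg0 p : 0 < @cell_sg R B del J p := lt_le_trans k0 (cell_sg_ge del0 J0 p).
have w0 (p : 'I_J * 'I_(Num.truncn (2 * B / (del / J%:R))).+1) : 0 <= pr m (cell F p).
  exact: pr_ge0.
have e4 : 0 <= 4 * eps by rewrite mulr_ge0.
have tst := test_of_boxes sg0 w0 e4 (fun i k => cell_box F_cmeas eps0 del0 carl J0 i k).
have e32 : 0 <= 8 * (4 * eps) by rewrite mulr_ge0.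
have Z0 : 0 <= 2 + 2 * B by rewrite addr_ge0// mulr_ge0.
have mass := cell_mass F_cmeas F_half F_B eps0 del0 del1 carl J0 B0.
have := discrete_embedding k0 (cell_sg_ge del0 J0) w0 tst e32 Z0 mass _ a N.
rewrite (_ : box_bound * eps = 2 * (64 * (8 * (4 * eps)) +
  (1 + 2 * (1 + 3 * (2 + 2 * B))) * (eps * (2 * B + 1)))); last by rewrite /box_bound; ring.
apply => p q.
apply: le_trans (nc_le_ReIm _) _ => /=.
have := cell_sg_le del0 J0 p; have := cell_sg_le del0 J0 q.
have := sg0 p; have := sg0 q.
have /andP[] := cell_ta_itv del0 J0 p B0; have /andP[] := cell_ta_itv del0 J0 q B0.
move=> h1 h2 h3 h4 h5 h6 h7 h8.
have a1 : `|cell_sg p + cell_sg q| <= 2.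
  rewrite ger0_norm ?addr_ge0 ?(ltW h5) ?(ltW h6)//.
  by apply: le_trans (lerD (le_trans h8 del1) (le_trans h7 del1)) _; rewrite -mulr2n.
have a2 : `|cell_ta p - cell_ta q| <= 2 * B.
  rewrite ler_norml; have := lerB h3 h2; have := lerB h4 h1.
  by rewrite opprK => k1 k2; apply/andP; split; [apply: le_trans k2|apply: le_trans k1 _]; lra.
exact: lerD.
Qed.

Lemma far_bound a N M s : (0 < M)%N -> (forall n, (n < M)%N -> a n = 0) ->
  1 / 2 + del <= complex.Re s ->
  nc (dirichlet a N s) ^+ 2 <= ztail (2 * del) M ^+ 2 * \sum_(n < N) nc (a n) ^+ 2.
Proof.
move=> M0 a0 hs; rewrite -H2poly_norm -exprMn.
apply: lerXn2r; rewrite ?nnegrE ?normc_ge0//.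
  by rewrite mulr_ge0 ?sqrtr_ge0// H2_rnorm_ge0.
have d2 : 0 < 2 * del by rewrite mulr_gt0.
have hs2 : 1 + 2 * del <= 2 * complex.Re s by lra.
have [h _] := dirichlet_sub_le (H2poly a N) d2 hs2 M0 (leq_maxr N M).
rewrite mulrC; move: h; rewrite [X in X - _](dirichlet_trunc _ _ (leq_maxl N M)).
rewrite [X in _ - X](_ : _ = 0) ?subr0// /dirichlet big1// => n _.
by rewrite /= /trunc a0 ?if_same ?mul0r.
Qed.

(** Far from the line [far_bound] applies; near it, [F z] is moved to the corner of its cell at the
    cost of a Lipschitz error. The mesh may depend on the polynomial because [grid_bound] is uniform
    in [J]; the error then disappears in the arbitrary [e]. *)
Lemma level_bound a N M : (0 < M)%N -> (forall n, (n < M)%N -> a n = 0) ->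
  nrm2 m (fcomp F a N) <=
  (ztail (2 * del) M ^+ 2 + 2 * (box_bound * eps)) * \sum_(n < N) nc (a n) ^+ 2.
Proof.
move=> M0 a0; set S := \sum_(n < N) _; have B0 := B_nonneg.
have S0 : 0 <= S by apply: sumr_ge0 => n _; exact: sqr_ge0.
set L := lipc a N; have L0 : 0 <= L by exact: lipc_ge0.
set W := eps * (2 * B + 1).
have W0 : 0 <= W by rewrite mulr_ge0// addr_ge0// mulr_ge0.
apply/ler_addgt0Pr => e e0.
(* [q / J^2] is the total Lipschitz error, since a cell point is at distance at most [2 del / J]
   from its corner. *)
set q := W * (2 * (L * (2 * del)) ^+ 2).
have q0 : 0 <= q by rewrite mulr_ge0// mulr_ge0// sqr_ge0.
set J := (Num.truncn (q / e)).+1.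
have J0 : (0 < J)%N by [].
have J1 : 1 <= J%:R :> R by rewrite ler1n.
have qJ : q / J%:R ^+ 2 <= e.
  have Jp : 0 < J%:R :> R by rewrite ltr0n.
  rewrite ler_pdivrMr ?exprn_gt0//.
  have h : q <= e * J%:R by rewrite mulrC -ler_pdivrMr// ltW// Num.Theory.truncnS_gt.
  by apply: le_trans h _; rewrite ler_wpM2l// ?(ltW e0)// expr2 ler_peMr// ltW.
pose I : finType := ('I_J * 'I_(Num.truncn (2 * B / (del / J%:R))).+1)%type.
pose b (p : I) : R := 2 * nc (dirichlet a N (corner p)) ^+ 2 + 2 * (L * (2 * (del / J%:R))) ^+ 2.
have b0 p : 0 <= b p by rewrite addr_ge0// mulr_ge0// sqr_ge0.
have mcell (p : I) : measurable (cell F p) by exact: measurable_rect.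
set tau := ztail (2 * del) M ^+ 2 * S.
have tau0 : 0 <= tau by rewrite mulr_ge0// sqr_ge0.
have [i1 e1] := esp_sum_indic (index_enum I) b mcell.
have ptw z : nc (fcomp F a N z) ^+ 2 <= tau + \sum_(p : I) b p * \1_(cell F p) z.
  have s0 : 0 <= \sum_(p : I) b p * \1_(cell F p) z by apply: sumr_ge0 => p _; rewrite mulr_ge0.
  have [h|h] := leP (1 / 2 + del) (complex.Re (F z)).
    by apply: le_trans (far_bound N M0 a0 h) _; rewrite lerDl.
  have [p zp] := cell_cover F_half F_B del0 J0 h.
  apply: (@le_trans _ _ (b p)); last first.
    apply: (@le_trans _ _ (\sum_(p : I) b p * \1_(cell F p) z)); last by rewrite lerDr.
    rewrite (bigD1 p)//= indicE mem_set// mulr1 lerDl.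
    by apply: sumr_ge0 => r _; rewrite mulr_ge0.
  have cp : 0 <= complex.Re (corner p).
    rewrite /= addr_ge0// ltW//; exact: lt_le_trans (kap_gt0 del0 J0) (cell_sg_ge del0 J0 p).
  have Fz : 0 <= complex.Re (F z) by apply: le_trans (F_half z); rewrite divr_ge0.
  have h1 := dirichlet_lip a N Fz cp.
  have h2 := cell_dist zp.
  have -> : fcomp F a N z = dirichlet a N (corner p) +
    (dirichlet a N (F z) - dirichlet a N (corner p)) by rewrite addrC subrK.
  apply: le_trans (ncD_sqr_le _ _) _; rewrite lerD2l ler_wpM2l//.
  apply: lerXn2r; rewrite ?nnegrE ?normc_ge0//.
    by rewrite !mulr_ge0// ltW// kap_gt0.
  by apply: le_trans h1 _; rewrite ler_wpM2l.
have i2 : intg m (fun z => nc (fcomp F a N z) ^+ 2) := (l2_fcomp m F_cmeas F_half a N).2.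
apply: le_trans (esp_le i2 (intgD (intg_cst m tau) i1) ptw) _.
rewrite RintegralD//; last exact: intg_cst.
rewrite esp_cst e1 mulrDl -addrA lerD2l.
have -> : \sum_(p : I) b p * pr m (cell F p) =
   2 * (\sum_(p : I) pr m (cell F p) * nc (dirichlet a N (corner p)) ^+ 2) +
   (2 * (L * (2 * (del / J%:R))) ^+ 2) * \sum_(p : I) pr m (cell F p).
  rewrite !mulr_sumr -big_split; apply: eq_bigr => p _; rewrite /b /=; ring.
apply: lerD.
  by rewrite -[leRHS]mulrA; apply: ler_wpM2l => //; exact: grid_bound.
apply: le_trans qJ.
have -> : q / J%:R ^+ 2 = 2 * (L * (2 * (del / J%:R))) ^+ 2 * W.
  by rewrite /q; field; rewrite gt_eqF// ltr0n.
apply: ler_wpM2l; first by rewrite mulr_ge0// sqr_ge0.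
have mass := cell_mass F_cmeas F_half F_B eps0 del0 del1 carl J0 B0.
exact: mass.
Qed.

End Level.

Lemma small_on_tails (eta : R) :
  (forall e : R, 0 < e -> exists d, 0 < d /\ forall t l, 0 < l -> l <= d ->
    pr m (F @^-1` carleson_square (t, l)) <= e * l) ->
  0 < eta -> exists M, forall a N, (forall n, (n < M)%N -> a n = 0) ->
    nrm2 m (fcomp F a N) <= eta * \sum_(n < N) nc (a n) ^+ 2.
Proof.
move=> van eta0; have bb := box_bound_gt0.
(* With this value the near part [2 box_bound eps] equals [eta / 2], leaving the other half to the
   tail. *)
have e0 : 0 < eta / (4 * box_bound) by rewrite divr_gt0// mulr_gt0.
have [d0 [d0p carl]] := van _ e0.
set d := Num.min d0 1.
have dp : 0 < d by rewrite lt_min d0p ltr01.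
have d1 : d <= 1 by rewrite ge_min lexx orbT.
have carl' t l : 0 < l -> l <= d -> pr m (F @^-1` carleson_square (t, l)) <= eta / (4 * box_bound) * l.
  by move=> l0 ld; apply: carl => //; apply: le_trans ld _; rewrite ge_min lexx.
have t0 : 0 < Num.min 1 (eta / 2) by rewrite lt_min ltr01 divr_gt0.
have d2 : 0 < 2 * d by rewrite mulr_gt0.
have [M [M0 hM]] := ztail_small d2 t0.
exists M => a N a0.
apply: le_trans (level_bound (ltW e0) dp d1 carl' N M0 a0) _.
rewrite ler_wpM2r//; first by apply: sumr_ge0 => n _; exact: sqr_ge0.
have z0 : 0 <= ztail (2 * d) M by exact: sqrtr_ge0.
have -> : 2 * (box_bound * (eta / (4 * box_bound))) = eta / 2.
  by field; rewrite gt_eqF.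
have h1 : ztail (2 * d) M <= 1 by apply: le_trans hM _; rewrite ge_min lexx.
have h2 : ztail (2 * d) M <= eta / 2 by apply: le_trans hM _; rewrite ge_min lexx orbT.
have : ztail (2 * d) M ^+ 2 <= ztail (2 * d) M by rewrite expr2 ler_piMl.
lra.
Qed.

End VanishingCarleson.
(** * Compactness from smallness on tails *)

Section UltrafilterLimits.
Variable R : realType.

Lemma ultra_fmap (S X : Type) (F : set_system S) (u : S -> X) :
  UltraFilter F -> UltraFilter (u x @[x --> F]).
Proof.
move=> FU; split; first exact: fmap_proper_filter.
move=> G PG FG; apply/seteqP; split=> A; last exact: FG.
move=> GA; have [//|FnA] := in_ultra_setVsetC (u @^-1` A) FU.
have /filter_ex[x [] //] : G (A `&` ~` A).
by apply: filterI => //; exact: FG.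
Qed.

Lemma ultra_bounded_cvg (S : Type) (F : set_system S) (u : S -> R) (r : R) :
  UltraFilter F -> (forall x, `|u x| <= r) -> exists l : R, u x @[x --> F] --> l.
Proof.
move=> FU ur; have := @segment_compact R (- r) r.
rewrite compact_ultra => /(_ _ (ultra_fmap u FU)); case.
  apply: (@filterS _ F _ setT); last exact: filterT.
  by move=> x _ /=; rewrite in_itv /= -ler_norml.
by move=> l [_ hl]; exists l.
Qed.

Lemma ultra_bounded_cvgc (S : Type) (F : set_system S) (u : S -> R[i]) (r : R) :
  UltraFilter F -> (forall x, nc (u x) <= r) -> exists l : R[i], u x @[x --> F] --> l.
Proof.
move=> FU ur.
have [a ha] : exists l : R, complex.Re (u x) @[x --> F] --> l.
  by apply: (@ultra_bounded_cvg _ _ _ r) => // x; exact: le_trans (nc_Re _) (ur x).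
have [b hb] : exists l : R, complex.Im (u x) @[x --> F] --> l.
  by apply: (@ultra_bounded_cvg _ _ _ r) => // x; exact: le_trans (nc_Im _) (ur x).
by exists (a +i* b); exact: cvgc_ReIm.
Qed.

End UltrafilterLimits.

Section CompactnessFromTails.
Variable R : realType.
Variable T : {linear H2 R -> H2 R}.
Implicit Types f : H2 R.

Lemma lt_H2_rnorm f (e : R) : (`|f| < e%:C) = (H2_rnorm f < e).
Proof. by rewrite -ltcR. Qed.

Lemma le_H2_rnorm f (e : R) : (`|f| <= e%:C) = (H2_rnorm f <= e).
Proof. by rewrite -lecR. Qed.

Lemma cvgH2P (S : Type) (F : set_system S) (FF : Filter F) (u : S -> H2 R) (l : H2 R) :
  (u x @[x --> F] --> l) <->
  (forall e : R, 0 < e -> \forall x \near F, H2_rnorm (l - u x) < e).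
Proof.
split=> [/cvgrPdist_lt h e e0|h].
  have := h e%:C; rewrite ltcR => /(_ e0).
  by apply: filterS => x; rewrite lt_H2_rnorm.
apply/cvgrPdist_lt => e /complex_gt0P[-> e0].
by have := h _ e0; apply: filterS => x; rewrite lt_H2_rnorm.
Qed.

Lemma bounded_H2 (A : set (H2 R)) : bounded_set A ->
  exists r : R, 0 <= r /\ forall f, A f -> H2_rnorm f <= r.
Proof.
move=> [M [Mr hM]]; exists (nc M + 1); split; first by rewrite addr_ge0// normc_ge0.
move=> f Af; rewrite -le_H2_rnorm; apply: hM Af.
apply: le_lt_trans (real_ler_norm Mr) _; rewrite normc_nc ltcR.
by rewrite ltrDl ltr01.
Qed.

Definition unit_vector (n : nat) : H2 R := H2poly (fun k => (k == n)%:R) n.+1.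

Lemma H2polyS f N : H2poly f N.+1 = H2poly f N + f N *: unit_vector N.
Proof.
apply/val_inj/funext => k.
change ((if (k < N.+1)%N then f k else 0) =
  (if (k < N)%N then f k else 0) + f N * (if (k < N.+1)%N then (k == N)%:R else 0)).
rewrite ltnS; case: (ltngtP k N) => h; rewrite ?mulr0 ?addr0//.
by rewrite h mulr1 add0r.
Qed.

Lemma rnorm_image_H2poly f N :
  H2_rnorm (T (H2poly f N)) <= \sum_(n < N) nc (f n) * H2_rnorm (T (unit_vector n)).
Proof.
elim: N => [|N IH].
  rewrite big_ord0 (_ : H2poly f 0 = 0); last by apply/val_inj/funext.
  by rewrite linear0; apply: H2_norm_le_sums => // N; rewrite big1// => k _; rewrite nc0 expr0n.
rewrite big_ord_recr H2polyS linearD linearZ /=.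
by apply: le_trans (H2_ler_rnormD _ _) _; rewrite H2_rnormZ lerD2r.
Qed.

Lemma H2_tail_coef f N n : (n < N)%N -> (f - H2poly f N) n = 0.
Proof. by move=> nN; rewrite H2_subE /= /trunc nN subrr. Qed.

Lemma H2_rnormN f : H2_rnorm (- f) = H2_rnorm f.
Proof. by rewrite -scaleN1r H2_rnormZ ncN nc1 mul1r. Qed.

Lemma H2_tail_norm f N : H2_rnorm (f - H2poly f N) <= 2 * H2_rnorm f.
Proof.
apply: le_trans (H2_ler_rnormD _ _) _; rewrite H2_rnormN.
by have := H2_norm_H2poly_le f N; lra.
Qed.

Hypothesis tails : forall e : R, 0 < e -> exists M, forall f,
  (forall n, (n < M)%N -> f n = 0) -> H2_rnorm (T f) <= e * H2_rnorm f.

(** Along an ultrafilter of images, the coefficients of chosen preimages converge and define [f0] in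
    the same ball. The difference from [f0] splits into a tail, small by [tails], and finitely many
    coefficients, which [T] maps through unit vectors; this avoids any appeal to continuity of
    [T]. *)
Lemma compact_image_ball (r : R) : 0 <= r -> compact (T @` [set f | H2_rnorm f <= r]).
Proof.
move=> r0; rewrite compact_ultra => F FU FK.
have norm0 : H2_rnorm (0 : H2 R) <= r.
  by apply: H2_norm_le_sums => // N; rewrite big1 ?sqr_ge0// => k _; rewrite nc0 expr0n.
(* Off the image the preimage is set to 0, so the norm bound on [g] holds everywhere. *)
have /choice[g hg] : forall h : H2 R, exists f : H2 R, H2_rnorm f <= r /\
    ((T @` [set f | H2_rnorm f <= r]) h -> T f = h).
  move=> h; have [[f fr fh]|nh] := pselect ((T @` [set f | H2_rnorm f <= r]) h).
    by exists f.
  by exists 0; split.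
have gr h : H2_rnorm (g h) <= r by have [] := hg h.
have /choice[l hl] : forall n : nat, exists l : R[i], g h n @[h --> F] --> l.
  move=> n; apply: (@ultra_bounded_cvgc R _ _ _ r) => h.
  exact: le_trans (H2_coef_le _ _) (gr h).
have lr N : \sum_(k < N) nc (l k) ^+ 2 <= r ^+ 2.
  rewrite -H2poly_norm; apply: lerXn2r; rewrite ?nnegrE ?H2_rnorm_ge0//.
  apply: (@H2_fatou R _ F _ (fun h => H2poly (g h) N)).
    move=> n /=; rewrite /trunc; case: ifP => _; first exact: hl.
    exact: cvg_cst.
  by apply: nearW => h; apply: le_trans (H2_norm_H2poly_le _ _) (gr h).
have lsq : l \in @sqsummable R.
  rewrite sqsummableE; apply/asboolP.
  suff /sq_bounded[] : forall n, series (fun k => nc (l k) ^+ 2) n <= r ^+ 2 by [].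
  by move=> n; rewrite /series /= big_mkord.
pose f0 : H2 R := MkH2 lsq.
have f0r : H2_rnorm f0 <= r by apply: H2_norm_le_sums.
exists (T f0); split; first by exists f0.
suff h : T (g h) @[h --> F] --> T f0.
  move=> A /h FA.
  apply: (@filterS2 _ F _ _ _ _ _ FK FA) => h' Kh /=; by rewrite (hg h').2.
apply/cvgH2P => e e0.
(* The difference from [f0] has norm at most [2 r], and removing its head at most doubles this;
   [4 (r + 1)] times the tolerance is [e / 2]. *)
have e1 : 0 < e / (8 * (r + 1)) by rewrite divr_gt0// mulr_gt0// ltr_wpDl.
have [M hM] := tails e1.
set c := \sum_(n < M) H2_rnorm (T (unit_vector n)).
have c0 : 0 <= c by apply: sumr_ge0 => n _; exact: H2_rnorm_ge0.
have e2 : 0 < e / (2 * (c + 1)) by rewrite divr_gt0// mulr_gt0// ltr_wpDl.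
have near_all : \forall h \near F, forall n : 'I_M, nc (f0 n - g h n) < e / (2 * (c + 1)).
  by apply: filter_forall => n; have /cvgcP /(_ _ e2) := hl n.
apply: filterS near_all => h hn.
rewrite -linearB; set p := f0 - g h.
have pr2 : H2_rnorm p <= 2 * r.
  by apply: le_trans (H2_ler_rnormD _ _) _; rewrite H2_rnormN; have := gr h; lra.
rewrite -(subrK (H2poly p M) p) linearD.
apply: le_lt_trans (H2_ler_rnormD _ _) _.
have h1 : H2_rnorm (T (p - H2poly p M)) <= e / 2.
  apply: le_trans (hM _ (@H2_tail_coef p M)) _.
  apply: (@le_trans _ _ (e / (8 * (r + 1)) * (4 * (r + 1)))).
    apply: ler_wpM2l; first exact: ltW.
    by apply: le_trans (H2_tail_norm _ _) _; lra.
  by rewrite le_eqVlt; apply/orP; left; apply/eqP; field; rewrite gt_eqF// ltr_wpDl.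
have h2 : H2_rnorm (T (H2poly p M)) < e / 2.
  apply: le_lt_trans (rnorm_image_H2poly _ _) _.
  apply: (@le_lt_trans _ _ (e / (2 * (c + 1)) * c)).
    rewrite mulr_sumr; apply: ler_sum => n _; rewrite ler_wpM2r ?H2_rnorm_ge0//.
    by apply/ltW; exact: hn.
  have cp : 0 < c + 1 by rewrite ltr_wpDl.
  rewrite (_ : _ * c = e / 2 * (c / (c + 1))); last by field; rewrite gt_eqF.
  rewrite -[ltRHS]mulr1 ltr_pM2l ?divr_gt0// ltr_pdivrMr// mul1r ltrDl//.
by rewrite [e]splitr; exact: ler_ltD.
Qed.

Lemma compact_of_tails : compact_operator T.
Proof.
move=> A /bounded_H2[r [r0 Ar]].
exists (T @` [set f | H2_rnorm f <= r]).
  by move=> _ [f Af <-]; exists f => //; exact: Ar.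
have cK := compact_image_ball r0.
by split => //; apply: compact_closed cK; exact: norm_hausdorff.
Qed.

End CompactnessFromTails.

Section PolynomialsToSeries.
Variable R : realType.
Variables (phi : R[i] -> R[i]) (T : {linear H2 R -> H2 R}).
Hypothesis phi_half : forall s : R[i], 0 < complex.Re s -> 1 / 2 < complex.Re (phi s).
Hypothesis phi_symbol : is_composition_operator phi T.

(** The images of the truncations converge pointwise because [phi] maps into the half-plane where
    [f] converges. Being bounded, they converge coefficientwise, and the norm estimate survives by
    [H2_fatou]. *)
Lemma tails_of_polynomials (e : R) (M : nat) : 0 <= e ->
  (forall a N, (forall n, (n < M)%N -> a n = 0) ->
    H2_rnorm (T (H2poly a N)) <= e * H2_rnorm (H2poly a N)) ->
  forall f : H2 R, (forall n, (n < M)%N -> f n = 0) -> H2_rnorm (T f) <= e * H2_rnorm f.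
Proof.
move=> e0 hp f f0.
have bd : \forall N \near \oo, H2_rnorm (T (H2poly f N)) <= e * H2_rnorm f.
  apply: nearW => N; apply: le_trans (hp _ _ f0) _.
  by rewrite ler_wpM2l// H2_norm_H2poly_le.
apply: (@H2_fatou R _ \oo _ (fun N => T (H2poly f N))); last exact: bd.
apply: (coef_cvg _ bd) => s hs.
rewrite phi_symbol// (_ : (fun N => _) = fun N => dirichlet f N (phi s)); last first.
  by apply/funext => N; rewrite phi_symbol// H2poly_eval.
apply: H2_eval_cvg; apply: phi_half.
by apply: lt_trans hs; rewrite divr_gt0.
Qed.

End PolynomialsToSeries.
(** * Test functions *)

Section TestFunctions.
Variable R : realType.

(* [sqrt l] times the reproducing kernel of [H2] at [1/2 + it], truncated where
   it resolves the scale [l]. *)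
Definition test_size (l : R) : nat := Num.truncn (expR l^-1).
Definition test_coef (t l : R) (k : nat) : R[i] :=
  (Num.sqrt l)%:C * nat_cpowN k.+1 (1 / 2 +i* (- t)).

Lemma harmonic_bounds N :
  ln N.+1%:R <= \sum_(k < N) (k.+1%:R^-1 : R) <= ln N.+1%:R + 2.
Proof.
have ln0 : ln 1 = 0 :> R by exact: ln1.
have E : \sum_(k < N) (ln k.+2%:R - ln k.+1%:R) = ln N.+1%:R :> R.
  by elim: N => [|N IH]; rewrite ?big_ord0 ?ln0// big_ord_recr /= IH; ring.
rewrite -{1 2}E; apply/andP; split.
  by apply: ler_sum => k _; have [] := @ln_succ_sub_bounds R k.+1 isT.
apply: le_trans (lerD (lexx _) (sum_inv_sqr_le R N)).
rewrite -big_split /=; apply: ler_sum => k _.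
by have [_ _ h] := @ln_succ_sub_bounds R k.+1 isT; rewrite -lerBlDl.
Qed.

Lemma test_size_ln (l : R) (k : nat) : 0 < l -> (k < test_size l)%N ->
  0 <= (ln k.+1%:R : R) <= l^-1.
Proof.
move=> l0 kN; rewrite ln_ge0 ?ler1n//=.
rewrite -[leRHS]expRK ler_ln ?posrE ?expR_gt0//.
by apply: le_trans (_ : (test_size l)%:R <= _); rewrite ?ler_nat// Num.Theory.truncn_le ?expR_ge0.
Qed.

Lemma test_size_ln_ge (l : R) : 0 < l -> l^-1 <= ln (test_size l).+1%:R :> R.
Proof.
move=> l0; rewrite -[leLHS]expRK ler_ln ?posrE ?expR_gt0//.
by rewrite ltW// Num.Theory.truncnS_gt.
Qed.

Lemma expRN_ln (n : nat) : (0 < n)%N -> expR (- ln n%:R) = n%:R^-1 :> R.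
Proof. by move=> n0; rewrite expRN lnK ?posrE ?ltr0n. Qed.

(** The squared norm is [l] times a harmonic sum of size at most [1/l + 3], that is at most
    [1 + 3 l <= 4]. *)
Lemma test_norm (t l : R) : 0 < l -> l <= 1 ->
  H2_rnorm (H2poly (test_coef t l) (test_size l)) <= 2.
Proof.
move=> l0 l1; rewrite -(@ler_pXn2r _ 2)// ?nnegrE ?H2_rnorm_ge0// H2poly_norm.
apply: (@le_trans _ _ (\sum_(k < test_size l) l * k.+1%:R^-1)).
  apply: ler_sum => k _; rewrite ncM ncR exprMn real_normK ?num_real// sqr_sqrtr ?(ltW l0)//.
  rewrite nc_nat_cpowN /= -expRM_natl -(expRN_ln (ltn0Sn k)) le_eqVlt; apply/orP; left; apply/eqP.
  by congr (_ * expR _); field.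
rewrite -mulr_sumr; have /andP[_ h] := harmonic_bounds (test_size l).
apply: le_trans (ler_wpM2l (ltW l0) h) _.
have e1 : 1 <= expR l^-1 by rewrite -expR0 ler_expR invr_ge0 ltW.
have N1 : (0 < test_size l)%N.
  have := Num.Theory.truncnS_gt (expR l^-1); rewrite -/(test_size l).
  by case: (test_size l) => // /(le_lt_trans e1); rewrite ltxx.
have [_ h1 _] := @ln_succ_sub_bounds R _ N1.
have /andP[_ h2] := @test_size_ln l (test_size l).-1 l0 (ltac:(by rewrite prednK)).
rewrite prednK// in h2.
have h3 : (test_size l)%:R^-1 <= 1 :> R by rewrite invf_le1 ?ltr0n// ler1n.
apply: (@le_trans _ _ (l * (l^-1 + 3))); first by rewrite ler_wpM2l ?(ltW l0)//; lra.
by rewrite mulrDr divff ?gt_eqF//; lra.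
Qed.

(** For [s] in the square and [ln n <= 1/l], both [(Re s - 1/2) ln n] and [(Im s - t) ln n] lie in
    [[0, 1]]; this is the least value of the damping times the cosine. *)
Definition test_const : R := expR (-1) * cos 1.

Lemma test_const_gt0 : 0 < test_const.
Proof. by rewrite mulr_gt0 ?expR_gt0 ?cos1_gt0. Qed.

Lemma cos_ge_cos1 (x : R) : 0 <= x <= 1 -> cos 1 <= cos x.
Proof.
move=> /andP[x0 x1]; have p2 := @pi_ge2 R.
rewrite le_eqVlt; have [->|xn] := eqVneq x 1; first by rewrite eqxx.
have x1' : x < 1 by rewrite lt_neqAle xn.
by rewrite (@ltr_cos R) ?x1' ?orbT// in_itv /=; apply/andP; split; lra.
Qed.

(** The truncation keeps every phase within one radian, so the real parts do not cancel and the sum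
    is at least [sqrt l] times a constant times a harmonic sum of size [1/l]. *)
Lemma test_lower (t l : R) s : 0 < l -> carleson_square (t, l) s ->
  test_const / Num.sqrt l <= nc (dirichlet (test_coef t l) (test_size l) s).
Proof.
move=> l0 [/= /andP[a1 a2] /andP[b1 b2]].
have sl : 0 < Num.sqrt l by rewrite sqrtr_gt0.
apply: le_trans (nc_Re _); apply: le_trans (ler_norm _); rewrite Re_sum.
apply: (@le_trans _ _ (\sum_(k < test_size l) Num.sqrt l * test_const * k.+1%:R^-1)).
  rewrite -mulr_sumr; have /andP[h _] := harmonic_bounds (test_size l).
  have h0 := le_trans (test_size_ln_ge l0) h.
  have c0 : 0 <= Num.sqrt l * test_const by rewrite mulr_ge0// ltW// test_const_gt0.
  apply: le_trans (ler_wpM2l c0 h0).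
  have -> : l^-1 = (Num.sqrt l)^-1 * (Num.sqrt l)^-1.
    by rewrite -invfM -expr2 sqr_sqrtr// ltW.
  rewrite le_eqVlt; apply/orP; left; apply/eqP.
  by field; rewrite gt_eqF.
apply: ler_sum => k _.
have /andP[n0 n1] := test_size_ln l0 (ltn_ord k).
rewrite /test_coef -[X in complex.Re X]mulrA ReZ -[leLHS]mulrA ler_wpM2l ?(ltW sl)//.
rewrite -nat_cpowND.
set n := ln k.+1%:R in n0 n1.
rewrite [X in nat_cpowN _ X](_ : _ = (1 + (complex.Re s - 1 / 2)) +i* (complex.Im s - t)); last first.
  by apply: complexP; rewrite ?(ReD, ImD) /=; [field|ring].
rewrite nat_cpowN_eit ReZ Re_eit -/n cosN.
have nl (x : R) : 0 <= x -> x <= l -> 0 <= x * n <= 1.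
  move=> x0 xl; rewrite mulr_ge0//=; apply: le_trans (ler_pM x0 n0 xl n1) _.
  by rewrite divff// gt_eqF.
have /andP[_ s1] : 0 <= (complex.Re s - 1 / 2) * n <= 1 by apply: nl; lra.
have c1 := cos_ge_cos1 (nl (complex.Im s - t) ltac:(lra) ltac:(lra)).
have e1 : expR (- n) * expR (-1) <= expR (- ((1 + (complex.Re s - 1 / 2)) * n)).
  by rewrite -expRD ler_expR; lra.
rewrite -(expRN_ln (ltn0Sn k)) -/n [leLHS]mulrC /test_const mulrA.
by apply: ler_pM; rewrite ?mulr_ge0 ?expR_ge0 ?(ltW (cos1_gt0 R)).
Qed.

Lemma test_eval (t l a : R) w : 0 < l -> 0 < a -> 1 / 2 + a <= complex.Re w ->
  nc (dirichlet (test_coef t l) (test_size l) w) <= Num.sqrt l * (1 + (1 + a) / a).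
Proof.
move=> l0 a0 aw; apply: le_trans (nc_sum _ _ _) _.
apply: (@le_trans _ _ (\sum_(k < test_size l) Num.sqrt l * expR (- ((1 + a) * ln k.+1%:R)))).
  apply: ler_sum => k _; rewrite /test_coef ncM ncM ncR ger0_norm ?sqrtr_ge0// -mulrA.
  rewrite ler_wpM2l ?sqrtr_ge0// !nc_nat_cpowN -expRD ler_expR /=.
  have n0 : 0 <= ln k.+1%:R :> R by rewrite ln_ge0// ler1n.
  have : (1 + a) * ln k.+1%:R <= (1 / 2 + complex.Re w) * ln k.+1%:R.
    by rewrite ler_wpM2r//; lra.
  lra.
rewrite -mulr_sumr ler_wpM2l ?sqrtr_ge0//.
case: (test_size l) => [|N]; first by rewrite big_ord0 addr_ge0// divr_ge0 ?addr_ge0// ltW.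
rewrite big_ord_recl /= ln1 mulr0 oppr0 expR0 lerD2l.
have := @zeta_tail_le R a 1 N.+1 a0 isT; rewrite ln1 mulr0 oppr0 expR0 mulr1.
by rewrite big_add1 big_mkord.
Qed.

End TestFunctions.

(** * Compactness implies the Carleson condition *)

Section Necessity.
Variable R : realType.
Variable m : probability (torus R) R.
Variables (phi : R[i] -> R[i]) (F : torus R -> R[i]) (T : {linear H2 R -> H2 R}).
Hypothesis phi_half : forall s : R[i], 0 < complex.Re s -> 1 / 2 < complex.Re (phi s).
Hypothesis phi_symbol : is_composition_operator phi T.
Hypothesis F_cmeas : cmeas F.
Hypothesis F_half : forall z, 1 / 2 <= complex.Re (F z).
Hypothesis T_norm : forall a N, H2_rnorm (T (H2poly a N)) = nrm m (fcomp F a N).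

Let g (t l : R) : H2 R := H2poly (test_coef t l) (test_size l).

Lemma carleson_le_norm (t l : R) : 0 < l ->
  pr m (F @^-1` carleson_square (t, l)) <= l * H2_rnorm (T (g t l)) ^+ 2 / test_const R ^+ 2.
Proof.
move=> l0; have c0 := test_const_gt0 R; have sl : 0 < Num.sqrt l by rewrite sqrtr_gt0.
have e0 : 0 < test_const R / Num.sqrt l by rewrite divr_gt0.
have lf := l2_fcomp m F_cmeas F_half (test_coef t l) (test_size l).
have := markov_nrm2 lf e0; rewrite -nrm_sqr -T_norm -/(g t l).
rewrite exprMn exprVn (sqr_sqrtr (ltW l0)) invfM invrK => h.
apply: le_trans (le_trans _ h) _; last first.
  by rewrite le_eqVlt; apply/orP; left; apply/eqP; ring.
apply: pr_mono.
- by rewrite (rect_carleson F); exact: measurable_rect.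
- by apply: measurable_nc_ge; [exact: l2_cmeas lf|exact: ltW].
- by move=> z /(test_lower l0).
Qed.

(** Compactness gives the images a norm limit [h] along an ultrafilter finer than [\oo]. They tend
    to 0 at every point, hence coefficientwise, so [h = 0]. One index with a small image is enough
    for the contradiction below. *)
Lemma test_image_cvg0 (t l : nat -> R) : compact_operator T ->
  (forall n, 0 < l n <= n.+1%:R^-1) ->
  forall e : R, 0 < e -> exists n, H2_rnorm (T (g (t n) (l n))) < e.
Proof.
move=> cT lP e e0.
have l0 n : 0 < l n by have /andP[] := lP n.
have l1 n : l n <= 1.
  by have /andP[_ h] := lP n; apply: le_trans h _; rewrite invf_le1 ?ltr0n// ler1n.
pose A := [set f : H2 R | H2_rnorm f <= 2].
have bA : bounded_set A.
  exists 2%:C; split; first by rewrite realE lecR ler0n.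
  move=> x hx f Af; apply: le_trans (ltW hx).
  by rewrite le_H2_rnorm.
have [U UA [cU _]] := cT A bA.
have [G [GU sG]] := ultraFilterLemma (_ : ProperFilter (\oo : set_system nat)).
pose u n := T (g (t n) (l n)).
have uU n : U (u n) by apply: UA; exists (g (t n) (l n)) => //; exact: test_norm.
have [h [_ uh]] : U `&` [set p | u n @[n --> G] --> p] !=set0.
  move: cU; rewrite compact_ultra; apply; first exact: ultra_fmap.
  by apply: (@filterS _ G _ setT); [move=> n _; exact: uU|exact: filterT].
have l_cvg : forall d : R, 0 < d -> \forall n \near G, Num.sqrt (l n) <= d.
  move=> d d0; apply: sG.
  have d2 : 0 < d ^+ 2 by rewrite exprn_gt0.
  near=> n; have /andP[_ ln] := lP n.
  rewrite -[leRHS](ger0_norm (ltW d0)) -sqrtr_sqr ler_wsqrtr//; apply: le_trans ln _.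
  rewrite invf_ple ?posrE ?ltr0n//; near: n.
  exists (Num.truncn (d ^+ 2)^-1) => // n /= hn.
  apply: le_trans (ltW (Num.Theory.truncnS_gt _)) _; by rewrite ler_nat.
have coef0 : forall n, u k n @[k --> G] --> (0 : H2 R) n.
  have bd : \forall k \near G, H2_rnorm (u k) <= H2_rnorm h + 1.
    have /cvgH2P/(_ 1 ltr01) := uh; apply: filterS => k hk.
    have -> : u k = h - (h - u k) by rewrite opprB addrC subrK.
    apply: le_trans (H2_ler_rnormD _ _) _; rewrite H2_rnormN lerD2l; exact: ltW.
  apply: (coef_cvg _ bd) => s hs.
  have hs0 : 0 < complex.Re s by apply: lt_trans hs; rewrite divr_gt0.
  have h0 : H2_eval (0 : H2 R) s = 0.
    rewrite (_ : (0 : H2 R) = H2poly (fun=> 0) 0); last by apply/val_inj/funext.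
    by rewrite H2poly_eval /dirichlet big_ord0.
  rewrite h0; apply/cvgcP => d d0.
  pose a := complex.Re (phi s) - 1 / 2.
  have a0 : 0 < a by rewrite subr_gt0; exact: phi_half.
  pose c := 1 + (1 + a) / a.
  have c0 : 0 < c by rewrite addr_gt0// divr_gt0// addr_gt0.
  have d1 : 0 < d / (c + c) by rewrite divr_gt0// addr_gt0.
  have := l_cvg _ d1; apply: filterS => k hk.
  rewrite sub0r ncN phi_symbol// H2poly_eval.
  apply: le_lt_trans (test_eval _ (l0 k) a0 _) _; first by rewrite /a addrC subrK.
  rewrite -/c; apply: le_lt_trans (ler_wpM2r (ltW c0) hk) _.
  rewrite (_ : d / (c + c) * c = d / 2); last by field; rewrite gt_eqF// addr_gt0.
  by rewrite ltr_pdivrMr// ltr_pMr// ltr1n.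
have hz : h = 0.
  apply/val_inj/funext => n /=; apply/eqP; rewrite -nc_eq0 eq_le normc_ge0 andbT.
  apply/ler_addgt0Pr => d d0; rewrite add0r.
  have d2 : 0 < d / 2 by rewrite divr_gt0.
  have /cvgH2P/(_ _ d2) h1 := uh.
  have /cvgcP/(_ _ d2) h2 := coef0 n.
  have [k [k1 k2]] := filter_ex (filterI h1 h2).
  have -> : h n = (h - u k) n + u k n by rewrite H2_subE subrK.
  apply: le_trans (ncD _ _) _; rewrite [leRHS]splitr; apply: lerD.
    by apply: le_trans (H2_coef_le _ _) (ltW k1).
  by apply/ltW; move: k2; rewrite sub0r ncN.
have /cvgH2P/(_ _ e0) := uh; rewrite hz => /filter_ex[k hk].
by exists k; move: hk; rewrite sub0r H2_rnormN.
Unshelve. all: by end_near. Qed.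

Lemma carleson_of_compact : compact_operator T -> forall e : R, 0 < e ->
  exists d, 0 < d /\ forall t l, 0 < l -> l <= d ->
    pr m (F @^-1` carleson_square (t, l)) <= e * l.
Proof.
move=> cT e e0; apply: contrapT => no.
(* If the condition fails for [e], each scale has a square of too large mass. Its position is
   uncontrolled, which is why the test functions are bounded uniformly in [t]. *)
have bad n : exists tl : R * R, 0 < tl.2 <= n.+1%:R^-1 /\
    e * tl.2 < pr m (F @^-1` carleson_square (tl.1, tl.2)).
  apply: contrapT => nn; apply: no; exists n.+1%:R^-1; split; first by rewrite invr_gt0 ltr0n.
  move=> t l l0 ln; rewrite leNgt; apply/negP => h; apply: nn.
  by exists (t, l); rewrite /= l0.
have /choice[tl htl] := bad.
have c0 := test_const_gt0 R.
have e1 : 0 < Num.sqrt e * test_const R by rewrite mulr_gt0// sqrtr_gt0.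
have [n hn] := @test_image_cvg0 (fun n => (tl n).1) (fun n => (tl n).2) cT (fun n => (htl n).1) _ e1.
have [/andP[l0 _] hl] := htl n.
have := lt_le_trans hl (carleson_le_norm _ l0).
apply/negP; rewrite -leNgt -mulrA mulrC ler_wpM2r ?(ltW l0)//.
rewrite ler_pdivrMr ?exprn_gt0//.
have -> : e * test_const R ^+ 2 = (Num.sqrt e * test_const R) ^+ 2.
  by rewrite [RHS]exprMn sqr_sqrtr// ltW.
by apply: lerXn2r; rewrite ?nnegrE ?H2_rnorm_ge0//; exact: ltW.
Qed.

End Necessity.

(** * The limsup condition in epsilon-delta form *)

Section CarlesonLimsup.
Variable R : realType.
Variable m : probability (torus R) R.
Variables (G F : torus R -> R[i]) (A : set (torus R)).
Hypothesis G_cmeas : cmeas G.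
Hypothesis F_cmeas : cmeas F.
Hypothesis A_null : null_set m A.
Hypothesis F_eq : forall z, ~ A z -> F z = G z.

Lemma pr_carleson_eq Q :
  pr m (G @^-1` carleson_square Q) = pr m (F @^-1` carleson_square Q).
Proof.
case: Q => t l; have [mA A0] := A_null.
have mG : measurable (G @^-1` carleson_square (t, l)).
  by rewrite rect_carleson; exact: measurable_rect.
have mF : measurable (F @^-1` carleson_square (t, l)).
  by rewrite rect_carleson; exact: measurable_rect.
have le (X Y : set (torus R)) : measurable X -> measurable Y -> X `<=` Y `|` A ->
    pr m X <= pr m Y.
  move=> mX mY XY; apply: le_trans (pr_mono m mX (measurableU _ _ mY mA) XY) _.
  by apply: le_trans (pr_setU_le m mY mA) _; rewrite A0 addr0.
apply/eqP; rewrite eq_le; apply/andP; split; apply: le => // z /= hz.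
  have [Az|nA] := pselect (A z); [by right|left].
  by rewrite F_eq.
have [Az|nA] := pselect (A z); [by right|left].
by rewrite -F_eq.
Qed.

Let ratio (Q : R * R) := (m (G @^-1` carleson_square Q) * (Q.2^-1)%:E)%E.

Lemma ratioE Q : ratio Q = (pr m (F @^-1` carleson_square Q) / Q.2)%:E.
Proof.
rewrite /ratio prE ?pr_carleson_eq//; case: Q => t l.
by rewrite rect_carleson; exact: measurable_rect.
Qed.

Lemma limsup_carlesonP :
  limf_esup ratio (@carleson_to0 R) = 0%E <->
  forall e : R, 0 < e -> exists d, 0 < d /\ forall t l, 0 < l -> l <= d ->
    pr m (F @^-1` carleson_square (t, l)) <= e * l.
Proof.
split=> [lim0 e e0|h].
  have : (limf_esup ratio (@carleson_to0 R) < e%:E)%E by rewrite lim0 lte_fin.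
  rewrite limf_esupE => /ereal_inf_lt[_ [V [d /= d0 dV] <-] supV].
  (* The filter base requires a side strictly less than [d], while the epsilon form allows
     equality. *)
  exists (d / 2); split; first by rewrite divr_gt0.
  move=> t l l0 ld; rewrite -ler_pdivrMr// -lee_fin -(ratioE (t, l)).
  apply/ltW; apply: le_lt_trans supV; apply: ereal_sup_ubound.
  exists (t, l) => //; apply: dV; rewrite /= l0.
  by apply: le_lt_trans ld _; rewrite ltr_pdivrMr// ltr_pMr// ltr1n.
apply/eqP; rewrite eq_le; apply/andP; split.
  apply/lee_addgt0Pr => e e0; rewrite add0e.
  have [d [d0 hd]] := h _ e0.
  apply: ge_ereal_inf; exists (ereal_sup (ratio @` [set Q | 0 < Q.2 < d])).
    by exists [set Q | 0 < Q.2 < d] => //; exists d.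
  apply: ge_ereal_sup => _ [[t l] /= /andP[l0 ld] <-].
  by rewrite ratioE lee_fin ler_pdivrMr//; apply: hd => //; exact: ltW.
apply: le_ereal_inf_tmp => _ [V [d /= d0 dV] <-].
(* A square in every set of the filter keeps the suprema nonnegative; an empty one would be minus
   infinity. *)
have Vd : V (0, d / 2).
  by apply: dV; rewrite /= divr_gt0//= ltr_pdivrMr// ltr_pMr// ltr1n.
apply: le_trans (ereal_sup_ubound _); last by exists (0, d / 2); [exact: Vd|].
by rewrite ratioE lee_fin mulr_ge0 ?pr_ge0//= invr_ge0 divr_ge0// ltW.
Qed.

End CarlesonLimsup.

Theorem corollary4p1 (R : realType) (m : probability (torus R) R)
    (c : nat -> R[i]) (phi : R[i] -> R[i]) (C_phi : {linear H2 R -> H2 R})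
    (PhiS : torus R -> R[i])
    (m_haar : is_haar m)
    (phi_series : forall e : R, 0 < e ->
      {uniform halfplane e, dirichlet c @ \oo --> phi})
    (phi_symbol : is_composition_operator phi C_phi)
    (phi_bounded : bounded_set (phi @` halfplane 0))
    (phi_range : phi @` halfplane 0 `<=` halfplane (1 / 2))
    (PhiS_boundary : is_boundary_function m c PhiS) :
  compact_operator C_phi <->
  limf_esup
    (fun Q : R * R => (m (PhiS @^-1` carleson_square Q) * (Q.2^-1)%:E)%E)
    (@carleson_to0 R) = 0%E.
Proof.
have phi_half s : 0 < complex.Re s -> 1 / 2 < complex.Re (phi s).
  by move=> s0; apply: phi_range; exists s.
have [B phi_B] : exists B, forall s, 0 < complex.Re s -> nc (phi s) <= B.
  have [M [Mr hM]] := phi_bounded; exists (nc M + 1) => s s0.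
  rewrite -lecR -normc_nc; apply: hM; last by exists s.
  apply: le_lt_trans (real_ler_norm Mr) _; rewrite normc_nc ltcR.
  by rewrite ltrDl ltr01.
have [F [F_cmeas F_half F_B [A [A_null F_eq]]]] :=
  exists_PhiR m_haar phi_series phi_half phi_B PhiS_boundary.
have l2S : l2 m PhiS := l2_PhiS PhiS_boundary.
have l2F : l2 m F := l2_bounded m F_cmeas F_B.
have F_PhiS : nrm m (fun z => F z - PhiS z) <= 0.
  apply: (nrm_le_ae A_null.1 A_null.2 (l2B l2F l2S)) => // z nA.
  by rewrite F_eq// subrr nc0.
(* [F] and [PhiS] are at [L^2] distance 0, so approximations of the boundary function transfer to
   its everywhere bounded version. *)
have approx (e : R) : 0 < e -> exists x b N, [/\ 0 < x <= e,
    forall s, 0 <= complex.Re s -> nc (dirichlet b N s - phi (s + x%:C)) <= e &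
    nrm m (fun z => F z - lift b N z) <= e].
  move=> e0; have [x [b [N [x0 hb hS]]]] := phi_lift_approx m_haar phi_series PhiS_boundary e0.
  exists x, b, N; split => //.
  apply: le_trans (nrm_triangleB l2F l2S (l2_lift m b N)) _.
  by rewrite -[leRHS]add0r; exact: lerD.
have T_norm := norm_identity m_haar phi_half phi_B F_cmeas F_half F_B approx phi_symbol.
rewrite (limsup_carlesonP (l2_cmeas l2S) F_cmeas A_null F_eq); split=> [cT|van].
  exact: carleson_of_compact phi_half phi_symbol F_cmeas F_half T_norm cT.
apply: compact_of_tails => e e0.
(* [small_on_tails] bounds squared norms, hence the tolerance [e^2]. *)
have [M hM] := small_on_tails F_cmeas F_half F_B van (exprn_gt0 2 e0).
exists M; apply: (tails_of_polynomials phi_half phi_symbol (ltW e0)) => a N a0.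
rewrite T_norm -(@ler_pXn2r _ 2)// ?nnegrE ?nrm_ge0//; last first.
  by rewrite mulr_ge0 ?H2_rnorm_ge0// ltW.
by rewrite nrm_sqr exprMn H2poly_norm; exact: hM.
Qed.
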